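(* For every natural number $n\ge 0$, the $\omega$-category $c^n(1)$ obtained by applying the cylinder construction $c$ $n$ times to the terminal $\omega$-category $1$ is isomorphic, as an $\omega$-category, to the $n$th cube $\mathcal{Q}(n)$.
   Context: **$\omega$-categories.** ''$\omega$-category'' means small strict globular $\omega$-category: a globular set $X$ (sets $X_n$ with $s,t\colon X_{n+1}\to X_n$, $ss=st$, $ts=tt$) with identities $i\colon X_n\to X_{n+1}$ and compositions $\circ_n$ of $k$-cells for all $0\le n<k$, satisfying the usual axioms. For a $k$-cell $x$ and $n<k$, $s_nx,t_nx\in X_n$ are its iterated source and target, the pair $(s_nx,t_nx)$ is its $n$-boundary (also, $s_kx=t_kx=x$), and $y\circ_n x$ is defined when $t_n(x)=s_n(y)$. Cells $x,y$ of the same dimension are parallel if they are $0$-cells or $(sx,tx)=(sy,ty)$. $x\colon y\to z$ means $sx=y$, $tx=z$. For $a,b\in X_0$, $X(a,b)$ is the $\omega$-category whose $n$-cells are the $(n+1)$-cells of $X$ with $0$-boundary $(a,b)$, with composition $\circ_n$ given by $\circ_{n+1}$ in $X$. In this way $\omega$-categories are identified with categories enriched in $\omega\text{-}\mathbf{Cat}$ (with its cartesian product), enriched composition $X(b,c)\times X(a,b)\to X(a,c)$ being $\circ_0$. The dual $X^{\mathrm{op}}$ is obtained by interchanging $s$ and $t$ in every dimension, with the same identities and with all compositions reversed. An isomorphism of $\omega$-categories is an invertible $\omega$-functor (map of globular sets preserving identities and compositions). **Conventions.** $\circ_n$ binds more tightly than $\circ_k$ when $n<k$. When cells of different dimensions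 are composed, the lower-dimensional one is replaced by the iterated identity on it (whiskering). **Lax coslice.** For an $\omega$-category $X$ and $a\in X_0$, the $\omega$-category $a/X$ is as follows. - $0$-cells $\boldsymbol{x}=(x,\bar x)$: pairs $x\in X_0$, $\bar x\colon a\to x$ in $X$. - $(n+1)$-cells $\boldsymbol{x}=(x,\bar x)$ with $i$-boundary $(\boldsymbol m_i,\boldsymbol p_i)=((m_i,\bar m_i),(p_i,\bar p_i))$ for $i\le n$ (so $(\boldsymbol m_n,\boldsymbol p_n)$ is a parallel pair of $n$-cells): for $n$ even, pairs $$x\colon m_n\to p_n,\quad \bar x\colon \bar p_{n-1}\circ_{n-1}\cdots\bar p_3\circ_3\bar p_1\circ_1 x\circ_0\bar m_0\circ_2\bar m_2\cdots\circ_n\bar m_n\to\bar p_n;$$ for $n$ odd, pairs $$x\colon m_n\to p_n,\quad \bar x\colon\bar m_n\to\bar p_n\circ_n\cdots\bar p_3\circ_3\bar p_1\circ_1 x\circ_0\bar m_0\circ_2\bar m_2\cdots\circ_{n-1}\bar m_{n-1}.$$ - Composition: if $\boldsymbol x,\boldsymbol y$ are $k$-cells with $k>n$, $t_n(\boldsymbol x)=s_n(\boldsymbol y)$, and common $i$-boundary $(\boldsymbol m_i,\boldsymbol p_i)$ for $i<n$, then $\boldsymbol y\circ_n\boldsymbol x$ is, for $n$ even, $$(y\circ_n x,\ \bar y\circ_{n+1}\bar p_{n-1}\circ_{n-1}\cdots\bar p_3\circ_3\bar p_1\circ_1 s_{n+1}y\circ_0\bar m_0\circ_2\bar m_2\cdots\circ_{n-2}\bar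 m_{n-2}\circ_n\bar x),$$ and for $n$ odd, $$(y\circ_n x,\ \bar y\circ_n\bar p_{n-2}\circ_{n-2}\cdots\bar p_3\circ_3\bar p_1\circ_1 t_{n+1}x\circ_0\bar m_0\circ_2\bar m_2\cdots\circ_{n-1}\bar m_{n-1}\circ_{n+1}\bar x).$$ - The identity on $(x,\bar x)$ is $(ix,i\bar x)$. The projection $\pi\colon a/X\to X$, $\pi(x,\bar x)=x$, is an $\omega$-functor. **Lax slice and bislice.** For $b\in X_0$, the lax slice is $X/b=(b/X^{\mathrm{op}})^{\mathrm{op}}$. Explicitly, $0$-cells are pairs $(x,\hat x)$ with $\hat x\colon x\to b$; $(n+1)$-cells $(x,\hat x)$ with $i$-boundaries $(\boldsymbol m_i,\boldsymbol p_i)=((m_i,\hat m_i),(p_i,\hat p_i))$ have $x\colon m_n\to p_n$ and, for $n$ even, $$\hat x\colon\hat m_n\to\hat p_n\circ_n\cdots\hat p_2\circ_2\hat p_0\circ_0 x\circ_1\hat m_1\circ_3\hat m_3\cdots\circ_{n-1}\hat m_{n-1},$$ and for $n$ odd, $$\hat x\colon\hat p_{n-1}\circ_{n-1}\cdots\hat p_2\circ_2\hat p_0\circ_0 x\circ_1\hat m_1\circ_3\hat m_3\cdots\circ_n\hat m_n\to\hat p_n,$$ with composition dual to that of the lax coslice. The lax bislice $a/X/b$ is the pullback $a/X\times_X X/b$ of $\omega$-categories over the projections to $X$; its cells are triples $(x,\bar x,\hat x)$ with $(x,\bar x)$ a cell of $a/X$ and $(x,\hat x)$ a cell of $X/b$.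 **Actions.** There are $\omega$-functors $a/X\times X(b,a)\to b/X$ given on cells of all dimensions by $(x,\bar x)\cdot h=(x,\bar x\circ_0h)$, and dually $X(b,c)\times X/b\to X/c$ given by $k\cdot(x,\hat x)=(x,k\circ_0\hat x)$ (sources and targets being computed componentwise). They make $(a,b)\mapsto a/X/b$ an $X$-$X$-bimodule, with right action in $a$ inherited from $a/X$ and left action in $b$ inherited from $X/b$. **Cylinder.** The cylinder $c(X)$ is the collage of this bimodule: the $\omega\text{-}\mathbf{Cat}$-category (equivalently $\omega$-category) whose object set is the disjoint union of two copies $X_0^{l}+X_0^{r}$ of $X_0$, with homs $c(X)(u,v)=X(u,v)$ if $u,v$ are both in $X_0^l$ or both in $X_0^r$; $c(X)(u,v)=u/X/v$ if $u\in X_0^l$, $v\in X_0^r$; and $c(X)(u,v)=\emptyset$ if $u\in X_0^r$, $v\in X_0^l$; the non-trivial compositions are those of $X$ (in each copy) together with the right and left action maps of the bimodule. **Cubes.** Let $\langle n\rangle$ be the set of strings of length $n$ in the symbols $\ominus,\odot,\oplus$, and $\langle n\rangle_j$ the subset of strings in which $\odot$ appears exactly $j$ times. For $j>0$ and $a\in\langle n\rangle_j$ set $a^-=\{a\delta_i^-:1\le i\le j\}$ and $a^+=\{a\delta_i^+:1\le i\le j\}$, subsets of $\langle n\rangle_{j-1}$, where $a\delta_i^-$ is obtained from $a$ by replacing the $i$th occurrence of $\odot$ by $\ominus$ if $i$ is odd and by $\oplus$ if $i$ is even, and $a\delta_i^+$ by replacing the $i$th occurrence of $\odot$ by $\oplus$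 if $i$ is odd and by $\ominus$ if $i$ is even. For $\xi\subset\langle n\rangle_j$, $\xi^\pm=\bigcup_{a\in\xi}a^\pm$. The $n$th cube $\mathcal Q(n)$ is the following $\omega$-category (its well-definedness is known from Street's theory of parity complexes). - $0$-cells are elements of $\langle n\rangle_0$, identified with the corresponding singleton subsets. - $(j+1)$-cells $\xi$ with successive $k$-boundaries $(\mu_k,\pi_k)$ for $k\le j$ (so $\mu_j,\pi_j$ is a parallel pair of $j$-cells) are finite subsets $\xi\subset\langle n\rangle_{j+1}$ such that: (i) if $a\ne b\in\xi$ then $a^+\cap b^+=a^-\cap b^-=\emptyset$; (ii) $\pi_j=(\mu_j\cup\xi^+)\setminus\xi^-$ and $\mu_j=(\pi_j\cup\xi^-)\setminus\xi^+$ in $\langle n\rangle_j$ (here a cell is denoted by its underlying subset; the boundary is part of the data of a cell). - For $(j+1)$-cells $\xi\colon x\to y$, $\zeta\colon y\to z$, the $\circ_j$-composite is $\zeta\cup\xi\colon x\to z$; for $(j+1)$-cells $\xi\colon x\to y$, $\zeta\colon w\to z$ with $t_i(\xi)=s_i(\zeta)$, $i<j$, the $\circ_i$-composite is $\zeta\cup\xi\colon w\circ_i x\to z\circ_i y$. - The identity on a $j$-cell $x$ is $\emptyset\colon x\to x$. *)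

(* Defs.v *)
From mathcomp Require Import all_boot.

Set Implicit Arguments.
Unset Strict Implicit.
Unset Printing Implicit Defensive.

(* Iterated boundaries and iterated identities in one total function: for
   [n <= k], [move d u k n] is the (k - n)-fold iterate of [d], and for [k <= n]
   it is the (n - k)-fold iterate of [u]; see the three lemmas below.  The
   recursion shifts the graded type so that no cast between dimensions occurs. *)
Fixpoint move (C : nat -> Type) (d : forall n, C n.+1 -> C n)
    (u : forall n, C n -> C n.+1) (k n : nat) {struct k} : C k -> C n :=
  match k return C k -> C n with
  | 0 => fun x => nat_rect C x u n
  | k'.+1 =>
    match n return C k'.+1 -> C n with
    | 0 => fun x => @move C d u k' 0 (d k' x)
    | n'.+1 => @move (fun m => C m.+1) (fun m => d m.+1) (fun m => u m.+1) k' n'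
    end
  end.

Lemma move_id C d u k (x : C k) : @move C d u k k x = x.
Proof. by elim: k C d u x => //= k IH C d u x; rewrite IH. Qed.

Lemma move_down C d u k n (x : C k.+1) :
  n <= k -> @move C d u k.+1 n x = @move C d u k n (d k x).
Proof.
elim: k n C d u x => [|k IH] [|n] C d u x //= le_nk.
exact: (IH n (fun m => C m.+1)).
Qed.

Lemma move_up C d u k n (x : C k) :
  k <= n -> @move C d u k n.+1 x = u n (@move C d u k n x).
Proof.
elim: k n C d u x => [|k IH] [|n] C d u x //= le_kn.
exact: (IH n (fun m => C m.+1)).
Qed.

(* The set of n-cells is a subset [is_cell n] of an ambient type [amb n].  The
   operations are total on the ambient types; [comp k n y x] is the composite of
   the k-cells [y] and [x] along their n-boundary, which is meaningful only for
   cells with [n < k] and [composable n y x]. *)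
Record omega_data := OmegaData {
  amb : nat -> Type;
  is_cell : forall n, amb n -> Prop;
  src : forall n, amb n.+1 -> amb n;
  tgt : forall n, amb n.+1 -> amb n;
  idc : forall n, amb n -> amb n.+1;
  comp : forall k, nat -> amb k -> amb k -> amb k
}.

Arguments is_cell X {n} x : rename.
Arguments src {X n} x : rename.
Arguments tgt {X n} x : rename.
Arguments idc {X n} x : rename.
Arguments comp {X k} n y x : rename.

(* For [n <= k], [sbd n x] and [tbd n x] are the n-source and n-target of the
   k-cell [x]. *)
Definition sbd {X : omega_data} {k} (n : nat) (x : amb X k) : amb X n :=
  move (@src X) (@idc X) n x.
Definition tbd {X : omega_data} {k} (n : nat) (x : amb X k) : amb X n :=
  move (@tgt X) (@idc X) n x.
(* Used for [k <= n] only, where it is the iterated identity. *)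
Definition lift {X : omega_data} {k} (n : nat) (x : amb X k) : amb X n :=
  move (@src X) (@idc X) n x.

Definition composable {X : omega_data} {k} (n : nat) (y x : amb X k) : Prop :=
  tbd n x = sbd n y.

Record is_omega_category (X : omega_data) : Prop := {
  src_cell : forall n (x : amb X n.+1), is_cell X x -> is_cell X (src x);
  tgt_cell : forall n (x : amb X n.+1), is_cell X x -> is_cell X (tgt x);
  idc_cell : forall n (x : amb X n), is_cell X x -> is_cell X (idc x);
  comp_cell : forall k n (y x : amb X k), n < k ->
    is_cell X y -> is_cell X x -> composable n y x -> is_cell X (comp n y x);
  src_src : forall n (x : amb X n.+2), is_cell X x -> src (src x) = src (tgt x);
  tgt_tgt : forall n (x : amb X n.+2), is_cell X x -> tgt (src x) = tgt (tgt x);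
  src_idc : forall n (x : amb X n), is_cell X x -> src (idc x) = x;
  tgt_idc : forall n (x : amb X n), is_cell X x -> tgt (idc x) = x;
  src_comp_top : forall n (y x : amb X n.+1),
    is_cell X y -> is_cell X x -> composable n y x -> src (comp n y x) = src x;
  tgt_comp_top : forall n (y x : amb X n.+1),
    is_cell X y -> is_cell X x -> composable n y x -> tgt (comp n y x) = tgt y;
  src_comp : forall k n (y x : amb X k.+1), n < k ->
    is_cell X y -> is_cell X x -> composable n y x ->
    src (comp n y x) = comp n (src y) (src x);
  tgt_comp : forall k n (y x : amb X k.+1), n < k ->
    is_cell X y -> is_cell X x -> composable n y x ->
    tgt (comp n y x) = comp n (tgt y) (tgt x);
  compA : forall k n (z y x : amb X k), n < k ->
    is_cell X z -> is_cell X y -> is_cell X x ->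
    composable n z y -> composable n y x ->
    comp n z (comp n y x) = comp n (comp n z y) x;
  comp_idr : forall k n (x : amb X k), n < k -> is_cell X x ->
    comp n x (lift k (sbd n x)) = x;
  comp_idl : forall k n (x : amb X k), n < k -> is_cell X x ->
    comp n (lift k (tbd n x)) x = x;
  idc_comp : forall k n (y x : amb X k), n < k ->
    is_cell X y -> is_cell X x -> composable n y x ->
    idc (comp n y x) = comp n (idc y) (idc x);
  interchange : forall k m n (y' y x' x : amb X k), n < m -> m < k ->
    is_cell X y' -> is_cell X y -> is_cell X x' -> is_cell X x ->
    composable m y' y -> composable m x' x -> composable n y x ->
    comp n (comp m y' y) (comp m x' x) = comp m (comp n y' x') (comp n y x)
}.

Record is_omega_functor (X Y : omega_data) (f : forall n, amb X n -> amb Y n)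
    : Prop := {
  fun_cell : forall n (x : amb X n), is_cell X x -> is_cell Y (f n x);
  fun_src : forall n (x : amb X n.+1), is_cell X x -> f n (src x) = src (f n.+1 x);
  fun_tgt : forall n (x : amb X n.+1), is_cell X x -> f n (tgt x) = tgt (f n.+1 x);
  fun_idc : forall n (x : amb X n), is_cell X x -> f n.+1 (idc x) = idc (f n x);
  fun_comp : forall k n (y x : amb X k), n < k ->
    is_cell X y -> is_cell X x -> composable n y x ->
    f k (comp n y x) = comp n (f k y) (f k x)
}.

Definition isomorphic (X Y : omega_data) : Prop :=
  exists (f : forall n, amb X n -> amb Y n) (g : forall n, amb Y n -> amb X n),
    [/\ is_omega_functor f, is_omega_functor g,
        forall n (x : amb X n), is_cell X x -> g n (f n x) = x
      & forall n (y : amb Y n), is_cell Y y -> f n (g n y) = y].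

Definition terminal : omega_data :=
  @OmegaData (fun _ => unit) (fun _ _ => True) (fun _ _ => tt) (fun _ _ => tt)
    (fun _ _ => tt) (fun _ _ _ _ => tt).

Definition op (X : omega_data) : omega_data :=
  @OmegaData (amb X) (@is_cell X) (@tgt X) (@src X) (@idc X)
    (fun k n y x => comp n x y).

(* An element of [tower D n.+1] is ((source, target), label): the cell includes
   its successive boundaries as data. *)
Section Tower.

Variable D : nat -> Type.

Fixpoint tower (n : nat) : Type :=
  if n is m.+1 then ((tower m * tower m) * D m.+1)%type else D 0.

Definition tlab n : tower n -> D n :=
  match n return tower n -> D n with 0 => fun x => x | _.+1 => fun x => x.2 end.

Definition tsrc n (x : tower n.+1) : tower n := x.1.1.
Definition ttgt n (x : tower n.+1) : tower n := x.1.2.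

Definition tparallel n : tower n -> tower n -> Prop :=
  match n return tower n -> tower n -> Prop with
  | 0 => fun _ _ => True
  | _.+1 => fun x y => tsrc x = tsrc y /\ ttgt x = ttgt y
  end.

Variable lab_id : forall n, D n -> D n.+1.

Definition tid n (x : tower n) : tower n.+1 := ((x, x), lab_id (tlab x)).

Variable lab_comp : forall k, nat -> tower k -> tower k -> D k.

Fixpoint tcomp k (n : nat) : tower k -> tower k -> tower k :=
  match k return tower k -> tower k -> tower k with
  | 0 => fun y _ => y
  | k'.+1 => fun y x =>
      ((if n == k' then (tsrc x, ttgt y)
        else (@tcomp k' n (tsrc y) (tsrc x), @tcomp k' n (ttgt y) (ttgt x))),
       @lab_comp k'.+1 n y x)
  end.

End Tower.

Section Coslice.

Variables (X : omega_data) (a : amb X 0).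

(* The label of an n-cell is the pair [(x, xbar)], with [xbar] an (n+1)-cell. *)
Definition cos_lab (n : nat) : Type := (amb X n * amb X n.+1)%type.
Definition cos_amb : nat -> Type := tower cos_lab.

Definition base n (c : cos_amb n) : amb X n := (tlab c).1.
Definition bar n (c : cos_amb n) : amb X n.+1 := (tlab c).2.

Definition cos_lab_id n (l : cos_lab n) : cos_lab n.+1 := (idc l.1, idc l.2).
Definition cos_id : forall n, cos_amb n -> cos_amb n.+1 := @tid cos_lab cos_lab_id.

Definition mbar k (c : cos_amb k) (i : nat) : amb X i.+1 :=
  bar (move (@tsrc cos_lab) cos_id i c).
Definition pbar k (c : cos_amb k) (i : nat) : amb X i.+1 :=
  bar (move (@ttgt cos_lab) cos_id i c).

(* [whisk c u j] is
     ... pbar_3 o_3 pbar_1 o_1 u o_0 mbar_0 o_2 mbar_2 ...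
   with all factors [mbar_i] (i even) and [pbar_i] (i odd) such that i < j, the
   compositions being performed in the order o_0, o_1, o_2, ... *)
Fixpoint whisk k (c : cos_amb k) K (u : amb X K) (j : nat) : amb X K :=
  if j is i.+1 then
    if odd i then comp i (lift K (pbar c i)) (whisk c u i)
    else comp i (whisk c u i) (lift K (mbar c i))
  else u.

Fixpoint cos_cell n : cos_amb n -> Prop :=
  match n return cos_amb n -> Prop with
  | 0 => fun c =>
      [/\ is_cell X (base c), is_cell X (bar c),
          src (bar c) = a & tgt (bar c) = base c]
  | m.+1 => fun c =>
      [/\ cos_cell (tsrc c), cos_cell (ttgt c) & tparallel (tsrc c) (ttgt c)] /\
      [/\ is_cell X (base c), src (base c) = base (tsrc c)
        & tgt (base c) = base (ttgt c)] /\
      is_cell X (bar c) /\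
      if odd m then
        src (bar c) = bar (tsrc c) /\ tgt (bar c) = whisk c (base c) m.+1
      else
        src (bar c) = whisk c (base c) m.+1 /\ tgt (bar c) = bar (ttgt c)
  end.

Definition cos_lab_comp k (n : nat) (y x : cos_amb k) : cos_lab k :=
  (comp n (base y) (base x),
   if odd n then
     comp n.+1 (comp n (bar y) (whisk x (lift k.+1 (tbd n.+1 (base x))) n)) (bar x)
   else
     comp n.+1 (bar y) (comp n (whisk x (lift k.+1 (sbd n.+1 (base y))) n) (bar x))).

Definition coslice : omega_data :=
  @OmegaData cos_amb cos_cell (@tsrc cos_lab) (@ttgt cos_lab) cos_id
    (@tcomp cos_lab cos_lab_comp).

End Coslice.

Definition slice (X : omega_data) (b : amb X 0) : omega_data :=
  op (@coslice (op X) b).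

(* The ambient types of a/X/b depend on neither a nor b. *)
Definition bis_amb (X : omega_data) (n : nat) : Type :=
  (cos_amb X n * cos_amb (op X) n)%type.

Definition bislice (X : omega_data) (a b : amb X 0) : omega_data :=
  @OmegaData (bis_amb X)
    (fun n u => [/\ is_cell (coslice a) u.1, is_cell (slice b) u.2
                  & base u.1 = base u.2 :> amb X n])
    (fun n u => (@src (coslice a) n u.1, @src (slice b) n u.2))
    (fun n u => (@tgt (coslice a) n u.1, @tgt (slice b) n u.2))
    (fun n u => (@idc (coslice a) n u.1, @idc (slice b) n u.2))
    (fun k n v u => (@comp (coslice a) k n v.1 u.1, @comp (slice b) k n v.2 u.2)).

(* An n-cell [h] of X(b,a) is an (n+1)-cell of X with 0-boundary (b,a). *)
Fixpoint cos_act (X : omega_data) n : cos_amb X n -> amb X n.+1 -> cos_amb X n :=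
  match n return cos_amb X n -> amb X n.+1 -> cos_amb X n with
  | 0 => fun c h => (base c, comp 0 (bar c) h)
  | m.+1 => fun c h =>
      ((cos_act (tsrc c) (src h), cos_act (ttgt c) (tgt h)),
       (base c, comp 0 (bar c) h))
  end.

Definition bis_ract (X : omega_data) n (u : bis_amb X n) (h : amb X n.+1)
  : bis_amb X n := (cos_act u.1 h, u.2).
(* The action on X/b is dual to the one on coslices: [cos_act] over [op X] composes
   the label with [h] on the other side. *)
Definition bis_lact (X : omega_data) n (h : amb X n.+1) (u : bis_amb X n)
  : bis_amb X n := (u.1, @cos_act (op X) n u.2 h).

Section Cylinder.

Variable X : omega_data.

(* (n+1)-cells of c(X): those between objects of the left copy, those between
   objects of the right copy, and the n-cells of a/X/b, which go from the left
   object a to the right object b. *)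
Inductive cyl_pos (n : nat) : Type :=
| CylL of amb X n.+1
| CylR of amb X n.+1
| CylM of amb X 0 & amb X 0 & bis_amb X n.

Definition cyl_amb (n : nat) : Type :=
  if n is m.+1 then cyl_pos m else (amb X 0 + amb X 0)%type.

Definition cyl_cell n : cyl_amb n -> Prop :=
  match n return cyl_amb n -> Prop with
  | 0 => fun x => match x with inl a => is_cell X a | inr b => is_cell X b end
  | m.+1 => fun x =>
      match x with
      | CylL h | CylR h => is_cell X h
      | CylM a b u => [/\ is_cell X a, is_cell X b & is_cell (bislice a b) u]
      end
  end.

Definition cyl_src n : cyl_amb n.+1 -> cyl_amb n :=
  match n return cyl_amb n.+1 -> cyl_amb n with
  | 0 => fun x =>
      match x with
      | CylL h => inl (src h) | CylR h => inr (src h) | CylM a _ _ => inl a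
      end
  | m.+1 => fun x =>
      match x with
      | CylL h => CylL (src h) | CylR h => CylR (src h)
      | CylM a b u => CylM a b (@src (bislice a b) m u)
      end
  end.

Definition cyl_tgt n : cyl_amb n.+1 -> cyl_amb n :=
  match n return cyl_amb n.+1 -> cyl_amb n with
  | 0 => fun x =>
      match x with
      | CylL h => inl (tgt h) | CylR h => inr (tgt h) | CylM _ b _ => inr b
      end
  | m.+1 => fun x =>
      match x with
      | CylL h => CylL (tgt h) | CylR h => CylR (tgt h)
      | CylM a b u => CylM a b (@tgt (bislice a b) m u)
      end
  end.

Definition cyl_id n : cyl_amb n -> cyl_amb n.+1 :=
  match n return cyl_amb n -> cyl_amb n.+1 with
  | 0 => fun x => match x with inl a => CylL (idc a) | inr b => CylR (idc b) end
  | m.+1 => fun x =>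
      match x with
      | CylL h => CylL (idc h) | CylR h => CylR (idc h)
      | CylM a b u => CylM a b (@idc (bislice a b) m u)
      end
  end.

(* On each a/X/b, [comp n.+1] of c(X) is [comp n] of a/X/b; the actions are [comp 0].
   The last branch, the mixed branches at [n > 0] and the branch of two [CylM] at
   [n = 0] concern pairs that are never composable. *)
Definition cyl_comp k (n : nat) : cyl_amb k -> cyl_amb k -> cyl_amb k :=
  match k return cyl_amb k -> cyl_amb k -> cyl_amb k with
  | 0 => fun y _ => y
  | m.+1 => fun y x =>
      match y, x with
      | CylL g, CylL h => CylL (comp n g h)
      | CylR g, CylR h => CylR (comp n g h)
      | CylM _ b u, CylL h => CylM (sbd 0 h) b (bis_ract u h)
      | CylR h, CylM a _ u => CylM a (tbd 0 h) (bis_lact h u)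
      | CylM a b v, CylM _ _ u => CylM a b (@comp (bislice a b) m n.-1 v u)
      | _, _ => y
      end
  end.

Definition cyl : omega_data :=
  @OmegaData cyl_amb cyl_cell cyl_src cyl_tgt cyl_id cyl_comp.

End Cylinder.

(* [Some false], [None] and [Some true] stand for the symbols (-), (.) and (+). *)
Definition symbol := option bool.

Section Cube.

Variable n : nat.

Definition str := n.-tuple symbol.
Implicit Types (a b : str) (xi : {set str}).

Definition strs (j : nat) : {set str} := [set a : str | count_mem None a == j].

(* The position p of an occurrence of (.) in [a] is the (occ a p)-th one,
   counting from 1. *)
Definition occ a (p : 'I_n) : nat := #|[set q : 'I_n | q <= p & tnth a q == None]|.

Definition subst a (p : 'I_n) (s : symbol) : str :=
  [tuple if q == p then s else tnth a q | q < n].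

Definition minus_faces a : {set str} :=
  [set subst a p (Some (~~ odd (occ a p))) | p : 'I_n & tnth a p == None].
Definition plus_faces a : {set str} :=
  [set subst a p (Some (odd (occ a p))) | p : 'I_n & tnth a p == None].

Definition minus xi : {set str} := \bigcup_(a in xi) minus_faces a.
Definition plus xi : {set str} := \bigcup_(a in xi) plus_faces a.

Definition cube_amb : nat -> Type := tower (fun _ => {set str}).

Fixpoint cube_cell j : cube_amb j -> Prop :=
  match j return cube_amb j -> Prop with
  | 0 => fun x => exists2 a, a \in strs 0 & x = [set a]
  | i.+1 => fun x =>
      let xi := tlab x in
      let mu := tlab (tsrc x) in
      let pi := tlab (ttgt x) in
      [/\ cube_cell (tsrc x), cube_cell (ttgt x) & tparallel (tsrc x) (ttgt x)] /\
      xi \subset strs i.+1 /\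
      (forall a b, a \in xi -> b \in xi -> a <> b ->
         plus_faces a :&: plus_faces b = set0 /\
         minus_faces a :&: minus_faces b = set0) /\
      pi = (mu :|: plus xi) :\: minus xi /\
      mu = (pi :|: minus xi) :\: plus xi
  end.

Definition cube : omega_data :=
  @OmegaData cube_amb cube_cell
    (@tsrc (fun _ => {set str})) (@ttgt (fun _ => {set str}))
    (@tid (fun _ => {set str}) (fun _ _ => set0))
    (@tcomp (fun _ => {set str}) (fun k _ z x => tlab z :|: tlab x)).

End Cube.

(* Main.v *)
From Stdlib Require Import ClassicalEpsilon.
From mathcomp Require Import all_boot.
Require Import Defs.

Set Implicit Arguments.
Unset Strict Implicit.
Unset Printing Implicit Defensive.

(** The proof is an induction on [n].  Its step is an isomorphism between
    [cyl (cube n)] and [cube n.+1]; together with the functoriality of [cyl]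
    ([cyl_isomorphic]) it turns an isomorphism for [n] into one for [n.+1].

    A string of length [n.+1] is a string of length [n] followed by one more
    symbol, so a set of such strings amounts to a triple (A, S, B) of sets of
    strings of length [n]: those followed by (-), by (.) and by (+) ([glue]).
    The comparison [to_cube] sends a cell h of the left copy to the triple
    (h, 0, 0), a cell h of the right copy to (0, 0, h), and a cell
    (x, xbar, xhat) of a/X/b to (xbar, x, xhat), where a cell stands for its
    top label.  A string of S has, besides the faces in the old directions, one
    face in the new direction, which is a minus face at one end and a plus face
    at the other; since the new symbol comes last, the parity of the dimension
    decides which end is which ([bd_glue]).  This is the alternation between
    even and odd dimensions in the lax slices.  The conditions that define a
    cell of [cube n.+1] therefore split into conditions on A, S and B
    ([wf_glue], [moves_glue]).  The condition on A says that A is a cell of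
    [cube n] one of whose ends contains S ([moves_minus], [moves_plus]), and
    this is what the definition of a/X requires of xbar: in the top dimension
    whiskering only adds labels ([lab_whisk_top]).

    That [to_cube] is onto ([to_cube_surj]) needs two more facts.  A well formed
    set without boundary is empty ([no_cycle]), so a cell of [cube n.+1] whose
    ends lie in one copy lies in that copy.  And a 1-cell from the left to the
    right copy crosses exactly once, by counting faces ([moves_card]).

    The omega-category axioms hold in a cube because its composites are unions,
    except for one: a composite of two cells must again be a cell.  This is also
    obtained by induction, along [to_cube].  In the cube two parallel cells with
    the same top label are equal, and then the cylinder is closed under
    composition for a cheap reason: the equation required of xbar for a
    composite is between parallel cells, so it is enough to compare unions of
    labels ([cos_cellI], [coslice_comp_cell]).  The induction carries along that
    composable cells have disjoint labels, which the splitting above uses; the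
    record [labelled] collects what is needed of labels.  Finally the axioms
    for the iterated cylinder follow from those for the cube, because they are
    invariant under isomorphism ([transport_omega]). *)

(** * Iterated boundaries *)

Section Globular.

(** The axioms on which the behaviour of iterated boundaries rests.  Slices and
    cylinders satisfy them over any omega-category, whereas their closure under
    identities and composition is established only in the presence of labels. *)
Record globular (X : omega_data) : Prop := {
  g_src : forall n (x : amb X n.+1), is_cell X x -> is_cell X (src x);
  g_tgt : forall n (x : amb X n.+1), is_cell X x -> is_cell X (tgt x);
  g_ss : forall n (x : amb X n.+2), is_cell X x -> src (src x) = src (tgt x);
  g_tt : forall n (x : amb X n.+2), is_cell X x -> tgt (src x) = tgt (tgt x)
}.

Lemma sbd_id X k (x : amb X k) : sbd k x = x.
Proof. exact: move_id. Qed.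

Lemma tbd_id X k (x : amb X k) : tbd k x = x.
Proof. exact: move_id. Qed.

Lemma sbd_src X k n (x : amb X k.+1) : n <= k -> sbd n x = sbd n (src x).
Proof. exact: move_down. Qed.

Lemma tbd_tgt X k n (x : amb X k.+1) : n <= k -> tbd n x = tbd n (tgt x).
Proof. exact: move_down. Qed.

Lemma src_sbd X k n (x : amb X k) : n < k -> src (sbd n.+1 x) = sbd n x.
Proof.
elim: k x => // k IH x; rewrite ltnS leq_eqVlt => /orP[/eqP->|lt_nk].
  by rewrite sbd_id sbd_src // sbd_id.
by rewrite !(@sbd_src _ k) ?IH // ltnW.
Qed.

Lemma tgt_tbd X k n (x : amb X k) : n < k -> tgt (tbd n.+1 x) = tbd n x.
Proof.
elim: k x => // k IH x; rewrite ltnS leq_eqVlt => /orP[/eqP->|lt_nk].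
  by rewrite tbd_id tbd_tgt // tbd_id.
by rewrite !(@tbd_tgt _ k) ?IH // ltnW.
Qed.

Variable X : omega_data.
Hypothesis gX : globular X.

Lemma sbd_cell_le k n (x : amb X k) : n <= k -> is_cell X x -> is_cell X (sbd n x).
Proof.
elim: k x => [|k IH] x; first by rewrite leqn0 => /eqP->; rewrite sbd_id.
rewrite leq_eqVlt => /orP[/eqP->|lt_nk] cx; first by rewrite sbd_id.
by rewrite sbd_src //; apply: IH => //; apply: g_src.
Qed.

Lemma tbd_cell_le k n (x : amb X k) : n <= k -> is_cell X x -> is_cell X (tbd n x).
Proof.
elim: k x => [|k IH] x; first by rewrite leqn0 => /eqP->; rewrite tbd_id.
rewrite leq_eqVlt => /orP[/eqP->|lt_nk] cx; first by rewrite tbd_id.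
by rewrite tbd_tgt //; apply: IH => //; apply: g_tgt.
Qed.

Lemma sbd_tgt k n (x : amb X k.+1) : n < k -> is_cell X x -> sbd n x = sbd n (tgt x).
Proof.
case: k x => // k x lt_nk cx.
by rewrite sbd_src 1?ltnW // sbd_src // (g_ss gX) // -sbd_src.
Qed.

Lemma tbd_src k n (x : amb X k.+1) : n < k -> is_cell X x -> tbd n x = tbd n (src x).
Proof.
case: k x => // k x lt_nk cx.
by rewrite tbd_tgt 1?ltnW // tbd_tgt // -(g_tt gX) // -tbd_tgt.
Qed.

Lemma tgt_sbd_lt k n (x : amb X k) :
  n < k -> is_cell X x -> tgt (sbd n.+1 x) = tbd n x.
Proof.
elim: k x => // k IH x; rewrite ltnS leq_eqVlt => /orP[/eqP->|lt_nk] cx.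
  by rewrite sbd_id tbd_tgt // tbd_id.
by rewrite sbd_src // IH ?tbd_src //; apply: g_src.
Qed.

Lemma src_tbd_lt k n (x : amb X k) :
  n < k -> is_cell X x -> src (tbd n.+1 x) = sbd n x.
Proof.
elim: k x => // k IH x; rewrite ltnS leq_eqVlt => /orP[/eqP->|lt_nk] cx.
  by rewrite tbd_id sbd_src // sbd_id.
by rewrite tbd_tgt // IH ?sbd_tgt //; apply: g_tgt.
Qed.

Lemma sbd_sbd_le k j n (x : amb X k) : j <= n -> n <= k -> sbd j (sbd n x) = sbd j x.
Proof.
elim: n => [|n IH]; first by rewrite leqn0 => /eqP-> _; rewrite sbd_id.
rewrite leq_eqVlt => /orP[/eqP-> _|]; first by rewrite sbd_id.
by rewrite ltnS => le_jn lt_nk; rewrite sbd_src // src_sbd // IH // ltnW.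
Qed.

Lemma tbd_tbd_le k j n (x : amb X k) : j <= n -> n <= k -> tbd j (tbd n x) = tbd j x.
Proof.
elim: n => [|n IH]; first by rewrite leqn0 => /eqP-> _; rewrite tbd_id.
rewrite leq_eqVlt => /orP[/eqP-> _|]; first by rewrite tbd_id.
by rewrite ltnS => le_jn lt_nk; rewrite tbd_tgt // tgt_tbd // IH // ltnW.
Qed.

Lemma tbd_sbd_lt k j n (x : amb X k) : j < n -> n <= k -> is_cell X x ->
  tbd j (sbd n x) = tbd j x.
Proof.
case: n => // n; rewrite ltnS => le_jn lt_nk cx.
by rewrite tbd_tgt // tgt_sbd_lt // tbd_tbd_le // ltnW.
Qed.

Lemma sbd_tbd_lt k j n (x : amb X k) : j < n -> n <= k -> is_cell X x ->
  sbd j (tbd n x) = sbd j x.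
Proof.
case: n => // n; rewrite ltnS => le_jn lt_nk cx.
by rewrite sbd_src // src_tbd_lt // sbd_sbd_le // ltnW.
Qed.

End Globular.

Section OmegaCategory.

Variable X : omega_data.
Hypothesis wX : is_omega_category X.

Lemma omega_globular : globular X.
Proof. by case: wX => *; split. Qed.
Let gX := omega_globular.

Lemma lift_idc k n (x : amb X k) : k <= n -> lift n.+1 x = idc (lift n x).
Proof. exact: move_up. Qed.

Lemma lift_id k (x : amb X k) : lift k x = x.
Proof. exact: move_id. Qed.

Lemma lift_cell k n (x : amb X k) : k <= n -> is_cell X x -> is_cell X (lift n x).
Proof.
elim: n => [|n IH]; first by rewrite leqn0 => /eqP e; subst k; rewrite lift_id.
rewrite leq_eqVlt => /orP[/eqP e|]; first by subst k; rewrite lift_id.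
by rewrite ltnS => le_kn cx; rewrite lift_idc //; apply: idc_cell (IH _ _).
Qed.

Lemma src_lift k n (x : amb X k) : k <= n -> is_cell X x -> src (lift n.+1 x) = lift n x.
Proof. by move=> le_kn cx; rewrite lift_idc // src_idc //; apply: lift_cell. Qed.

Lemma tgt_lift k n (x : amb X k) : k <= n -> is_cell X x -> tgt (lift n.+1 x) = lift n x.
Proof. by move=> le_kn cx; rewrite lift_idc // tgt_idc //; apply: lift_cell. Qed.

Lemma sbd_lift_ge k d n (x : amb X k) : k <= d -> d <= n -> is_cell X x ->
  sbd d (lift n x) = lift d x.
Proof.
elim: n => [|n IH] le_kd.
  by rewrite leqn0 => /eqP e; subst d; rewrite sbd_id.
rewrite leq_eqVlt => /orP[/eqP-> _|]; first by rewrite sbd_id.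
rewrite ltnS => le_dn cx.
by rewrite sbd_src // src_lift // ?IH // (leq_trans le_kd).
Qed.

Lemma tbd_lift_ge k d n (x : amb X k) : k <= d -> d <= n -> is_cell X x ->
  tbd d (lift n x) = lift d x.
Proof.
elim: n => [|n IH] le_kd.
  by rewrite leqn0 => /eqP e; subst d; rewrite tbd_id.
rewrite leq_eqVlt => /orP[/eqP-> _|]; first by rewrite tbd_id.
rewrite ltnS => le_dn cx.
by rewrite tbd_tgt // tgt_lift // ?IH // (leq_trans le_kd).
Qed.

Lemma sbd_lift k d n (x : amb X k) : d <= k -> k <= n -> is_cell X x ->
  sbd d (lift n x) = sbd d x.
Proof.
by move=> le_dk le_kn cx; rewrite -(@sbd_sbd_le X n d k) // sbd_lift_ge // lift_id.
Qed.

Lemma tbd_lift k d n (x : amb X k) : d <= k -> k <= n -> is_cell X x ->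
  tbd d (lift n x) = tbd d x.
Proof.
by move=> le_dk le_kn cx; rewrite -(@tbd_tbd_le X n d k) // tbd_lift_ge // lift_id.
Qed.

Lemma sbd_comp_top k n (y x : amb X k) : n < k -> is_cell X y -> is_cell X x ->
  composable n y x -> sbd n (comp n y x) = sbd n x.
Proof.
elim: k y x => // k IH y x; rewrite ltnS leq_eqVlt => /orP[/eqP e|lt_nk] cy cx yx.
  by subst n; rewrite !sbd_src // src_comp_top.
rewrite sbd_src 1?ltnW // src_comp // IH //.
- by rewrite -sbd_src 1?ltnW.
- exact: src_cell.
- exact: src_cell.
- by rewrite /composable -sbd_src 1?ltnW // -(tbd_src gX).
Qed.

Lemma tbd_comp_top k n (y x : amb X k) : n < k -> is_cell X y -> is_cell X x ->
  composable n y x -> tbd n (comp n y x) = tbd n y.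
Proof.
elim: k y x => // k IH y x; rewrite ltnS leq_eqVlt => /orP[/eqP e|lt_nk] cy cx yx.
  by subst n; rewrite !tbd_tgt // tgt_comp_top.
rewrite tbd_tgt 1?ltnW // tgt_comp // IH //.
- by rewrite -tbd_tgt 1?ltnW.
- exact: tgt_cell.
- exact: tgt_cell.
- by rewrite /composable -tbd_tgt 1?ltnW // -(sbd_tgt gX).
Qed.

Lemma sbd_comp k d n (y x : amb X k) : n < d -> d <= k -> is_cell X y -> is_cell X x ->
  composable n y x -> sbd d (comp n y x) = comp n (sbd d y) (sbd d x).
Proof.
elim: k y x => [|k IH] y x lt_nd; first by case: d lt_nd.
rewrite leq_eqVlt => /orP[/eqP->|]; first by rewrite !sbd_id.
rewrite ltnS => le_dk cy cx yx; have lt_nk := leq_trans lt_nd le_dk.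
rewrite !(@sbd_src X k) // src_comp // IH //; try exact: src_cell.
by rewrite /composable -sbd_src 1?ltnW // -(tbd_src gX).
Qed.

Lemma tbd_comp k d n (y x : amb X k) : n < d -> d <= k -> is_cell X y -> is_cell X x ->
  composable n y x -> tbd d (comp n y x) = comp n (tbd d y) (tbd d x).
Proof.
elim: k y x => [|k IH] y x lt_nd; first by case: d lt_nd.
rewrite leq_eqVlt => /orP[/eqP->|]; first by rewrite !tbd_id.
rewrite ltnS => le_dk cy cx yx; have lt_nk := leq_trans lt_nd le_dk.
rewrite !(@tbd_tgt X k) // tgt_comp // IH //; try exact: tgt_cell.
by rewrite /composable -tbd_tgt 1?ltnW // -(sbd_tgt gX).
Qed.

(** Iterated identities are defined through [move] on sources, hence on targets
    in the dual. *)
Lemma lift_op k n (x : amb X k) : k <= n -> @lift (op X) k n x = lift n x.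
Proof.
elim: n => [|n IH]; first by rewrite leqn0 => /eqP e; subst k; rewrite lift_id /lift move_id.
rewrite leq_eqVlt => /orP[/eqP e|]; first by subst k; rewrite lift_id /lift move_id.
by rewrite ltnS => le_kn; rewrite /lift !move_up //= -/(@lift (op X) _ n x) IH.
Qed.

Lemma sbd_cell k n (x : amb X k) : is_cell X x -> is_cell X (sbd n x).
Proof. by case: (leqP n k) => [|/ltnW] le_nk; [apply: sbd_cell_le | apply: lift_cell]. Qed.

Lemma op_omega : is_omega_category (op X).
Proof.
case: (wX) => h1 h2 h3 h4 h5 h6 h7 h8 h9 h10 h11 h12 h13 h14 h15 h16 h17.
split=> /=; first [exact: h1 | exact: h2 | exact: h3 | idtac].
- by move=> k n y x lt cy cx yx; exact: h4 (esym yx).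
- by move=> n x cx; rewrite h6.
- by move=> n x cx; rewrite h5.
- exact: h8.
- exact: h7.
- by move=> n y x cy cx yx; exact: h10 (esym yx).
- by move=> n y x cy cx yx; exact: h9 (esym yx).
- by move=> k n y x lt cy cx yx; exact: h12 (esym yx).
- by move=> k n y x lt cy cx yx; exact: h11 (esym yx).
- by move=> k n z y x lt cz cy cx zy yx; exact: esym (h13 _ _ _ _ _ lt cx cy cz (esym yx) (esym zy)).
- move=> k n x lt cx; rewrite lift_op 1?ltnW //; exact: h15.
- move=> k n x lt cx; rewrite lift_op 1?ltnW //; exact: h14.
- by move=> k n y x lt cy cx yx; exact: h16 (esym yx).
- move=> k m n y' y x' x ltnm ltmk cy' cy cx' cx e1 e2 e3.
  apply: (h17 _ _ _ _ _ _ _ ltnm ltmk cx cx' cy cy' (esym e2) (esym e1)).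
  have e1' : sbd m y = tbd m y' := e1.
  have e2' : sbd m x = tbd m x' := e2.
  have e3' : sbd n x = tbd n y := e3.
  have le_mk := ltnW ltmk; have le_nm := ltnW ltnm.
  rewrite /composable -(@tbd_tbd_le X k n m y') // -e1' (tbd_sbd_lt gX) //.
  by rewrite -(@sbd_tbd_lt X gX k n m x') // -e2' sbd_sbd_le.
Qed.

End OmegaCategory.

Lemma composable_src X k n (y x : amb X k.+1) : globular X -> n < k ->
  is_cell X x -> composable n y x -> composable n (src y) (src x).
Proof.
move=> gX lt_nk cx yx.
by rewrite /composable -sbd_src 1?ltnW // -(tbd_src gX).
Qed.

Lemma composable_tgt X k n (y x : amb X k.+1) : globular X -> n < k ->
  is_cell X y -> composable n y x -> composable n (tgt y) (tgt x).
Proof.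
move=> gX lt_nk cy yx.
by rewrite /composable -tbd_tgt 1?ltnW // -(sbd_tgt gX).
Qed.

(** * Functors, isomorphisms and transport of structure *)

Section FunctorBoundaries.

Variables (X Y : omega_data) (f : forall n, amb X n -> amb Y n).
Hypotheses (gX : globular X) (ff : is_omega_functor f).

Lemma functor_sbd k n (x : amb X k) : n <= k -> is_cell X x -> f (sbd n x) = sbd n (f x).
Proof.
elim: k x => [|k IH] x; first by rewrite leqn0 => /eqP->; rewrite !sbd_id.
rewrite leq_eqVlt => /orP[/eqP->|lt_nk] cx; first by rewrite !sbd_id.
by rewrite !(@sbd_src _ k) // IH ?(fun_src ff) //; apply: (g_src gX).
Qed.

Lemma functor_tbd k n (x : amb X k) : n <= k -> is_cell X x -> f (tbd n x) = tbd n (f x).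
Proof.
elim: k x => [|k IH] x; first by rewrite leqn0 => /eqP->; rewrite !tbd_id.
rewrite leq_eqVlt => /orP[/eqP->|lt_nk] cx; first by rewrite !tbd_id.
by rewrite !(@tbd_tgt _ k) // IH ?(fun_tgt ff) //; apply: (g_tgt gX).
Qed.

Lemma functor_composable k n (y x : amb X k) : n <= k -> is_cell X y -> is_cell X x ->
  composable n y x -> composable n (f y) (f x).
Proof. by move=> le_nk cy cx yx; rewrite /composable -functor_tbd // -functor_sbd // yx. Qed.

End FunctorBoundaries.

Section Maps.

Variables (X Y : omega_data) (f : forall n, amb X n -> amb Y n).
Hypotheses (gX : globular X) (ff : is_omega_functor f).

Hypothesis f_inj : forall n (x y : amb X n), is_cell X x -> is_cell X y -> f x = f y -> x = y.

(** Composability is an equation between boundary cells, so an injective functor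
    reflects it. *)
Lemma functor_composable_inv k n (y x : amb X k) : n <= k -> is_cell X y -> is_cell X x ->
  composable n (f y) (f x) -> composable n y x.
Proof.
move=> le_nk cy cx yx; apply: f_inj; [exact: tbd_cell_le | exact: sbd_cell_le |].
by rewrite (functor_tbd gX ff) // (functor_sbd gX ff).
Qed.

Hypothesis f_surj : forall n (y : amb Y n), is_cell Y y -> exists2 x, is_cell X x & f x = y.
Hypothesis X_idc : forall n (x : amb X n), is_cell X x -> is_cell X (idc x).
Hypothesis X_comp : forall k n (y x : amb X k), n < k ->
  is_cell X y -> is_cell X x -> composable n y x -> is_cell X (comp n y x).
Hypothesis X_inh : forall n, inhabited (amb X n).

(** Injectivity on cells makes any choice of preimages compatible with the
    structure; the closure hypotheses ensure that the two sides that have to be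
    compared are cells. *)
Lemma bijective_isomorphic : isomorphic X Y.
Proof.
pose g n (y : amb Y n) := epsilon (X_inh n) (fun x => is_cell X x /\ f x = y).
have gP n (y : amb Y n) : is_cell Y y -> is_cell X (g n y) /\ f (g n y) = y.
  move=> cy; apply: (epsilon_spec (X_inh n) (fun x => is_cell X x /\ f x = y)).
  by have [x cx e] := f_surj cy; exists x.
have gK n (x : amb X n) : is_cell X x -> g n (f x) = x.
  by move=> cx; have [c e] := gP _ _ (fun_cell ff cx); apply: f_inj.
exists f, g; split=> //; last by move=> n y /gP[].
split.
- by move=> n y /gP[].
- move=> n y /gP[c {1}<-]; rewrite -(fun_src ff) // gK //; exact: (g_src gX).
- move=> n y /gP[c {1}<-]; rewrite -(fun_tgt ff) // gK //; exact: (g_tgt gX).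
- by move=> n y /gP[c {1}<-]; rewrite -(fun_idc ff) // gK //; apply: X_idc.
move=> k n y x lt_nk /gP[cy ey] /gP[cx ex] yx.
have yx' : composable n (g k y) (g k x).
  by apply: functor_composable_inv => //; [exact: ltnW | rewrite ey ex].
by rewrite -{1}ey -{1}ex -(fun_comp ff) // gK //; apply: X_comp.
Qed.

End Maps.

Lemma functor_comp X Y Z (f : forall n, amb X n -> amb Y n) (g : forall n, amb Y n -> amb Z n) :
  globular X -> is_omega_functor f -> is_omega_functor g ->
  is_omega_functor (fun n x => g n (f n x)).
Proof.
move=> gX ff fg; split.
- by move=> n x cx; do 2!apply: fun_cell => //.
- by move=> n x cx; rewrite (fun_src ff) // (fun_src fg) //; apply: fun_cell.
- by move=> n x cx; rewrite (fun_tgt ff) // (fun_tgt fg) //; apply: fun_cell.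
- by move=> n x cx; rewrite (fun_idc ff) // (fun_idc fg) //; apply: fun_cell.
move=> k n y x lt cy cx yx; rewrite (fun_comp ff) // (fun_comp fg) //; try exact: fun_cell.
by apply: (functor_composable gX ff) => //; apply: ltnW.
Qed.

Lemma isomorphic_trans X Y Z : globular X -> globular Z ->
  isomorphic X Y -> isomorphic Y Z -> isomorphic X Z.
Proof.
move=> gX gZ [f [f' [ff ff' fK f'K]]] [g [g' [fg fg' gK g'K]]].
exists (fun n x => g n (f n x)), (fun n z => f' n (g' n z)); split.
- exact: functor_comp.
- exact: functor_comp.
- by move=> n x cx; rewrite gK ?fK //; apply: (fun_cell ff).
by move=> n z cz; rewrite f'K ?g'K //; apply: (fun_cell fg').
Qed.

(** The composability conditions that the interchange axiom leaves implicit. *)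
Lemma interchange_composable X k m n (y' y x' x : amb X k) : is_omega_category X ->
  n < m -> m < k -> is_cell X y' -> is_cell X y -> is_cell X x' -> is_cell X x ->
  composable m y' y -> composable m x' x -> composable n y x ->
  [/\ composable n y' x', composable n (comp m y' y) (comp m x' x)
    & composable m (comp n y' x') (comp n y x)].
Proof.
move=> wX lt_nm lt_mk cy' cy cx' cx e1 e2 e3; have gX := omega_globular wX.
have le_nm := ltnW lt_nm; have le_mk := ltnW lt_mk; have lt_nk := ltn_trans lt_nm lt_mk.
have ty : sbd n y' = sbd n y.
  by rewrite -(@sbd_sbd_le X k n m y') // -e1 (sbd_tbd_lt gX).
have tx : tbd n x' = tbd n x.
  by rewrite -(@tbd_sbd_lt X gX k n m x') // -e2 tbd_tbd_le.
have e4 : composable n y' x' by rewrite /composable ty tx.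
split=> //.
  rewrite /composable -(@tbd_tbd_le X k n m) // tbd_comp_top // tbd_tbd_le // tx e3.
  by rewrite -[RHS](@sbd_sbd_le X k n m) // sbd_comp_top // sbd_sbd_le.
by rewrite /composable tbd_comp // sbd_comp // e1 e2.
Qed.

Section Transport.

Variables (X Y : omega_data) (f : forall n, amb X n -> amb Y n) (g : forall n, amb Y n -> amb X n).
Hypotheses (wY : is_omega_category Y) (ff : is_omega_functor f) (fg : is_omega_functor g).
Hypothesis gK : forall n (x : amb X n), is_cell X x -> g (f x) = x.

Let f_inj n (x y : amb X n) : is_cell X x -> is_cell X y -> f x = f y -> x = y.
Proof. by move=> cx cy e; rewrite -(gK cx) e gK. Qed.

Let fc n (x : amb X n) : is_cell X x -> is_cell Y (f x).
Proof. exact: fun_cell. Qed.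

Lemma transport_globular : globular X.
Proof.
have h1 n (x : amb X n.+1) : is_cell X x -> is_cell X (src x).
  move=> cx; rewrite -(gK cx) -(fun_src fg); last exact: fc.
  by apply/(fun_cell fg)/(src_cell wY)/fc.
have h2 n (x : amb X n.+1) : is_cell X x -> is_cell X (tgt x).
  move=> cx; rewrite -(gK cx) -(fun_tgt fg); last exact: fc.
  by apply/(fun_cell fg)/(tgt_cell wY)/fc.
split=> // n x cx; have c1 := h1 _ _ cx; have c2 := h2 _ _ cx.
  apply: f_inj; [exact: h1 | exact: h1 |].
  by rewrite !(fun_src ff, fun_tgt ff) // (src_src wY) //; apply: fc.
apply: f_inj; [exact: h2 | exact: h2 |].
by rewrite !(fun_src ff, fun_tgt ff) // (tgt_tgt wY) //; apply: fc.
Qed.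
Let gX := transport_globular.

(** An equation between cells of [X] holds because its image under [f] is an
    instance of an axiom of [Y]; composability conditions are carried back in the same way. *)
Lemma transport_omega : is_omega_category X.
Proof.
have Xidc n (x : amb X n) : is_cell X x -> is_cell X (idc x).
  move=> cx; rewrite -(gK cx) -(fun_idc fg); last exact: fc.
  by apply/(fun_cell fg)/(idc_cell wY)/fc.
have fcomp k n (y x : amb X k) : n < k -> is_cell X y -> is_cell X x ->
    composable n y x -> composable n (f y) (f x).
  by move=> lt cy cx yx; apply: (functor_composable gX ff) => //; apply: ltnW.
have compf k n (y x : amb X k) : n < k -> is_cell X y -> is_cell X x ->
    composable n (f y) (f x) -> composable n y x.
  by move=> lt cy cx yx; apply: (functor_composable_inv gX ff f_inj) => //; apply: ltnW.
have Xcomp k n (y x : amb X k) : n < k -> is_cell X y -> is_cell X x ->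
    composable n y x -> is_cell X (comp n y x).
  move=> lt cy cx yx; have yx' := fcomp _ _ _ _ lt cy cx yx.
  rewrite -(gK cy) -(gK cx) -(fun_comp fg) //; try exact: fc.
  by apply/(fun_cell fg)/(comp_cell wY) => //; apply: fc.
have Xs := g_src gX; have Xt := g_tgt gX.
have lift_cell' k n (x : amb X k) : k <= n -> is_cell X x -> is_cell X (lift n x).
  elim: n => [|n IH]; first by rewrite leqn0 => /eqP e; subst k; rewrite lift_id.
  rewrite leq_eqVlt => /orP[/eqP e|]; first by subst k; rewrite lift_id.
  by rewrite ltnS => le_kn cx; rewrite lift_idc //; apply: Xidc; apply: IH.
have flift k n (x : amb X k) : k <= n -> is_cell X x -> f (lift n x) = lift n (f x).
  elim: n => [|n IH]; first by rewrite leqn0 => /eqP e; subst k; rewrite !lift_id.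
  rewrite leq_eqVlt => /orP[/eqP e|]; first by subst k; rewrite !lift_id.
  rewrite ltnS => le_kn cx; rewrite !lift_idc // (fun_idc ff) ?IH //; exact: lift_cell'.
have cs k n (y x : amb X k.+1) : n < k -> is_cell X x -> composable n y x ->
    composable n (src y) (src x).
  by move=> *; apply: composable_src.
have ct k n (y x : amb X k.+1) : n < k -> is_cell X y -> composable n y x ->
    composable n (tgt y) (tgt x).
  by move=> *; apply: composable_tgt.
case: (gX) => h1 h2 h3 h4; split=> //.
- move=> n x cx; apply: f_inj => //; first exact/h1/Xidc.
  by rewrite (fun_src ff) ?(fun_idc ff) ?(src_idc wY) //; [apply: fc | apply: Xidc].
- move=> n x cx; apply: f_inj => //; first exact/h2/Xidc.
  by rewrite (fun_tgt ff) ?(fun_idc ff) ?(tgt_idc wY) //; [apply: fc | apply: Xidc].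
- move=> n y x cy cx yx; have c := Xcomp _ _ _ _ (leqnn _) cy cx yx.
  apply: f_inj; [exact: h1 | exact: h1 |].
  by rewrite !(fun_src ff) // (fun_comp ff) // (src_comp_top wY) //; try exact: fc; apply: fcomp.
- move=> n y x cy cx yx; have c := Xcomp _ _ _ _ (leqnn _) cy cx yx.
  apply: f_inj; [exact: h2 | exact: h2 |].
  by rewrite !(fun_tgt ff) // (fun_comp ff) // (tgt_comp_top wY) //; try exact: fc; apply: fcomp.
- move=> k n y x lt cy cx yx; have lt' := leqW lt.
  have c := Xcomp _ _ _ _ lt' cy cx yx; have c' := cs _ _ _ _ lt cx yx.
  apply: f_inj; [exact: h1 | by apply: Xcomp => //; exact: h1 |].
  rewrite (fun_src ff) // (fun_comp ff) // (src_comp wY) //; try exact: fc; last exact: fcomp.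
  by rewrite (fun_comp ff) ?(fun_src ff) //; exact: h1.
- move=> k n y x lt cy cx yx; have lt' := leqW lt.
  have c := Xcomp _ _ _ _ lt' cy cx yx; have c' := ct _ _ _ _ lt cy yx.
  apply: f_inj; [exact: h2 | by apply: Xcomp => //; exact: h2 |].
  rewrite (fun_tgt ff) // (fun_comp ff) // (tgt_comp wY) //; try exact: fc; last exact: fcomp.
  by rewrite (fun_comp ff) ?(fun_tgt ff) //; exact: h2.
- move=> k n z y x lt cz cy cx zy yx; have lt' := ltnW lt.
  have c := Xcomp _ _ _ _ lt cz cy zy; have c' := Xcomp _ _ _ _ lt cy cx yx.
  have zy' := fcomp _ _ _ _ lt cz cy zy; have yx' := fcomp _ _ _ _ lt cy cx yx.
  have e1 : composable n z (comp n y x).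
    apply: compf => //; rewrite (fun_comp ff) // /composable tbd_comp_top //; exact: fc.
  have e2 : composable n (comp n z y) x.
    apply: compf => //; rewrite (fun_comp ff) // /composable sbd_comp_top //; exact: fc.
  apply: f_inj; [exact: Xcomp | exact: Xcomp |].
  by rewrite !(fun_comp ff) // (compA wY) //; exact: fc.
- move=> k n x lt cx; have lt' := ltnW lt.
  have cb : is_cell X (sbd n x) by apply: sbd_cell_le.
  have cl := lift_cell' _ _ _ lt' cb.
  have fl : f (lift k (sbd n x)) = lift k (sbd n (f x)).
    by rewrite flift // (functor_sbd gX ff).
  have e : composable n x (lift k (sbd n x)).
    apply: compf => //; rewrite fl /composable tbd_lift //; last by apply: sbd_cell_le (fc _) => //; exact: omega_globular.
    exact: tbd_id.
  apply: f_inj => //; first exact: Xcomp.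
  by rewrite (fun_comp ff) // fl (comp_idr wY) //; exact: fc.
- move=> k n x lt cx; have lt' := ltnW lt.
  have cb : is_cell X (tbd n x) by apply: tbd_cell_le.
  have cl := lift_cell' _ _ _ lt' cb.
  have fl : f (lift k (tbd n x)) = lift k (tbd n (f x)).
    by rewrite flift // (functor_tbd gX ff).
  have e : composable n (lift k (tbd n x)) x.
    apply: compf => //; rewrite fl /composable sbd_lift //; last by apply: tbd_cell_le (fc _) => //; exact: omega_globular.
    exact: esym (sbd_id _).
  apply: f_inj => //; first exact: Xcomp.
  by rewrite (fun_comp ff) // fl (comp_idl wY) //; exact: fc.
- move=> k n y x lt cy cx yx; have c := Xcomp _ _ _ _ lt cy cx yx.
  have yx' := fcomp _ _ _ _ lt cy cx yx; have lt' := leqW lt.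
  have iy := Xidc _ _ cy; have ix := Xidc _ _ cx.
  have e : composable n (idc y) (idc x).
    apply: compf => //; rewrite !(fun_idc ff) // /composable.
    have cfx := fc cx; have cfy := fc cy; have le := ltnW lt.
    by rewrite tbd_tgt // (tgt_idc wY) // sbd_src // (src_idc wY).
  apply: f_inj; [exact: Xidc | exact: Xcomp |].
  by rewrite (fun_idc ff) // !(fun_comp ff) // (idc_comp wY) ?(fun_idc ff) //; exact: fc.
move=> k m n y' y x' x lt_nm lt_mk cy' cy cx' cx e1 e2 e3.
have lt_nk := ltn_trans lt_nm lt_mk.
have f1 := fcomp _ _ _ _ lt_mk cy' cy e1; have f2 := fcomp _ _ _ _ lt_mk cx' cx e2.
have f3 := fcomp _ _ _ _ lt_nk cy cx e3.
have [] := interchange_composable wY lt_nm lt_mk (fc cy') (fc cy) (fc cx') (fc cx) f1 f2 f3.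
move=> /(compf _ _ _ _ lt_nk cy' cx') h1' h2' h3'.
have c1 := Xcomp _ _ _ _ lt_mk cy' cy e1; have c2 := Xcomp _ _ _ _ lt_mk cx' cx e2.
have c3 := Xcomp _ _ _ _ lt_nk cy' cx' h1'; have c4 := Xcomp _ _ _ _ lt_nk cy cx e3.
have h2'' : composable n (comp m y' y) (comp m x' x) by apply: compf => //; rewrite !(fun_comp ff).
have h3'' : composable m (comp n y' x') (comp n y x) by apply: compf => //; rewrite !(fun_comp ff).
apply: f_inj; [exact: Xcomp | exact: Xcomp |].
by rewrite !(fun_comp ff) // (interchange wY) //; exact: fc.
Qed.

End Transport.

(** * Lax coslices: whiskering *)

Section Coslice.

Variable X : omega_data.
Hypothesis wX : is_omega_category X.
Variable a : amb X 0.
Let gX := omega_globular wX.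

Lemma coslice_globular : globular (coslice a).
Proof.
split=> n c /=; first by case=> -[].
- by case=> -[].
- by case=> -[_ _ []].
- by case=> -[_ _ []].
Qed.
Let gC := coslice_globular.

Notation bs i c := (@sbd (coslice a) _ i c).
Notation bt i c := (@tbd (coslice a) _ i c).

Lemma base_cell k (c : cos_amb X k) : cos_cell a c -> is_cell X (base c).
Proof. by case: k c => [|k] c /= => [[]|[_ [[]]]]. Qed.

Lemma bar_cell k (c : cos_amb X k) : cos_cell a c -> is_cell X (bar c).
Proof. by case: k c => [|k] c /= => [[]|[_ [_ []]]]. Qed.

Lemma src_base k (c : cos_amb X k.+1) : cos_cell a c -> src (base c) = base (tsrc c).
Proof. by move=> [_ [[]]]. Qed.

Lemma tgt_base k (c : cos_amb X k.+1) : cos_cell a c -> tgt (base c) = base (ttgt c).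
Proof. by move=> [_ [[]]]. Qed.

Lemma sbd_base k i (c : cos_amb X k) : i <= k -> cos_cell a c ->
  sbd i (base c) = base (bs i c).
Proof.
elim: k c => [|k IH] c; first by rewrite leqn0 => /eqP-> _; rewrite !sbd_id.
rewrite leq_eqVlt => /orP[/eqP-> _|]; first by rewrite !sbd_id.
rewrite ltnS => le_ik cc; rewrite sbd_src // src_base // IH ?(@sbd_src (coslice a)) //.
exact: (g_src gC).
Qed.

Lemma tbd_base k i (c : cos_amb X k) : i <= k -> cos_cell a c ->
  tbd i (base c) = base (bt i c).
Proof.
elim: k c => [|k IH] c; first by rewrite leqn0 => /eqP-> _; rewrite !tbd_id.
rewrite leq_eqVlt => /orP[/eqP-> _|]; first by rewrite !tbd_id.
rewrite ltnS => le_ik cc; rewrite tbd_tgt // tgt_base // IH ?(@tbd_tgt (coslice a)) //.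
exact: (g_tgt gC).
Qed.

Lemma bar_src_odd k (c : cos_amb X k) : odd k -> cos_cell a c ->
  src (bar c) = whisk c (base c) k.
Proof. by case: k c => // k c /= /negPf ok [_ [_ [_]]]; rewrite ok => -[]. Qed.

(** Stated with [whisk c (base c) k], the formula for the whiskered end of [bar c]
    also covers dimension 0, where nothing is whiskered. *)
Lemma bar_tgt_even k (c : cos_amb X k) : ~~ odd k -> cos_cell a c ->
  tgt (bar c) = whisk c (base c) k.
Proof.
case: k c => [|k] c /= => [_ []|] //.
by rewrite negbK => ok [_ [_ [_]]]; rewrite ok => -[].
Qed.

Lemma bar_tgt_odd k (c : cos_amb X k.+1) : odd k.+1 -> cos_cell a c ->
  tgt (bar c) = bar (ttgt c).
Proof. by move=> /= /negPf ok [_ [_ [_]]]; rewrite ok => -[]. Qed.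

Lemma bar_src_even k (c : cos_amb X k.+1) : ~~ odd k.+1 -> cos_cell a c ->
  src (bar c) = bar (tsrc c).
Proof. by rewrite /= negbK => ok [_ [_ [_]]]; rewrite ok => -[]. Qed.

Lemma bar_src0 (c : cos_amb X 0) : cos_cell a c -> src (bar c) = a.
Proof. by case. Qed.

(** [whisk c] depends only on the proper boundary of [c].  Frames keep just that
    part of a cell, so that whiskering can be studied while [c] is still under
    construction. *)
Definition cos_frame k : cos_amb X k -> Prop :=
  match k return cos_amb X k -> Prop with
  | 0 => fun _ => True
  | m.+1 => fun c =>
      [/\ cos_cell a (tsrc c), cos_cell a (ttgt c) & tparallel (tsrc c) (ttgt c)]
  end.

Lemma cell_frame k (c : cos_amb X k) : cos_cell a c -> cos_frame c.
Proof. by case: k c => // k c [[]]. Qed.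

Lemma frame_sbd k i (c : cos_amb X k) : i < k -> cos_frame c -> cos_cell a (bs i c).
Proof.
case: k c => // k c; rewrite ltnS => le_ik [cs _ _].
by rewrite (@sbd_src (coslice a)) //; apply: (sbd_cell_le gC).
Qed.

Lemma frame_tbd k i (c : cos_amb X k) : i < k -> cos_frame c -> cos_cell a (bt i c).
Proof.
case: k c => // k c; rewrite ltnS => le_ik [_ ct _].
by rewrite (@tbd_tgt (coslice a)) //; apply: (tbd_cell_le gC).
Qed.

Lemma frame_parallel k l (c : cos_amb X k.+1) : l < k -> cos_frame c ->
  bs l (tsrc c) = bs l (ttgt c) /\ bt l (tsrc c) = bt l (ttgt c).
Proof.
case: k c => // k c; rewrite ltnS => le_lk [_ _ [es et]].
rewrite !(@sbd_src (coslice a) k) // !(@tbd_tgt (coslice a) k) //=.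
by rewrite es et.
Qed.

Lemma frame_tbd_sbd k l i (c : cos_amb X k) : l < i -> i < k -> cos_frame c ->
  bt l (bs i c) = bt l c.
Proof.
case: k c => // k c lt_li; rewrite ltnS => le_ik fc; case: (fc) => cs ct _.
have lt_lk := leq_trans lt_li le_ik.
rewrite (@sbd_src (coslice a)) // (tbd_sbd_lt gC) // (@tbd_tgt (coslice a) k) 1?ltnW //=.
by case: (frame_parallel lt_lk fc).
Qed.

Lemma frame_sbd_tbd k l i (c : cos_amb X k) : l < i -> i < k -> cos_frame c ->
  bs l (bt i c) = bs l c.
Proof.
case: k c => // k c lt_li; rewrite ltnS => le_ik fc; case: (fc) => cs ct _.
have lt_lk := leq_trans lt_li le_ik.
rewrite (@tbd_tgt (coslice a)) // (sbd_tbd_lt gC) // (@sbd_src (coslice a) k) 1?ltnW //=.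
by case: (frame_parallel lt_lk fc).
Qed.

Lemma whisk_ext k k' (c : cos_amb X k) (c' : cos_amb X k') K (u : amb X K) j :
  (forall l, l < j -> bs l c = bs l c' /\ bt l c = bt l c') ->
  whisk c u j = whisk c' u j.
Proof.
elim: j => //= j IH e; rewrite IH => [|l lt_lj]; last by apply: e; rewrite ltnW.
have [es et] := e j (leqnn _).
by rewrite /mbar /pbar -!/(bs _ _) -!/(bt _ _) es et.
Qed.

Lemma whisk_sbd k i (c : cos_amb X k) K (u : amb X K) : i < k -> cos_frame c ->
  whisk (bs i c) u i = whisk c u i.
Proof.
move=> lt_ik fc; apply: whisk_ext => l lt_li.
by rewrite frame_tbd_sbd // (@sbd_sbd_le (coslice a)) // ltnW.
Qed.

Lemma whisk_tbd k i (c : cos_amb X k) K (u : amb X K) : i < k -> cos_frame c ->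
  whisk (bt i c) u i = whisk c u i.
Proof.
move=> lt_ik fc; apply: whisk_ext => l lt_li.
by rewrite frame_sbd_tbd // (@tbd_tbd_le (coslice a)) // ltnW.
Qed.

(** The boundary of [u] below dimension [j] lies under that of [c]: then
    [whisk c u j] is a composite of composable cells. *)
Definition fits k (c : cos_amb X k) K (u : amb X K) j :=
  forall i, i < j -> sbd i u = base (bs i c) /\ tbd i u = base (bt i c).

Definition whisk_good k (c : cos_amb X k) K (u : amb X K) j :=
  is_cell X (whisk c u j) /\
  forall d, j <= d -> d <= K -> sbd d (whisk c u j) = whisk c (sbd d u) j /\
                               tbd d (whisk c u j) = whisk c (tbd d u) j.

(** The [i]-dimensional boundary of a whiskered cell is the whiskering of its
    boundary, and so is the inner end of the bar that comes next. *)
Lemma whisk_composable_step k (c : cos_amb X k) K (u : amb X K) i :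
  cos_frame c -> i < k -> i < K -> fits c u i.+1 -> whisk_good c u i ->
  if odd i then composable i (lift K (pbar c i)) (whisk c u i)
  else composable i (whisk c u i) (lift K (mbar c i)).
Proof.
move=> fc lt_ik lt_iK fu [cw bw].
have [es et] := bw i (leqnn _) (ltnW lt_iK).
have [bsu btu] := fu i (leqnn _).
have cs := frame_sbd lt_ik fc; have ct := frame_tbd lt_ik fc.
case: ifP => oi; rewrite /composable.
  rewrite et sbd_lift // ?leqnSn //; last exact: bar_cell ct.
  by rewrite sbd_src // sbd_id bar_src_odd // btu whisk_tbd.
rewrite es tbd_lift // ?leqnSn //; last exact: bar_cell cs.
by rewrite tbd_tgt // tbd_id bar_tgt_even ?oi // bsu whisk_sbd.
Qed.

(** Whiskering commutes with the boundaries in dimensions at least [j], since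
    every factor added so far is an identity there. *)
Lemma whiskP k (c : cos_amb X k) K (u : amb X K) j :
  cos_frame c -> j <= k -> j <= K -> is_cell X u -> fits c u j -> whisk_good c u j.
Proof.
move=> fc; elim: j => [|i IH] lt_ik lt_iK cu fu; first by split.
have fu' : fits c u i by move=> l lt_li; apply: fu; rewrite ltnW.
have good := IH (ltnW lt_ik) (ltnW lt_iK) cu fu'.
have cp := whisk_composable_step fc lt_ik lt_iK fu good.
case: good => cw bw.
have cs := bar_cell (frame_sbd lt_ik fc); have ct := bar_cell (frame_tbd lt_ik fc).
have cls := lift_cell wX lt_iK cs; have clt := lift_cell wX lt_iK ct.
rewrite /whisk_good /= ; case: ifP cp => oi cp; (split; first exact: comp_cell) => d lt_id le_dK;
  have [es et] := bw d (ltnW lt_id) le_dK;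
  by rewrite (sbd_comp wX) // (tbd_comp wX) // es et (sbd_lift_ge wX) // (tbd_lift_ge wX).
Qed.

Lemma fitsW k (c : cos_amb X k) K (u : amb X K) i j :
  i <= j -> fits c u j -> fits c u i.
Proof. by move=> le_ij fu l lt_li; apply: fu; apply: leq_trans le_ij. Qed.

Lemma whisk_cell k (c : cos_amb X k) K (u : amb X K) j :
  cos_frame c -> j <= k -> j <= K -> is_cell X u -> fits c u j ->
  is_cell X (whisk c u j).
Proof. by move=> fc lt_jk lt_jK cu fu; case: (whiskP fc lt_jk lt_jK cu fu). Qed.

Lemma whisk_composable k (c : cos_amb X k) K (u : amb X K) i :
  cos_frame c -> i < k -> i < K -> is_cell X u -> fits c u i.+1 ->
  if odd i then composable i (lift K (pbar c i)) (whisk c u i)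
  else composable i (whisk c u i) (lift K (mbar c i)).
Proof.
move=> fc lt_ik lt_iK cu fu; apply: whisk_composable_step => //.
apply: whiskP => //; try exact: ltnW.
by move=> l lt_li; apply: fu; rewrite ltnW.
Qed.

(** This and the next three lemmas, with [parallel_bar_src] and
    [parallel_bar_tgt], show that the whiskered base is parallel to the other end
    prescribed for [bar c]: the definition of the slice asks for a cell between
    parallel cells. *)
Lemma src_whisk_even m (c : cos_amb X m.+1) (u : amb X m.+1) : ~~ odd m ->
  cos_frame c -> is_cell X u -> fits c u m.+1 ->
  src (whisk c u m.+1) = src (bar (tsrc c)).
Proof.
move=> om fc cu fu; have := whisk_composable fc (leqnn _) (leqnn _) cu fu.
rewrite /= (negPf om) /mbar -/(bs _ _) (@sbd_src (coslice a)) // sbd_id lift_id => cp.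
rewrite src_comp_top //.
by apply: whisk_cell => //; apply: fitsW fu.
by case: fc => cs _ _; apply: bar_cell.
Qed.

Lemma tgt_whisk_even m (c : cos_amb X m.+1) (u : amb X m.+1) : ~~ odd m ->
  cos_frame c -> is_cell X u -> fits c u m.+1 ->
  tgt (whisk c u m.+1) = tgt (bar (ttgt c)).
Proof.
move=> om fc cu fu; have := whisk_composable fc (leqnn _) (leqnn _) cu fu.
have [|cw bw] := @whiskP _ c _ u m fc (leqnSn _) (leqnSn _) cu.
  by move=> l lt_l; apply: fu; rewrite ltnW.
rewrite /= (negPf om) => cp.
have cl := lift_cell wX (leqnn _) (bar_cell (frame_sbd (leqnn _) fc)).
rewrite tgt_comp_top //.
have [_] := bw m (leqnn _) (leqnSn _); rewrite tbd_tgt // tbd_id => ->.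
have [_ ->] := fu m (leqnn _); rewrite (bar_tgt_even om); last by case: fc.
by rewrite -(@whisk_tbd _ m c) // (@tbd_tgt (coslice a)) // tbd_id.
Qed.

Lemma src_whisk_odd m (c : cos_amb X m.+1) (u : amb X m.+1) : odd m ->
  cos_frame c -> is_cell X u -> fits c u m.+1 ->
  src (whisk c u m.+1) = src (bar (tsrc c)).
Proof.
move=> om fc cu fu; have := whisk_composable fc (leqnn _) (leqnn _) cu fu.
have [|cw bw] := @whiskP _ c _ u m fc (leqnSn _) (leqnSn _) cu.
  by move=> l lt_l; apply: fu; rewrite ltnW.
rewrite /= om => cp.
have cl := lift_cell wX (leqnn _) (bar_cell (frame_tbd (leqnn _) fc)).
rewrite src_comp_top //.
have [+ _] := bw m (leqnn _) (leqnSn _); rewrite sbd_src // sbd_id => ->.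
have [-> _] := fu m (leqnn _); rewrite (bar_src_odd om); last by case: fc.
by rewrite -(@whisk_sbd _ m c) // (@sbd_src (coslice a)) // sbd_id.
Qed.

Lemma tgt_whisk_odd m (c : cos_amb X m.+1) (u : amb X m.+1) : odd m ->
  cos_frame c -> is_cell X u -> fits c u m.+1 ->
  tgt (whisk c u m.+1) = tgt (bar (ttgt c)).
Proof.
move=> om fc cu fu; have := whisk_composable fc (leqnn _) (leqnn _) cu fu.
rewrite /= om /pbar -/(bt _ _) (@tbd_tgt (coslice a)) // tbd_id lift_id => cp.
rewrite tgt_comp_top //; first by case: fc => _ ct _; apply: bar_cell.
by apply: whisk_cell => //; apply: fitsW fu.
Qed.

Lemma parallel_bar_src m (c : cos_amb X m.+1) : ~~ odd m -> cos_frame c ->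
  src (bar (tsrc c)) = src (bar (ttgt c)).
Proof.
case: m c => [|m] c om [cs ct]; first by rewrite !bar_src0.
by case=> es _; rewrite !bar_src_even // es.
Qed.

Lemma parallel_bar_tgt m (c : cos_amb X m.+1) : odd m -> cos_frame c ->
  tgt (bar (tsrc c)) = tgt (bar (ttgt c)).
Proof.
by case: m c => // m c om [cs ct [_ et]]; rewrite !bar_tgt_odd // et.
Qed.

Lemma base_fits m (c : cos_amb X m.+1) : cos_frame c ->
  src (base c) = base (tsrc c) -> tgt (base c) = base (ttgt c) ->
  fits c (base c) m.+1.
Proof.
case=> cs ct _ es et i lt_im.
rewrite sbd_src // tbd_tgt // es et sbd_base // tbd_base //.
by rewrite -(@sbd_src (coslice a)) // -(@tbd_tgt (coslice a)).
Qed.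

Lemma cell_fits k (c : cos_amb X k) j : j <= k -> cos_cell a c -> fits c (base c) j.
Proof.
move=> le_jk cc i lt_ij; have le_ik : i <= k by rewrite ltnW // (leq_trans lt_ij).
by rewrite sbd_base // tbd_base.
Qed.

Lemma whisk_src k (c : cos_amb X k.+1) K (u : amb X K) n : n <= k -> cos_cell a c ->
  whisk (tsrc c) u n = whisk c u n.
Proof.
move=> le_nk cc; apply: whisk_ext => l lt_ln; have lt_lk := leq_trans lt_ln le_nk.
by rewrite [bs l c](@sbd_src (coslice a)) 1?ltnW // [bt l c](tbd_src gC).
Qed.

Lemma whisk_tgt k (c : cos_amb X k.+1) K (u : amb X K) n : n <= k -> cos_cell a c ->
  whisk (ttgt c) u n = whisk c u n.
Proof.
move=> le_nk cc; apply: whisk_ext => l lt_ln; have lt_lk := leq_trans lt_ln le_nk.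
by rewrite [bt l c](@tbd_tgt (coslice a)) 1?ltnW // [bs l c](sbd_tgt gC).
Qed.

(** In dimension [n.+1] one end of [bar c] is a bar of the boundary of [c] and the
    other end is a whiskered cell, whatever the dimension of [c]: by globularity
    it is enough to follow, one dimension at a time, the end of [bar c] that is
    itself a bar. *)
Lemma bar_sbd_odd k n (c : cos_amb X k) : odd n -> n < k -> cos_cell a c ->
  sbd n.+1 (bar c) = bar (bs n c).
Proof.
move=> on; elim: k c => // k IH c; rewrite ltnS leq_eqVlt => /orP[/eqP e|lt_nk] cc.
  subst n; rewrite sbd_src // sbd_id (@sbd_src (coslice a)) // sbd_id.
  by rewrite bar_src_even //= on.
have cb := bar_cell cc; case/boolP: (odd k.+1) => ok.
  by rewrite (sbd_tgt gX) // bar_tgt_odd // IH ?(@sbd_tgt _ gC) //; apply: (g_tgt gC).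
rewrite (@sbd_src _ k.+1) 1?ltnW // bar_src_even // IH //; last exact: (g_src gC).
by rewrite (@sbd_src (coslice a) k) // ltnW.
Qed.

Lemma bar_tbd_even k n (c : cos_amb X k) : ~~ odd n -> n < k -> cos_cell a c ->
  tbd n.+1 (bar c) = bar (bt n c).
Proof.
move=> on; elim: k c => // k IH c; rewrite ltnS leq_eqVlt => /orP[/eqP e|lt_nk] cc.
  subst n; rewrite tbd_tgt // tbd_id (@tbd_tgt (coslice a)) // tbd_id.
  by rewrite bar_tgt_odd.
have cb := bar_cell cc; case/boolP: (odd k.+1) => ok; last first.
  by rewrite (tbd_src gX) // bar_src_even // IH ?(@tbd_src _ gC) //; apply: (g_src gC).
rewrite (@tbd_tgt _ k.+1) 1?ltnW // bar_tgt_odd // IH //; last exact: (g_tgt gC).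
by rewrite (@tbd_tgt (coslice a) k) // ltnW.
Qed.

Lemma bar_tbd_odd k n (c : cos_amb X k) : odd n -> n < k -> cos_cell a c ->
  tbd n.+1 (bar c) = comp n (pbar c n) (whisk c (tbd n.+1 (base c)) n).
Proof.
move=> on; elim: k c => // k IH c; rewrite ltnS leq_eqVlt => /orP[/eqP e|lt_nk] cc.
  subst n; rewrite tbd_tgt // tbd_id tbd_id.
  have on' : ~~ odd k.+1 by rewrite /= negbK.
  by rewrite (bar_tgt_even on' cc) /= on lift_id.
have cb := bar_cell cc; case/boolP: (odd k.+1) => ok.
  rewrite (@tbd_tgt X k.+1 _ (bar c)) 1?ltnW // bar_tgt_odd // IH //; last exact: (g_tgt gC).
  rewrite (@tbd_tgt _ k _ (base c)) // tgt_base // whisk_tgt // 1?ltnW //.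
  by rewrite /pbar -!/(bt _ _) (@tbd_tgt (coslice a) k) // ltnW.
have lt_nk' : n.+1 < k.
  by rewrite ltn_neqAle lt_nk andbT; apply/eqP => e; subst k; rewrite /= on in ok.
rewrite (tbd_src gX) // bar_src_even // IH //; last exact: (g_src gC).
rewrite (@tbd_src _ gX _ _ (base c)) //; last exact: base_cell cc.
rewrite src_base // whisk_src // 1?ltnW //.
by rewrite /pbar -!/(bt _ _) (@tbd_src _ gC).
Qed.

Lemma bar_sbd_even k n (c : cos_amb X k) : ~~ odd n -> n < k -> cos_cell a c ->
  sbd n.+1 (bar c) = comp n (whisk c (sbd n.+1 (base c)) n) (mbar c n).
Proof.
move=> on; elim: k c => // k IH c; rewrite ltnS leq_eqVlt => /orP[/eqP e|lt_nk] cc.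
  subst n; rewrite sbd_src // sbd_id sbd_id.
  by rewrite (@bar_src_odd _ c on cc) /= (negPf on) lift_id.
have cb := bar_cell cc; case/boolP: (odd k.+1) => ok; last first.
  rewrite (@sbd_src X k.+1 _ (bar c)) 1?ltnW // bar_src_even // IH //; last exact: (g_src gC).
  rewrite (@sbd_src _ k _ (base c)) // src_base // whisk_src // 1?ltnW //.
  by rewrite /mbar -!/(bs _ _) (@sbd_src (coslice a) k) // ltnW.
have lt_nk' : n.+1 < k.
  by rewrite ltn_neqAle lt_nk andbT; apply/eqP => e; subst k; rewrite /= negbK (negPf on) in ok.
rewrite (sbd_tgt gX) // bar_tgt_odd // IH //; last exact: (g_tgt gC).
rewrite (@sbd_tgt _ gX _ _ (base c)) //; last exact: base_cell cc.
rewrite tgt_base // whisk_tgt // 1?ltnW //.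
by rewrite /mbar -!/(bs _ _) (@sbd_tgt _ gC).
Qed.

End Coslice.

(** * Lax coslices: composition and functoriality *)

Section CosliceComp.

Variable X : omega_data.
Hypothesis wX : is_omega_category X.
Variable a : amb X 0.
Let gX := omega_globular wX.
Let gC := @coslice_globular X a.

Notation bs i c := (@sbd (coslice a) _ i c).
Notation bt i c := (@tbd (coslice a) _ i c).

Lemma composable_bds k n (y x : cos_amb X k) l : l < n -> n < k ->
  cos_cell a y -> cos_cell a x -> @composable (coslice a) k n y x ->
  bs l x = bs l y /\ bt l x = bt l y.
Proof.
move=> lt_ln lt_nk cy cx yx; have le_nk := ltnW lt_nk.
rewrite -(@sbd_tbd_lt _ gC _ l n x) // yx (@sbd_sbd_le (coslice a)) // 1?ltnW //.
by rewrite -(@tbd_tbd_le (coslice a) _ l n x) // 1?ltnW // yx (tbd_sbd_lt gC).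
Qed.

(** The whiskered cell that is inserted between the bars of the two factors of a
    composite. *)
Definition mid k n (y x : cos_amb X k) : amb X k.+1 :=
  whisk x (lift k.+1 (if odd n then tbd n.+1 (base x) else sbd n.+1 (base y))) n.

Lemma bar_compE k n (y x : cos_amb X k) :
  (cos_lab_comp n y x).2 = if odd n then comp n.+1 (comp n (bar y) (mid n y x)) (bar x)
                           else comp n.+1 (bar y) (comp n (mid n y x) (bar x)).
Proof. by rewrite /cos_lab_comp /mid /=; case: ifP. Qed.

Section Factors.

Variables (k n : nat) (y x : cos_amb X k).
Hypotheses (lt_nk : n < k) (cy : cos_cell a y) (cx : cos_cell a x).
Hypothesis yx : @composable (coslice a) k n y x.

Let v := if odd n then tbd n.+1 (base x) else sbd n.+1 (base y).

Lemma mid_arg_cell : is_cell X v.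
Proof.
by rewrite /v; case: ifP => _; [apply: tbd_cell_le | apply: sbd_cell_le] => //;
  apply: base_cell; [exact: cx | exact: cy].
Qed.

Let v_cell := mid_arg_cell.
Let x_base_cell := base_cell cx.
Let y_base_cell := base_cell cy.

Let v_sbd i : i <= n -> sbd i v = if odd n then base (bs i x) else base (bs i y).
Proof.
move=> le_in; rewrite /v; case: ifP => _.
  by rewrite (sbd_tbd_lt gX) // (sbd_base _ cx) // ltnW // (leq_ltn_trans le_in).
by rewrite sbd_sbd_le // 1?ltnW // (sbd_base _ cy) // ltnW // (leq_ltn_trans le_in).
Qed.

Let v_tbd i : i <= n -> tbd i v = if odd n then base (bt i x) else base (bt i y).
Proof.
move=> le_in; rewrite /v; case: ifP => _.
  by rewrite tbd_tbd_le // 1?ltnW // (tbd_base _ cx) // ltnW // (leq_ltn_trans le_in).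
by rewrite (tbd_sbd_lt gX) // (tbd_base _ cy) // ltnW // (leq_ltn_trans le_in).
Qed.

Lemma mid_fits : fits a x (lift k.+1 v) n.
Proof.
move=> i lt_in; have le_in := ltnW lt_in.
have [e1 e2] := composable_bds lt_in lt_nk cy cx yx.
by rewrite sbd_lift // 1?tbd_lift // 1?ltnW // v_sbd // v_tbd // e1 e2; case: ifP.
Qed.

Let lv_cell : is_cell X (lift k.+1 v).
Proof. by apply: lift_cell; rewrite // ltnW. Qed.

Lemma mid_good : whisk_good x (lift k.+1 v) n.
Proof. by apply: (whiskP wX (cell_frame cx) _ _ _ mid_fits) => //; rewrite ltnW // ltnW. Qed.

Lemma mid_cell : is_cell X (mid n y x).
Proof. by case: mid_good. Qed.

Lemma mid_sbd d : n < d -> d <= k.+1 -> sbd d (mid n y x) = whisk x (lift d v) n.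
Proof.
move=> lt_nd le_dk; have [_ /(_ d (ltnW lt_nd) le_dk)[-> _]] := mid_good.
by rewrite sbd_lift_ge.
Qed.

Lemma mid_tbd d : n < d -> d <= k.+1 -> tbd d (mid n y x) = whisk x (lift d v) n.
Proof.
move=> lt_nd le_dk; have [_ /(_ d (ltnW lt_nd) le_dk)[_ ->]] := mid_good.
by rewrite tbd_lift_ge.
Qed.

Lemma mid_sbdn : sbd n (mid n y x) = whisk x (base (if odd n then bs n x else bs n y)) n.
Proof.
have [_ /(_ n (leqnn _) (leqW (ltnW lt_nk)))[-> _]] := mid_good.
by rewrite sbd_lift // 1?ltnW // v_sbd //; case: ifP.
Qed.

Lemma mid_tbdn : tbd n (mid n y x) = whisk x (base (if odd n then bt n x else bt n y)) n.
Proof.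
have [_ /(_ n (leqnn _) (leqW (ltnW lt_nk)))[_ ->]] := mid_good.
by rewrite tbd_lift // 1?ltnW // v_tbd //; case: ifP.
Qed.

(** The whiskered end of the bar of the common [n]-boundary of the factors is an
    [n]-boundary of the inserted cell. *)
Lemma mid_inner : if odd n then composable n (bar y) (mid n y x)
                  else composable n (mid n y x) (bar x).
Proof.
have := mid_sbdn; have := mid_tbdn; case: ifP => on et es.
  rewrite /composable et -(@src_sbd X k.+1 n) 1?ltnW // (bar_sbd_odd wX on lt_nk cy) -yx.
  have ct : cos_cell a (bt n x) := tbd_cell_le gC (ltnW lt_nk) cx.
  by rewrite (bar_src_odd on ct) (whisk_tbd _ lt_nk (cell_frame cx)).
have on' : ~~ odd n by rewrite on.
rewrite /composable es -(@tgt_tbd X k.+1 n) 1?ltnW // (bar_tbd_even wX on' lt_nk cx) -yx.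
have ct : cos_cell a (bt n x) := tbd_cell_le gC (ltnW lt_nk) cx.
by rewrite (bar_tgt_even on' ct) (whisk_tbd _ lt_nk (cell_frame cx)).
Qed.

(** Both sides are the bar of the common [n]-boundary of [x] and [y], whiskered
    by the same cell. *)
Lemma mid_outer :
  if odd n then composable n.+1 (comp n (bar y) (mid n y x)) (bar x)
  else composable n.+1 (bar y) (comp n (mid n y x) (bar x)).
Proof.
have lt_nk1 : n < k.+1 by rewrite ltnW.
have cby := bar_cell cy; have cbx := bar_cell cx; have cm := mid_cell.
have ms := mid_sbd (leqnn _) lt_nk1; have mt := mid_tbd (leqnn _) lt_nk1.
have := mid_inner; case: ifP => on cp; rewrite /composable.
  rewrite (bar_tbd_odd wX on lt_nk cx) sbd_comp // ms lift_id /v on (bar_sbd_odd wX on lt_nk cy).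
  by rewrite -yx.
have on' : ~~ odd n by rewrite on.
rewrite (bar_sbd_even wX on' lt_nk cy) tbd_comp // mt lift_id /v on (bar_tbd_even wX on' lt_nk cx).
rewrite /mbar -/(bs _ _) -yx; congr comp; apply: whisk_ext => l lt_ln.
exact: composable_bds yx.
Qed.

Lemma bar_comp_cell : is_cell X (cos_lab_comp n y x).2.
Proof.
have lt_nk1 : n < k.+1 by rewrite ltnW.
have cby := bar_cell cy; have cbx := bar_cell cx; have cm := mid_cell.
rewrite bar_compE; have := mid_inner; have := mid_outer.
by case: ifP => on co ci; apply: comp_cell => //; apply: comp_cell.
Qed.

End Factors.

End CosliceComp.

Section Functor.

Variables (X Y : omega_data) (f : forall n, amb X n -> amb Y n).
Hypothesis wX : is_omega_category X.
Hypothesis ff : is_omega_functor f.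
Let gX := omega_globular wX.

Lemma functor_lift k n (x : amb X k) : k <= n -> is_cell X x ->
  f (lift n x) = lift n (f x).
Proof.
elim: n => [|n IH]; first by rewrite leqn0 => /eqP e; subst k; rewrite !lift_id.
rewrite leq_eqVlt => /orP[/eqP e|]; first by subst k; rewrite !lift_id.
rewrite ltnS => le_kn cx; rewrite !lift_idc // (fun_idc ff) ?IH //.
exact: lift_cell.
Qed.

Fixpoint cos_map k : cos_amb X k -> cos_amb Y k :=
  match k return cos_amb X k -> cos_amb Y k with
  | 0 => fun c => (f (base c), f (bar c))
  | m.+1 => fun c => ((cos_map (tsrc c), cos_map (ttgt c)), (f (base c), f (bar c)))
  end.

Lemma base_map k (c : cos_amb X k) : base (cos_map c) = f (base c).
Proof. by case: k c. Qed.

Lemma bar_map k (c : cos_amb X k) : bar (cos_map c) = f (bar c).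
Proof. by case: k c. Qed.

Variable a : amb X 0.

Lemma map_sbd k i (c : cos_amb X k) : i <= k ->
  @sbd (coslice (f a)) k i (cos_map c) = cos_map (@sbd (coslice a) k i c).
Proof.
elim: k c => [|k IH] c; first by rewrite leqn0 => /eqP->; rewrite !sbd_id.
rewrite leq_eqVlt => /orP[/eqP->|lt_nk]; first by rewrite !sbd_id.
by rewrite (@sbd_src (coslice (f a))) // (@sbd_src (coslice a)) // -IH.
Qed.

Lemma map_tbd k i (c : cos_amb X k) : i <= k ->
  @tbd (coslice (f a)) k i (cos_map c) = cos_map (@tbd (coslice a) k i c).
Proof.
elim: k c => [|k IH] c; first by rewrite leqn0 => /eqP->; rewrite !tbd_id.
rewrite leq_eqVlt => /orP[/eqP->|lt_nk]; first by rewrite !tbd_id.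
by rewrite (@tbd_tgt (coslice (f a))) // (@tbd_tgt (coslice a)) // -IH.
Qed.

(** A functor only has to preserve composites of composable cells, so this needs
    the frame to be fitted by [u]. *)
Lemma map_whisk k (c : cos_amb X k) K (u : amb X K) j :
  cos_frame a c -> j <= k -> j <= K -> is_cell X u -> fits a c u j ->
  f (whisk c u j) = whisk (cos_map c) (f u) j.
Proof.
move=> fc; elim: j => //= i IH lt_ik lt_iK cu fu.
have fu' := fitsW (leqnSn i) fu.
have cw := whisk_cell wX fc (ltnW lt_ik) (ltnW lt_iK) cu fu'.
have := whisk_composable wX fc lt_ik lt_iK cu fu.
have cs := bar_cell (frame_sbd lt_ik fc); have ct := bar_cell (frame_tbd lt_ik fc).
have es := @map_sbd k i c (ltnW lt_ik); have et := @map_tbd k i c (ltnW lt_ik).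
rewrite /mbar /pbar; rewrite -/(@sbd (coslice a) k i c) -/(@tbd (coslice a) k i c).
rewrite -/(@sbd (coslice (f a)) k i (cos_map c)) -/(@tbd (coslice (f a)) k i (cos_map c)).
rewrite es et !bar_map -!functor_lift // -IH 1?ltnW //.
by case: ifP => oi cp; rewrite (fun_comp ff) //; apply: lift_cell.
Qed.

Lemma map_parallel k (c d : cos_amb X k) :
  tparallel c d -> tparallel (cos_map c) (cos_map d).
Proof. by case: k c d => //= k c d [-> ->]. Qed.

Lemma map_cell k (c : cos_amb X k) : cos_cell a c -> cos_cell (f a) (cos_map c).
Proof.
elim: k c => [|m IH] c.
  case=> cb cr es et; split; rewrite ?base_map ?bar_map //.
  - exact: fun_cell.
  - exact: fun_cell.
  - by rewrite -(fun_src ff) // es.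
  - by rewrite -(fun_tgt ff) // et.
move=> cc; have fc := cell_frame cc; have := cc.
have cb := base_cell cc; have cr := bar_cell cc.
case=> [[cs ct p]] [[_ bs bt] [_ h]]; split; [|split; [|split]].
- split; [exact: IH | exact: IH |].
  exact: map_parallel.
- split; rewrite ?base_map; first exact: fun_cell.
    by rewrite -(fun_src ff) ?bs.
  by rewrite -(fun_tgt ff) ?bt.
- by rewrite bar_map; apply: fun_cell.
have fb : fits a c (base c) m.+1 by apply: cell_fits.
rewrite !base_map !bar_map -map_whisk // -(fun_src ff) // -(fun_tgt ff) //.
by move: h; case: ifP => om [-> ->].
Qed.

Lemma map_lab_comp k n (y x : cos_amb X k) : n < k -> cos_cell a y -> cos_cell a x ->
  @composable (coslice a) k n y x ->
  (f (cos_lab_comp n y x).1, f (cos_lab_comp n y x).2) =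
  cos_lab_comp n (cos_map y) (cos_map x).
Proof.
move=> lt_nk cy cx yx; rewrite [RHS]surjective_pairing; congr pair.
  have cbx := base_cell cx; have cby := base_cell cy.
  rewrite /= !base_map (fun_comp ff) //.
  by rewrite /composable (tbd_base _ cx) 1?ltnW // (sbd_base _ cy) 1?ltnW // yx.
have cby := bar_cell cy; have cbx := bar_cell cx.
have cm := mid_cell wX lt_nk cy cx yx.
have em : f (mid n y x) = mid n (cos_map y) (cos_map x).
  have cv := mid_arg_cell wX lt_nk cy cx; have le_nk : n.+1 <= k.+1 by apply: ltnW.
  rewrite /mid (map_whisk (cell_frame cx) (ltnW lt_nk) (leqW (ltnW lt_nk))); first last.
  - exact: mid_fits.
  - exact: lift_cell.
  rewrite !base_map functor_lift //.
  by case: ifP cv => _ cv; rewrite ?(functor_tbd gX ff) ?(functor_sbd gX ff) //;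
    apply: base_cell; [exact: cx | exact: cy].
have := mid_inner wX lt_nk cy cx yx; have := mid_outer wX lt_nk cy cx yx.
rewrite !bar_compE !bar_map -em; have lt_nk1 := ltnW lt_nk.
by case: ifP => on co ci; rewrite (fun_comp ff) ?(fun_comp ff) //; apply: comp_cell.
Qed.

Lemma map_tcomp k n (y x : cos_amb X k) : n < k -> cos_cell a y -> cos_cell a x ->
  @composable (coslice a) k n y x ->
  cos_map (@comp (coslice a) k n y x) = @comp (coslice (f a)) k n (cos_map y) (cos_map x).
Proof.
have gC := @coslice_globular X a.
elim: k y x => // k IH y x lt_nk cy cx yx.
have em := map_lab_comp lt_nk cy cx yx.
rewrite /= in em *; congr pair; last exact: em.
case: eqVneq => // ne_nk; have {ne_nk} lt_nk' : n < k.
  by rewrite ltn_neqAle ne_nk.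
congr pair; apply: IH => //; try exact: (g_src gC); try exact: (g_tgt gC).
  exact: (composable_src gC).
exact: (composable_tgt gC).
Qed.

Lemma map_cos_id k (c : cos_amb X k) : cos_cell a c -> cos_map (cos_id c) = cos_id (cos_map c).
Proof.
move=> cc; have cb := base_cell cc; have cr := bar_cell cc.
have eb : f (idc (base c)) = idc (base (cos_map c)) by rewrite base_map (fun_idc ff).
have er : f (idc (bar c)) = idc (bar (cos_map c)) by rewrite bar_map (fun_idc ff).
exact: (f_equal2 (fun p q => ((cos_map c, cos_map c), (p, q))) eb er).
Qed.

(** This is why the action on a coslice composes composable cells. *)
Lemma sbd0_bar k (c : cos_amb X k) : cos_cell a c -> sbd 0 (bar c) = a.
Proof.
elim: k c => [|k IH] c cc; first by rewrite sbd_src // sbd_id (bar_src0 cc).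
have cb := bar_cell cc; have gC := @coslice_globular X a.
case/boolP: (odd k.+1) => ok.
  by rewrite (sbd_tgt gX) // (bar_tgt_odd ok cc) IH //; apply: (g_tgt gC).
by rewrite sbd_src // (bar_src_even ok cc) IH //; apply: (g_src gC).
Qed.

Lemma map_act k (c : cos_amb X k) (h : amb X k.+1) : cos_cell a c -> is_cell X h ->
  tbd 0 h = a -> cos_map (cos_act c h) = cos_act (cos_map c) (f h).
Proof.
have gC := @coslice_globular X a.
elim: k c h => [|k IH] c h cc ch th.
  have cp : composable 0 (bar c) h by rewrite /composable th sbd0_bar.
  by rewrite /= /base /bar /= (fun_comp ff) //; apply: bar_cell cc.
have cp : composable 0 (bar c) h by rewrite /composable th sbd0_bar.
have cr := bar_cell cc.
have e0 : f (comp 0 (bar c) h) = comp 0 (bar (cos_map c)) (f h).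
  by rewrite bar_map (fun_comp ff).
have e1 : cos_map (cos_act (tsrc c) (src h)) = cos_act (cos_map (tsrc c)) (src (f h)).
  rewrite -(fun_src ff) //; apply: IH; [exact: (g_src gC) | exact: g_src |].
  by rewrite -(tbd_src gX).
have e2 : cos_map (cos_act (ttgt c) (tgt h)) = cos_act (cos_map (ttgt c)) (tgt (f h)).
  rewrite -(fun_tgt ff) //; apply: IH; [exact: (g_tgt gC) | exact: g_tgt |].
  by rewrite -tbd_tgt.
by rewrite [LHS]/= e1 e2; congr pair; congr pair.
Qed.

End Functor.

Lemma op_functor X Y (f : forall n, amb X n -> amb Y n) :
  is_omega_functor f -> @is_omega_functor (op X) (op Y) f.
Proof.
case=> h1 h2 h3 h4 h5; split=> //= k n y x lt_nk cy cx yx.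
by apply: h5 => //; apply: esym.
Qed.

Section CylBoundaries.

Variable X : omega_data.
Notation C := (cyl X).

Lemma sbd0_L k (h : amb X k.+1) : @sbd C k.+1 0 (CylL h) = inl (sbd 0 h).
Proof.
elim: k h => [|k IH] h; rewrite sbd_src // [in RHS]sbd_src //= ?sbd_id //; exact: IH.
Qed.

Lemma tbd0_L k (h : amb X k.+1) : @tbd C k.+1 0 (CylL h) = inl (tbd 0 h).
Proof.
elim: k h => [|k IH] h; rewrite tbd_tgt // [in RHS]tbd_tgt //= ?tbd_id //; exact: IH.
Qed.

Lemma sbd0_R k (h : amb X k.+1) : @sbd C k.+1 0 (CylR h) = inr (sbd 0 h).
Proof.
elim: k h => [|k IH] h; rewrite sbd_src // [in RHS]sbd_src //= ?sbd_id //; exact: IH.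
Qed.

Lemma tbd0_R k (h : amb X k.+1) : @tbd C k.+1 0 (CylR h) = inr (tbd 0 h).
Proof.
elim: k h => [|k IH] h; rewrite tbd_tgt // [in RHS]tbd_tgt //= ?tbd_id //; exact: IH.
Qed.

Lemma sbd0_M k a b (u : bis_amb X k) : @sbd C k.+1 0 (CylM a b u) = inl a.
Proof.
elim: k u => [|k IH] u; rewrite sbd_src //= ?sbd_id //; exact: IH.
Qed.

Lemma tbd0_M k a b (u : bis_amb X k) : @tbd C k.+1 0 (CylM a b u) = inr b.
Proof.
elim: k u => [|k IH] u; rewrite tbd_tgt //= ?tbd_id //; exact: IH.
Qed.

Lemma sbdS_L k n (h : amb X k.+1) : n <= k -> @sbd C k.+1 n.+1 (CylL h) = CylL (sbd n.+1 h).
Proof.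
elim: k h => [|k IH] h; first by rewrite leqn0 => /eqP->; rewrite !sbd_id.
rewrite leq_eqVlt => /orP[/eqP->|lt_nk]; first by rewrite !sbd_id.
by rewrite (@sbd_src C) // (@sbd_src X) // -IH.
Qed.

Lemma tbdS_L k n (h : amb X k.+1) : n <= k -> @tbd C k.+1 n.+1 (CylL h) = CylL (tbd n.+1 h).
Proof.
elim: k h => [|k IH] h; first by rewrite leqn0 => /eqP->; rewrite !tbd_id.
rewrite leq_eqVlt => /orP[/eqP->|lt_nk]; first by rewrite !tbd_id.
by rewrite (@tbd_tgt C) // (@tbd_tgt X) // -IH.
Qed.

Lemma sbdS_R k n (h : amb X k.+1) : n <= k -> @sbd C k.+1 n.+1 (CylR h) = CylR (sbd n.+1 h).
Proof.
elim: k h => [|k IH] h; first by rewrite leqn0 => /eqP->; rewrite !sbd_id.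
rewrite leq_eqVlt => /orP[/eqP->|lt_nk]; first by rewrite !sbd_id.
by rewrite (@sbd_src C) // (@sbd_src X) // -IH.
Qed.

Lemma tbdS_R k n (h : amb X k.+1) : n <= k -> @tbd C k.+1 n.+1 (CylR h) = CylR (tbd n.+1 h).
Proof.
elim: k h => [|k IH] h; first by rewrite leqn0 => /eqP->; rewrite !tbd_id.
rewrite leq_eqVlt => /orP[/eqP->|lt_nk]; first by rewrite !tbd_id.
by rewrite (@tbd_tgt C) // (@tbd_tgt X) // -IH.
Qed.

Lemma sbdS_M k n a b (u : bis_amb X k) : n <= k ->
  @sbd C k.+1 n.+1 (CylM a b u) = CylM a b (@sbd (coslice a) k n u.1, @sbd (slice b) k n u.2).
Proof.
elim: k u => [|k IH] [u v]; first by rewrite leqn0 => /eqP->; rewrite !sbd_id.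
rewrite leq_eqVlt => /orP[/eqP->|lt_nk]; first by rewrite !sbd_id.
rewrite (@sbd_src C) // (@sbd_src (coslice a)) // (@sbd_src (slice b)) //.
exact: (IH (_, _)).
Qed.

Lemma tbdS_M k n a b (u : bis_amb X k) : n <= k ->
  @tbd C k.+1 n.+1 (CylM a b u) = CylM a b (@tbd (coslice a) k n u.1, @tbd (slice b) k n u.2).
Proof.
elim: k u => [|k IH] [u v]; first by rewrite leqn0 => /eqP->; rewrite !tbd_id.
rewrite leq_eqVlt => /orP[/eqP->|lt_nk]; first by rewrite !tbd_id.
rewrite (@tbd_tgt C) // (@tbd_tgt (coslice a)) // (@tbd_tgt (slice b)) //.
exact: (IH (_, _)).
Qed.

(** The five ways for two cells of a cylinder to be composable: inside a copy,
    through an action (along objects only), or inside a/X/b. *)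
Variant cyl_composable_spec k : nat -> cyl_pos X k -> cyl_pos X k -> Prop :=
| CompLL n (h g : amb X k.+1) of composable n h g :
    cyl_composable_spec n (CylL h) (CylL g)
| CompRR n (h g : amb X k.+1) of composable n h g :
    cyl_composable_spec n (CylR h) (CylR g)
| CompML a b (u : bis_amb X k) (h : amb X k.+1) of tbd 0 h = a :
    cyl_composable_spec 0 (CylM a b u) (CylL h)
| CompRM a b (h : amb X k.+1) (u : bis_amb X k) of sbd 0 h = b :
    cyl_composable_spec 0 (CylR h) (CylM a b u)
| CompMM n a b (v u : bis_amb X k) of
      @composable (coslice a) k n v.1 u.1 & @composable (slice b) k n v.2 u.2 :
    cyl_composable_spec n.+1 (CylM a b v) (CylM a b u).

Lemma cyl_composableP k n (y x : cyl_pos X k) : n <= k ->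
  @composable C k.+1 n y x -> cyl_composable_spec n y x.
Proof.
rewrite /composable; case: n => [|n] le_nk; case: y => [h|h|a b v]; case: x => [g|g|a' b' u];
  rewrite ?sbd0_L ?tbd0_L ?sbd0_R ?tbd0_R ?sbd0_M ?tbd0_M.
all: rewrite ?(sbdS_L _ (ltnW le_nk)) ?(tbdS_L _ (ltnW le_nk)) ?(sbdS_R _ (ltnW le_nk))
  ?(tbdS_R _ (ltnW le_nk)) ?(sbdS_M _ _ _ (ltnW le_nk)) ?(tbdS_M _ _ _ (ltnW le_nk)) //.
all: by case=> *; subst; constructor.
Qed.

End CylBoundaries.

Section CylFunctor.

Variables (X Y : omega_data) (f : forall n, amb X n -> amb Y n).

Definition cyl_map n : amb (cyl X) n -> amb (cyl Y) n :=
  match n return amb (cyl X) n -> amb (cyl Y) n with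
  | 0 => fun x => match x with inl a => inl (f a) | inr b => inr (f b) end
  | m.+1 => fun x =>
      match x with
      | CylL h => CylL (f h) | CylR h => CylR (f h)
      | CylM a b u => CylM (f a) (f b) (cos_map f u.1, @cos_map (op X) (op Y) f m u.2)
      end
  end.

Hypothesis wX : is_omega_category X.
Hypothesis ff : is_omega_functor f.
Let wX' := op_omega wX.
Let ff' := op_functor ff.

Lemma cyl_functor : is_omega_functor cyl_map.
Proof.
split.
- case=> [|n] /=; first by case=> x cx; apply: fun_cell.
  case=> [x|x|a b [u v]] cx; try exact: fun_cell.
  case: cx => ca cb [/= cu cv e].
  split; try exact: fun_cell.
  split; first exact: (map_cell wX ff cu); first exact: (map_cell wX' ff' cv).
  by rewrite /= [LHS]base_map e [RHS]base_map.
- case=> [|n] /=; case=> [x|x|a b [u v]] cx //=; rewrite ?(fun_src ff) //.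
- case=> [|n] /=; case=> [x|x|a b [u v]] cx //=; rewrite ?(fun_tgt ff) //.
- case=> [|n] /=; first by case=> x cx; rewrite (fun_idc ff).
  case=> [x|x|a b [u v]] cx.
  - by rewrite /= (fun_idc ff).
  - by rewrite /= (fun_idc ff).
  case: cx => _ _ [/= cu cv _].
  exact: (f_equal2 (fun p q => CylM (f a) (f b) (p, q)) (map_cos_id ff cu) (map_cos_id ff' cv)).
move=> [|k] n // y x; rewrite ltnS => le_nk cy cx yx.
move: (le_nk) cy cx.
case: (cyl_composableP le_nk yx) => {le_nk n y x yx} [n h g hg|n h g hg|a b u h th|a b h u sh|n a b v u e1 e2] /=.
- by move=> le_nk ch cg; rewrite (fun_comp ff).
- by move=> le_nk ch cg; rewrite (fun_comp ff).
- move=> _ [ca cb [cu cv e]] ch; rewrite (functor_sbd (omega_globular wX) ff) //.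
  by congr CylM; rewrite /bis_ract /= (map_act wX ff cu).
- move=> _ ch [ca cb [cu cv e]]; rewrite (functor_tbd (omega_globular wX) ff) //.
  by congr CylM; rewrite /bis_lact /= (map_act wX' ff' cv).
move=> lt_nk [ca cb [cv cv' _]] [_ _ [cu cu' _]]; congr CylM.
rewrite [LHS]/=; congr pair; first exact: (map_tcomp wX ff lt_nk cv cu e1).
exact: (map_tcomp wX' ff' lt_nk cu' cv' (esym e2)).
Qed.

End CylFunctor.

Lemma cos_mapK X Y (f : forall n, amb X n -> amb Y n) (g : forall n, amb Y n -> amb X n)
    (a : amb X 0) k (c : cos_amb X k) :
  (forall n (x : amb X n), is_cell X x -> g n (f n x) = x) ->
  cos_cell a c -> cos_map g (cos_map f c) = c.
Proof.
move=> gK; elim: k c => [|k IH] c cc.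
  by case: cc; case: c => x y /= cx cy _ _; rewrite /base /bar /= !gK.
have cb := base_cell cc; have cr := bar_cell cc.
case: cc => [[cs ct _]] _.
transitivity (((tsrc c, ttgt c), (base c, bar c)) : cos_amb X k.+1).
  exact: (f_equal2 pair (f_equal2 pair (IH _ cs) (IH _ ct)) (f_equal2 pair (gK _ _ cb) (gK _ _ cr))).
by case: c {cb cr cs ct} => [[? ?] [? ?]].
Qed.

Lemma cyl_mapK X Y (f : forall n, amb X n -> amb Y n) (g : forall n, amb Y n -> amb X n) :
  (forall n (x : amb X n), is_cell X x -> g n (f n x) = x) ->
  forall n (x : amb (cyl X) n), is_cell (cyl X) x -> cyl_map g (cyl_map f x) = x.
Proof.
move=> gK [|n]; first by case=> x cx /=; rewrite gK.
case=> [x|x|a b [u v]] cx; [by rewrite /= gK | by rewrite /= gK |].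
case: cx => // ca cb [cu cv _] /=.
by rewrite !gK // (cos_mapK gK cu) (@cos_mapK (op X) (op Y) f g _ _ _ gK cv).
Qed.

Lemma cyl_isomorphic X Y : is_omega_category X -> is_omega_category Y ->
  isomorphic X Y -> isomorphic (cyl X) (cyl Y).
Proof.
move=> wX wY [f [g [ff fg gK fK]]].
exists (cyl_map f), (cyl_map g); split.
- exact: cyl_functor.
- exact: cyl_functor.
- exact: cyl_mapK.
- exact: cyl_mapK.
Qed.

(** * Closure of lax slices and cylinders, from labels *)

(** What is used of the labels of a cube: they are additive, determine a cell
    among parallel ones, and are disjoint for composable cells.  The record is
    invariant under duality, so that slices follow from coslices. *)
Record labelled (X : omega_data) (T : finType) (lab : forall k, amb X k -> {set T}) : Prop := {
  lab_comp : forall k n (y x : amb X k), n < k -> lab k (comp n y x) = lab k y :|: lab k x;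
  lab_idc : forall k (x : amb X k), lab k.+1 (idc x) = set0;
  lab_ext0 : forall x y : amb X 0, is_cell X x -> is_cell X y -> lab 0 x = lab 0 y -> x = y;
  lab_ext : forall k (x y : amb X k.+1), is_cell X x -> is_cell X y ->
    src x = src y -> tgt x = tgt y -> lab k.+1 x = lab k.+1 y -> x = y;
  lab_disj : forall k n (y x : amb X k), n < k -> is_cell X y -> is_cell X x ->
    composable n y x -> lab k y :&: lab k x = set0
}.

Lemma op_labelled X T lab : @labelled X T lab -> @labelled (op X) T lab.
Proof.
case=> h1 h2 h3 h4 h5; split=> //=.
- by move=> k n y x lt_nk; rewrite h1 // setUC.
- by move=> k x y cx cy es et; apply: h4.
- by move=> k n y x lt_nk cy cx yx; rewrite setIC; apply: (h5 _ n) => //; apply: esym.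
Qed.

Section Labelled.

Variables (X : omega_data) (T : finType) (lab : forall k, amb X k -> {set T}).
Arguments lab {k} _.
Hypotheses (wX : is_omega_category X) (lX : labelled (@lab)).
Let gX := omega_globular wX.

Lemma lab_lift k n (x : amb X k) : k < n -> lab (lift n x) = set0.
Proof. by case: n => // n; rewrite ltnS => le_kn; rewrite lift_idc // (lab_idc lX). Qed.

(** Below the top, all the factors added by whiskering are identities. *)
Lemma lab_whisk_lt k (c : cos_amb X k) K (u : amb X K) j : j < K ->
  lab (whisk c u j) = lab u.
Proof.
elim: j => //= j IH lt_jK; have lt_jK' := ltnW lt_jK.
by case: ifP => oj; rewrite (lab_comp lX) ?(ltnW lt_jK') // IH // lab_lift ?set0U ?setU0.
Qed.

(** Only the last factor has the full dimension, and it is a bar of one end of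
    [c]. *)
Lemma lab_whisk_top m (c : cos_amb X m.+1) (u : amb X m.+1) :
  lab (whisk c u m.+1) = lab u :|: lab (bar (if odd m then ttgt c else tsrc c)).
Proof.
have es : mbar c m = bar (tsrc c).
  by rewrite /mbar -/(@sbd (coslice (sbd 0 u)) _ _ c) sbd_src // sbd_id.
have et : pbar c m = bar (ttgt c).
  by rewrite /pbar -/(@tbd (coslice (sbd 0 u)) _ _ c) tbd_tgt // tbd_id.
rewrite /= es et !lift_id.
by case: ifP => om; rewrite (lab_comp lX) // lab_whisk_lt // setUC.
Qed.

Variable a : amb X 0.
Let gC := @coslice_globular X a.

Notation bs i c := (@sbd (coslice a) _ i c).
Notation bt i c := (@tbd (coslice a) _ i c).

(** The equation on the inner end of [bar c] is between parallel cells, so that it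
    can be checked on labels.  This replaces all computations with composites of
    whiskered cells. *)
Lemma cos_cellI m (c : cos_amb X m.+1) : cos_frame a c ->
  [/\ is_cell X (base c), src (base c) = base (tsrc c) & tgt (base c) = base (ttgt c)] ->
  is_cell X (bar c) ->
  (if odd m then src (bar c) = bar (tsrc c) /\
     lab (tgt (bar c)) = lab (base c) :|: lab (bar (ttgt c))
   else tgt (bar c) = bar (ttgt c) /\
     lab (src (bar c)) = lab (base c) :|: lab (bar (tsrc c))) ->
  cos_cell a c.
Proof.
move=> fc [cb es et] cr h; split=> //; split=> //; split=> //.
have fb := base_fits fc es et.
have cw := whisk_cell wX fc (leqnn _) (leqnn _) cb fb.
have lw := lab_whisk_top c (base c).
case: ifP h lw => om [e l] lw; split=> //.
  apply: (lab_ext lX) => //; first exact: tgt_cell.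
  - by rewrite -(g_ss gX) // e (src_whisk_odd wX om fc cb fb).
  - by rewrite -(g_tt gX) // e (tgt_whisk_odd wX om fc cb fb) (parallel_bar_tgt om fc).
  - by rewrite l lw.
have om' : ~~ odd m by rewrite om.
apply: (lab_ext lX) => //; first exact: src_cell.
- by rewrite (g_ss gX) // e (src_whisk_even wX om' fc cb fb) (parallel_bar_src om' fc).
- by rewrite (g_tt gX) // e (tgt_whisk_even wX om' fc cb fb).
- by rewrite l lw.
Qed.

Lemma lab_bar_tgt m (c : cos_amb X m.+1) : odd m -> cos_cell a c ->
  lab (tgt (bar c)) = lab (base c) :|: lab (bar (ttgt c)).
Proof.
move=> om cc; have om' : ~~ odd m.+1 by rewrite /= om.
by rewrite (bar_tgt_even om' cc) lab_whisk_top om.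
Qed.

Lemma lab_bar_src m (c : cos_amb X m.+1) : ~~ odd m -> cos_cell a c ->
  lab (src (bar c)) = lab (base c) :|: lab (bar (tsrc c)).
Proof.
by move=> om cc; rewrite (@bar_src_odd _ _ m.+1 c om cc) lab_whisk_top (negPf om).
Qed.

Lemma cos_id_cell k (c : cos_amb X k) : cos_cell a c -> cos_cell a (cos_id c).
Proof.
move=> cc; have cb := base_cell cc; have cr := bar_cell cc.
have fc : cos_frame a (cos_id c) by split=> //; case: k c {cc cb cr}.
apply: cos_cellI => //.
- by split; [exact: idc_cell | exact: src_idc | exact: tgt_idc].
- exact: idc_cell.
have -> : base (cos_id c) = idc (base c) by [].
have -> : bar (cos_id c) = idc (bar c) by [].
rewrite (lab_idc lX) set0U (src_idc wX) // (tgt_idc wX) //.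
by case: ifP.
Qed.

(** The restriction on parities is harmless: the source of a bar is a bar exactly
    when [m] is odd, and then an odd [n] below [m] is below [m] by at least 2. *)
Lemma mid_src m n (y x : cos_amb X m.+1) : n < m -> (odd n -> n.+1 < m) ->
  cos_cell a y -> cos_cell a x -> @composable (coslice a) m.+1 n y x ->
  src (mid n y x) = mid n (tsrc y) (tsrc x).
Proof.
move=> lt_nm hn cy cx yx; have lt_nm1 : n < m.+1 by apply: ltnW.
have cv := mid_arg_cell wX lt_nm1 cy cx.
have := mid_sbd wX lt_nm1 cy cx yx lt_nm1 (leqnSn _); rewrite sbd_src // sbd_id => ->.
rewrite /mid (whisk_src _ _ cx) 1?ltnW //; congr (whisk _ (lift _ _) _).
case: ifP hn => on hn.
  by rewrite (tbd_src gX) ?hn // 1?(src_base cx) //; apply: base_cell cx.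
by rewrite sbd_src // (src_base cy).
Qed.

Lemma mid_tgt m n (y x : cos_amb X m.+1) : n < m -> (~~ odd n -> n.+1 < m) ->
  cos_cell a y -> cos_cell a x -> @composable (coslice a) m.+1 n y x ->
  tgt (mid n y x) = mid n (ttgt y) (ttgt x).
Proof.
move=> lt_nm hn cy cx yx; have lt_nm1 : n < m.+1 by apply: ltnW.
have cv := mid_arg_cell wX lt_nm1 cy cx.
have := mid_tbd wX lt_nm1 cy cx yx lt_nm1 (leqnSn _); rewrite tbd_tgt // tbd_id => ->.
rewrite /mid (whisk_tgt _ _ cx) 1?ltnW //; congr (whisk _ (lift _ _) _).
case: ifP hn => on hn.
  by rewrite tbd_tgt // (tgt_base cx).
by rewrite (sbd_tgt gX) ?hn // 1?(tgt_base cy) //; apply: base_cell cy.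
Qed.

Lemma lab_mid k n (y x : cos_amb X k) : n < k -> lab (mid n y x) = set0.
Proof. by move=> lt_nk; rewrite lab_whisk_lt ?lab_lift // ltnW. Qed.

Lemma lab_bar_comp k n (y x : cos_amb X k) : n < k ->
  lab (cos_lab_comp n y x).2 = lab (bar y) :|: lab (bar x).
Proof.
move=> lt_nk; rewrite bar_compE; have lt_nk1 : n < k.+1 by apply: ltnW.
by case: ifP => on; rewrite !(lab_comp lX) // lab_mid // ?setU0 ?set0U.
Qed.

Lemma src_bar_comp m n (y x : cos_amb X m.+1) : n < m ->
  cos_cell a y -> cos_cell a x -> @composable (coslice a) m.+1 n y x ->
  src (cos_lab_comp n y x).2 =
    if odd n then comp n.+1 (comp n (src (bar y)) (src (mid n y x))) (src (bar x))
    else comp n.+1 (src (bar y)) (comp n (src (mid n y x)) (src (bar x))).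
Proof.
move=> lt_nm cy cx yx; have lt_nm1 : n < m.+1 by apply: ltnW.
have cby := bar_cell cy; have cbx := bar_cell cx.
have cm := mid_cell wX lt_nm1 cy cx yx.
rewrite bar_compE; have := mid_inner wX lt_nm1 cy cx yx; have := mid_outer wX lt_nm1 cy cx yx.
have lt2 : n < m.+2 by apply: ltnW.
by case: ifP => on co ci; rewrite !(src_comp wX) //; apply: comp_cell.
Qed.

Lemma tgt_bar_comp m n (y x : cos_amb X m.+1) : n < m ->
  cos_cell a y -> cos_cell a x -> @composable (coslice a) m.+1 n y x ->
  tgt (cos_lab_comp n y x).2 =
    if odd n then comp n.+1 (comp n (tgt (bar y)) (tgt (mid n y x))) (tgt (bar x))
    else comp n.+1 (tgt (bar y)) (comp n (tgt (mid n y x)) (tgt (bar x))).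
Proof.
move=> lt_nm cy cx yx; have lt_nm1 : n < m.+1 by apply: ltnW.
have cby := bar_cell cy; have cbx := bar_cell cx.
have cm := mid_cell wX lt_nm1 cy cx yx.
rewrite bar_compE; have := mid_inner wX lt_nm1 cy cx yx; have := mid_outer wX lt_nm1 cy cx yx.
have lt2 : n < m.+2 by apply: ltnW.
by case: ifP => on co ci; rewrite !(tgt_comp wX) //; apply: comp_cell.
Qed.

Lemma base_composable k n (y x : cos_amb X k) : n < k -> cos_cell a y -> cos_cell a x ->
  @composable (coslice a) k n y x -> composable n (base y) (base x).
Proof.
move=> lt_nk cy cx yx; have le_nk := ltnW lt_nk.
by rewrite /composable (tbd_base le_nk cx) (sbd_base le_nk cy) yx.
Qed.

Lemma composable_top m (y x : cos_amb X m.+1) :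
  @composable (coslice a) m.+1 m y x -> ttgt x = tsrc y.
Proof. by rewrite /composable tbd_tgt // sbd_src // tbd_id sbd_id. Qed.

Lemma base_tcomp k n (y x : cos_amb X k) : 0 < k ->
  base (@comp (coslice a) k n y x) = comp n (base y) (base x).
Proof. by case: k y x. Qed.

Lemma bar_tcomp k n (y x : cos_amb X k) : 0 < k ->
  bar (@comp (coslice a) k n y x) = (cos_lab_comp n y x).2.
Proof. by case: k y x. Qed.

Lemma tcomp_parallel k n (y x y' x' : cos_amb X k) :
  tparallel y y' -> tparallel x x' ->
  tparallel (@comp (coslice a) k n y x) (@comp (coslice a) k n y' x').
Proof.
case: k y x y' x' => //= k y x y' x' [e1 e2] [e3 e4].
by rewrite /tsrc /ttgt /= -!/(tsrc _) -!/(ttgt _) e1 e2 e3 e4.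
Qed.

Lemma parallel_trans k (x y z : cos_amb X k) :
  tparallel x y -> tparallel y z -> tparallel x z.
Proof. by case: k x y z => //= k x y z [-> ->]. Qed.

(** The outer end of the bar of a composite is the bar of the composite of the
    ends; [cos_cellI] reduces the inner end to the label of a union. *)
Lemma coslice_comp_cell k n (y x : cos_amb X k) : n < k -> cos_cell a y -> cos_cell a x ->
  @composable (coslice a) k n y x -> cos_cell a (@comp (coslice a) k n y x).
Proof.
elim: k y x => // m IH y x lt_nk cy cx yx.
have cby := base_cell cy; have cbx := base_cell cx.
have bc := base_composable lt_nk cy cx yx.
set z := @comp _ _ _ _ _.
have bz : base z = comp n (base y) (base x) by [].
have rz : bar z = (cos_lab_comp n y x).2 by [].
have [[cys cyt py] _] := cy; have [[cxs cxt px] _] := cx.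
move: lt_nk; rewrite ltnS leq_eqVlt => /orP[/eqP e|lt_nm].
  (* Along the top dimension, each end of the composite is an end of one factor. *)
  subst n; have sz : tsrc z = tsrc x by rewrite /tsrc /= eqxx.
  have tz : ttgt z = ttgt y by rewrite /ttgt /= eqxx.
  have e := composable_top yx.
  apply: cos_cellI; rewrite ?bz ?rz ?sz ?tz.
  - split; rewrite ?sz ?tz //.
    by apply: parallel_trans px _; rewrite e.
  - by split; [exact: comp_cell | rewrite src_comp_top // (src_base cx)
      | rewrite tgt_comp_top // (tgt_base cy)].
  - exact: (bar_comp_cell wX _ cy cx yx).
  have cm := mid_cell wX (leqnn _) cy cx yx.
  have cry := bar_cell cy; have crx := bar_cell cx.
  rewrite bar_compE; have := mid_inner wX (leqnn _) cy cx yx.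
  have := mid_outer wX (leqnn _) cy cx yx.
  have lt_m2 : m < m.+2 by rewrite ltnW.
  case: ifP => om co ci.
    rewrite (src_comp_top wX) //; last exact: comp_cell.
    rewrite (tgt_comp_top wX) //; last exact: comp_cell.
    rewrite (tgt_comp wX) // (lab_comp lX) // (lab_bar_tgt om cy).
    have -> : lab (tgt (mid m y x)) = lab (base x).
      have := mid_tbd wX (leqnn _) cy cx yx (leqnn _) (leqnSn _).
      rewrite tbd_tgt // tbd_id => ->; rewrite lab_whisk_lt // om lift_id.
      by rewrite [tbd _ _]tbd_id.
    split; first by rewrite (bar_src_even _ cx) //= om.
    by rewrite (lab_comp lX) // -!setUA; congr (_ :|: _); rewrite setUC.
  have om' : ~~ odd m by rewrite om.
  rewrite (tgt_comp_top wX) //; last exact: comp_cell.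
  rewrite (src_comp_top wX) //; last exact: comp_cell.
  rewrite (src_comp wX) // (lab_comp lX) // (lab_bar_src om' cx).
  have -> : lab (src (mid m y x)) = lab (base y).
    have := mid_sbd wX (leqnn _) cy cx yx (leqnn _) (leqnSn _).
    rewrite sbd_src // sbd_id => ->; rewrite lab_whisk_lt // om lift_id.
    by rewrite [sbd _ _]sbd_id.
  split; first by rewrite (bar_tgt_odd _ cy) //= om.
  by rewrite (lab_comp lX) // -!setUA.
(* In lower dimensions, composition commutes with both ends. *)
have ne_nm : (n == m) = false by rewrite ltn_eqF.
have sz : tsrc z = @comp (coslice a) m n (tsrc y) (tsrc x) by rewrite /tsrc /= ne_nm.
have tz : ttgt z = @comp (coslice a) m n (ttgt y) (ttgt x) by rewrite /ttgt /= ne_nm.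
have lt_nm1 : n < m.+1 by apply: ltnW.
have cps : @composable (coslice a) m n (tsrc y) (tsrc x) by apply: (composable_src gC).
have cpt : @composable (coslice a) m n (ttgt y) (ttgt x) by apply: (composable_tgt gC).
have rsz : bar (tsrc z) = (cos_lab_comp n (tsrc y) (tsrc x)).2.
  by rewrite sz bar_tcomp // (leq_trans _ lt_nm).
have rtz : bar (ttgt z) = (cos_lab_comp n (ttgt y) (ttgt x)).2.
  by rewrite tz bar_tcomp // (leq_trans _ lt_nm).
have bsz : base (tsrc z) = comp n (base (tsrc y)) (base (tsrc x)).
  by rewrite sz base_tcomp // (leq_trans _ lt_nm).
have btz : base (ttgt z) = comp n (base (ttgt y)) (base (ttgt x)).
  by rewrite tz base_tcomp // (leq_trans _ lt_nm).
have cm := mid_cell wX lt_nm1 cy cx yx.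
apply: cos_cellI.
- split; [by rewrite sz; apply: IH | by rewrite tz; apply: IH |].
  by rewrite sz tz; apply: tcomp_parallel.
- rewrite bsz btz bz; split; first exact: comp_cell.
    by rewrite (src_comp wX) // (src_base cy) (src_base cx).
  by rewrite (tgt_comp wX) // (tgt_base cy) (tgt_base cx).
- exact: (bar_comp_cell wX _ cy cx yx).
rewrite rsz rtz rz bz !lab_bar_comp // src_bar_comp // tgt_bar_comp //.
have le_m1 : n.+1 < m.+1 by [].
have lm : lab (tgt (mid n y x)) = set0.
  have := mid_tbd wX lt_nm1 cy cx yx lt_nm1 (leqnSn _); rewrite tbd_tgt // tbd_id => ->.
  by rewrite lab_whisk_lt // lab_lift.
have lm' : lab (src (mid n y x)) = set0.
  have := mid_sbd wX lt_nm1 cy cx yx lt_nm1 (leqnSn _); rewrite sbd_src // sbd_id => ->.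
  by rewrite lab_whisk_lt // lab_lift.
have reorg (A B C D : {set T}) : A :|: B :|: (C :|: D) = A :|: C :|: (B :|: D).
  by rewrite -!setUA; congr (_ :|: _); rewrite setUCA.
have h1 : odd m -> odd n -> n.+1 < m.
  by move=> om on; rewrite ltn_neqAle lt_nm andbT; apply/eqP => e; subst m; rewrite /= on in om.
have h2 : ~~ odd m -> ~~ odd n -> n.+1 < m.
  by move=> om on; rewrite ltn_neqAle lt_nm andbT; apply/eqP => e; subst m; rewrite /= on in om.
case: ifPn => om.
  have om' : ~~ odd m.+1 by rewrite /= om.
  rewrite bar_compE (bar_src_even om' cy) (bar_src_even om' cx) mid_src //; last exact: h1.
  split; first by case: ifP.
  rewrite (lab_comp lX) // -reorg -(lab_bar_tgt om cy) -(lab_bar_tgt om cx).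
  by case: ifP => on; rewrite !(lab_comp lX) // lm ?setU0 ?set0U.
have om' : odd m.+1 by rewrite /= om.
rewrite bar_compE (bar_tgt_odd om' cy) (bar_tgt_odd om' cx) mid_tgt //; last exact: h2.
split; first by case: ifP.
rewrite (lab_comp lX) // -reorg -(lab_bar_src om cy) -(lab_bar_src om cx).
by case: ifP => on; rewrite !(lab_comp lX) // lm' ?setU0 ?set0U.
Qed.

End Labelled.

Section Closure.

Variables (X : omega_data) (T : finType) (lab : forall k, amb X k -> {set T}).
Hypotheses (wX : is_omega_category X) (lX : labelled lab).
Let gX := omega_globular wX.

Lemma act_parallel k (d e : cos_amb X k.+1) (g h : amb X k.+2) :
  tparallel d e -> src g = src h -> tgt g = tgt h -> tparallel (cos_act d g) (cos_act e h).
Proof. by case=> e1 e2 e3 e4; rewrite /= /tsrc /ttgt /= -!/(tsrc _) -!/(ttgt _) e1 e2 e3 e4. Qed.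

Lemma act_cell (a : amb X 0) k (c : cos_amb X k) (h : amb X k.+1) : cos_cell a c -> is_cell X h ->
  tbd 0 h = a -> cos_cell (sbd 0 h) (cos_act c h).
Proof.
have gC := @coslice_globular X a.
elim: k c h => [|m IH] c h cc ch th.
  have cp : composable 0 (bar c) h by rewrite /composable th (sbd0_bar wX cc).
  have cr := bar_cell cc; have cb := base_cell cc.
  split=> //; rewrite /bar /=; first exact: comp_cell.
    by rewrite src_comp_top // sbd_src // sbd_id.
  by rewrite tgt_comp_top // (bar_tgt_even _ cc).
have cp : composable 0 (bar c) h by rewrite /composable th (sbd0_bar wX cc).
have cr := bar_cell cc; have cb := base_cell cc.
have cs := g_src gC cc; have ct := g_tgt gC cc.
have bE j (d : cos_amb X j) g : base (cos_act d g) = base d by case: j d g.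
have rE j (d : cos_amb X j) g : bar (cos_act d g) = comp 0 (bar d) g by case: j d g.
set z := cos_act c h.
have sz : tsrc z = cos_act (tsrc c) (src h) by [].
have tz : ttgt z = cos_act (ttgt c) (tgt h) by [].
have par : tparallel (tsrc c) (ttgt c) by case: cc => [[]].
apply: (cos_cellI wX lX).
- rewrite /cos_frame sz tz; split.
  + by rewrite sbd_src //; apply: IH; [| exact: src_cell | rewrite -(tbd_src gX)].
  + by rewrite (sbd_tgt gX) //; apply: IH; [| exact: tgt_cell | rewrite -tbd_tgt].
  case: m c h par ch {IH cc th cp cr cb cs ct z sz tz} => // m c h par ch.
  by apply: act_parallel => //; [apply: g_ss | apply: g_tt].
- by rewrite sz tz !bE; split=> //; [apply: src_base cc | apply: tgt_base cc].
- by rewrite rE; apply: comp_cell.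
rewrite sz tz !rE bE (src_comp wX) // (tgt_comp wX) // !(lab_comp lX) //.
case: ifPn => om.
  by rewrite (lab_bar_tgt lX om cc) (bar_src_even _ cc) /= ?om // setUA.
by rewrite (lab_bar_src lX om cc) (bar_tgt_odd _ cc) /= ?om // setUA.
Qed.

End Closure.

Lemma slice_globular X (b : amb X 0) : globular (slice b).
Proof.
case: (@coslice_globular (op X) b) => h1 h2 h3 h4.
by split=> // n x cx; [exact: esym (h4 _ _ cx) | exact: esym (h3 _ _ cx)].
Qed.

Section CylStructure.

Variable X : omega_data.
Hypothesis wX : is_omega_category X.
Let gX := omega_globular wX.

Lemma cyl_src_cell n (x : amb (cyl X) n.+1) : is_cell (cyl X) x -> is_cell (cyl X) (src x).
Proof.
case: n x => [|n] [h|h|a b [u v]] cx; try exact: (src_cell wX cx); case: cx => ca cb [cu cv e] //.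
split=> //; split; [exact: (g_src (@coslice_globular X a) cu) | exact: (g_src (@slice_globular X b) cv) |].
by rewrite -(src_base cu) -(tgt_base cv) /= e.
Qed.

Lemma cyl_tgt_cell n (x : amb (cyl X) n.+1) : is_cell (cyl X) x -> is_cell (cyl X) (tgt x).
Proof.
case: n x => [|n] [h|h|a b [u v]] cx; try exact: (tgt_cell wX cx); case: cx => ca cb [cu cv e] //.
split=> //; split; [exact: (g_tgt (@coslice_globular X a) cu) | exact: (g_tgt (@slice_globular X b) cv) |].
by rewrite -(tgt_base cu) -(src_base cv) /= e.
Qed.

Lemma cyl_globular : globular (cyl X).
Proof.
split; [exact: cyl_src_cell | exact: cyl_tgt_cell | |].
  case=> [|n] [h|h|a b [u v]] cx //=; rewrite ?(g_ss gX) //; case: cx => _ _ [cu cv _].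
  by congr (CylM _ _ (_, _)); [exact: (g_ss (@coslice_globular X a) cu) | exact: (g_ss (@slice_globular X b) cv)].
case=> [|n] [h|h|a b [u v]] cx //=; rewrite ?(g_tt gX) //; case: cx => _ _ [cu cv _].
by congr (CylM _ _ (_, _)); [exact: (g_tt (@coslice_globular X a) cu) | exact: (g_tt (@slice_globular X b) cv)].
Qed.

(** The axioms on boundaries of composites, in one formula. *)
Lemma cyl_src_compE k n (y x : cyl_pos X k) : n <= k ->
  @is_cell (cyl X) k.+1 y -> @is_cell (cyl X) k.+1 x -> @composable (cyl X) k.+1 n y x ->
  @src (cyl X) k (@comp (cyl X) k.+1 n y x) =
  if n == k then @src (cyl X) k x else @comp (cyl X) k n (@src (cyl X) k y) (@src (cyl X) k x).
Proof.
move=> le_nk cy cx yx; move: (le_nk) cy cx.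
case: (cyl_composableP le_nk yx) => {le_nk n y x yx}
  [n h g hg|n h g hg|a b u h th|a b h u sh|n a b v u e1 e2].
- case: eqVneq => [e|ne] le_nk ch cg.
    subst n; case: k h g hg {le_nk} ch cg => [|k] h g hg ch cg;
      by rewrite /= (src_comp_top wX).
  case: k h g hg ch cg ne le_nk => [|k] h g hg ch cg ne le_nk; first by case: n ne le_nk {hg}.
  by rewrite /= (src_comp wX) // ltn_neqAle ne.
- case: eqVneq => [e|ne] le_nk ch cg.
    subst n; case: k h g hg {le_nk} ch cg => [|k] h g hg ch cg;
      by rewrite /= (src_comp_top wX).
  case: k h g hg ch cg ne le_nk => [|k] h g hg ch cg ne le_nk; first by case: n ne le_nk {hg}.
  by rewrite /= (src_comp wX) // ltn_neqAle ne.
- move=> _ cu ch; case: k u h th cu ch => [|k] u h th cu ch /=.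
    by rewrite sbd_src // sbd_id.
  by rewrite sbd_src.
- move=> _ ch cu; case: k u h sh cu ch => [|k] u h sh cu ch //=.
  by rewrite (tbd_src gX).
case: k v u e1 e2 => // k [v v'] [u u'] e1 e2 lt_nk _ _.
by rewrite eqSS /=; case: (eqVneq n k).
Qed.

Lemma cyl_tgt_compE k n (y x : cyl_pos X k) : n <= k ->
  @is_cell (cyl X) k.+1 y -> @is_cell (cyl X) k.+1 x -> @composable (cyl X) k.+1 n y x ->
  @tgt (cyl X) k (@comp (cyl X) k.+1 n y x) =
  if n == k then @tgt (cyl X) k y else @comp (cyl X) k n (@tgt (cyl X) k y) (@tgt (cyl X) k x).
Proof.
move=> le_nk cy cx yx; move: (le_nk) cy cx.
case: (cyl_composableP le_nk yx) => {le_nk n y x yx}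
  [n h g hg|n h g hg|a b u h th|a b h u sh|n a b v u e1 e2].
- case: eqVneq => [e|ne] le_nk ch cg.
    subst n; case: k h g hg {le_nk} ch cg => [|k] h g hg ch cg;
      by rewrite /= (tgt_comp_top wX).
  case: k h g hg ch cg ne le_nk => [|k] h g hg ch cg ne le_nk; first by case: n ne le_nk {hg}.
  by rewrite /= (tgt_comp wX) // ltn_neqAle ne.
- case: eqVneq => [e|ne] le_nk ch cg.
    subst n; case: k h g hg {le_nk} ch cg => [|k] h g hg ch cg;
      by rewrite /= (tgt_comp_top wX).
  case: k h g hg ch cg ne le_nk => [|k] h g hg ch cg ne le_nk; first by case: n ne le_nk {hg}.
  by rewrite /= (tgt_comp wX) // ltn_neqAle ne.
- move=> _ cu ch; case: k u h th cu ch => [|k] u h th cu ch //=.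
  by rewrite (sbd_tgt gX).
- move=> _ ch cu; case: k u h sh cu ch => [|k] u h sh cu ch //=.
case: k v u e1 e2 => // k [v v'] [u u'] e1 e2 lt_nk _ _.
by rewrite eqSS /=; case: (eqVneq n k).
Qed.

End CylStructure.

Section CylClosure.

Variables (X : omega_data) (T : finType) (lab : forall k, amb X k -> {set T}).
Hypotheses (wX : is_omega_category X) (lX : labelled lab).
Let wX' := op_omega wX.
Let gX := omega_globular wX.
Let lX' := op_labelled lX.

Lemma cyl_idc_cell n (x : amb (cyl X) n) : is_cell (cyl X) x -> is_cell (cyl X) (idc x).
Proof.
case: n x => [|n] /=; first by case=> x cx; apply: idc_cell.
case=> [h|h|a b [u v]] cx; try exact: (idc_cell wX cx); case: cx => ca cb [cu cv e].
split=> //; split; first exact: (cos_id_cell wX lX cu).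
  exact: (cos_id_cell wX' lX' cv).
by congr idc.
Qed.

Lemma cyl_comp_cell k n (y x : amb (cyl X) k) : n < k -> is_cell (cyl X) y ->
  is_cell (cyl X) x -> composable n y x -> is_cell (cyl X) (comp n y x).
Proof.
case: k y x => // k y x; rewrite ltnS => le_nk cy cx yx; move: (le_nk) cy cx.
have bE (Y : omega_data) j (d : cos_amb Y j) g : base (cos_act d g) = base d by case: j d g.
case: (cyl_composableP le_nk yx) => {le_nk n y x yx}
  [n h g hg|n h g hg|a b u h th|a b h u sh|n a b [v v'] [u u'] e1 e2].
- by move=> le_nk ch cg; exact: (comp_cell wX _ ch cg hg).
- by move=> le_nk ch cg; exact: (comp_cell wX _ ch cg hg).
- move=> _ [ca cb [cu cv e]] ch; split=> //; first exact: sbd_cell.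
  by split=> //; [exact: (act_cell wX lX cu) | rewrite bE].
- move=> _ ch [ca cb [cu cv e]]; split=> //; first exact: tbd_cell_le.
  split=> //; first exact: (@act_cell _ _ _ wX' lX' _ _ _ _ cv ch sh).
  by rewrite /bis_lact /= [RHS]bE.
move=> lt_nk [ca cb [cv cv' ev]] [_ _ [cu cu' eu]].
split=> //; split.
- exact: (coslice_comp_cell wX lX lt_nk cv cu e1).
- exact: (coslice_comp_cell wX' lX' lt_nk cu' cv' (esym e2)).
have lt0k : 0 < k by apply: leq_ltn_trans lt_nk.
rewrite [LHS]/= -/(@comp (coslice a) k n v u) base_tcomp // ev eu.
by rewrite /= -/(@comp (coslice (X := op X) b) k n u' v') [RHS]base_tcomp.
Qed.

End CylClosure.

(** * Strings with one more symbol *)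

Section Append.

Variable n : nat.
Implicit Types (a b : str n) (s t : symbol) (w : str n.+1) (P : symbol -> {set str n}).

(** The new symbol is the last one, so that the occurrences of (.) among the old
    symbols keep their numbers. *)
Definition app s a : str n.+1 :=
  [tuple if unlift ord_max i is Some j then tnth a j else s | i < n.+1].
Definition front w : str n := [tuple tnth w (fintype.lift ord_max i) | i < n].
Definition final w : symbol := tnth w ord_max.

Lemma tnth_app_lift s a i : tnth (app s a) (fintype.lift ord_max i) = tnth a i.
Proof. by rewrite tnth_mktuple liftK. Qed.

Lemma tnth_app_max s a : tnth (app s a) ord_max = s.
Proof. by rewrite tnth_mktuple unlift_none. Qed.

Lemma front_app s a : front (app s a) = a.
Proof. by apply: eq_from_tnth => i; rewrite tnth_mktuple tnth_app_lift. Qed.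

Lemma final_app s a : final (app s a) = s.
Proof. exact: tnth_app_max. Qed.

Lemma app_inj s t a b : app s a = app t b -> s = t /\ a = b.
Proof.
move=> e; split; first by have := congr1 final e; rewrite !final_app.
by have := congr1 front e; rewrite !front_app.
Qed.

Lemma app_surj w : exists s a, w = app s a.
Proof.
exists (final w), (front w); apply: eq_from_tnth => i; rewrite tnth_mktuple.
by case: unliftP => [j ->|->] //; rewrite tnth_mktuple.
Qed.

Definition glue P : {set str n.+1} := [set w | front w \in P (final w)].

Lemma in_glue P s a : (app s a \in glue P) = (a \in P s).
Proof. by rewrite inE front_app final_app. Qed.

Lemma glueP P (xi : {set str n.+1}) : (forall s a, (app s a \in xi) = (a \in P s)) -> xi = glue P.
Proof. by move=> e; apply/setP=> w; have [s [a ->]] := app_surj w; rewrite in_glue e. Qed.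

Lemma glue_inj P Q : glue P = glue Q -> forall s, P s = Q s.
Proof. by move=> e s; apply/setP=> a; rewrite -!in_glue e. Qed.

Lemma eq_glue P Q : (forall s, P s = Q s) -> glue P = glue Q.
Proof. by move=> e; apply: glueP => s a; rewrite in_glue e. Qed.

Lemma glue_surj (xi : {set str n.+1}) : exists P, xi = glue P.
Proof. by exists (fun s => [set a | app s a \in xi]); apply: glueP => s a; rewrite inE. Qed.

Lemma glueU P Q : glue P :|: glue Q = glue (fun s => P s :|: Q s).
Proof. by apply: glueP => s a; rewrite !inE ?front_app ?final_app. Qed.

Lemma glueI P Q : glue P :&: glue Q = glue (fun s => P s :&: Q s).
Proof. by apply: glueP => s a; rewrite !inE ?front_app ?final_app. Qed.

Lemma glueD P Q : glue P :\: glue Q = glue (fun s => P s :\: Q s).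
Proof. by apply: glueP => s a; rewrite !inE ?front_app ?final_app. Qed.

Lemma glue0 : glue (fun=> set0) = set0.
Proof. by apply/esym/glueP => s a; rewrite !inE. Qed.

End Append.

Section Faces.

Variable n : nat.
Implicit Types (a b : str n) (s t : symbol) (xi : {set str n}).

Lemma sum_none m (a : str m) : \sum_(q < m | tnth a q == None) 1 = count_mem None a.
Proof. by rewrite -(sum1_count a (pred1 None)) [RHS]big_tuple. Qed.

Lemma card_none m (a : str m) : #|[set q : 'I_m | tnth a q == None]| = count_mem None a.
Proof. by rewrite -sum1dep_card sum_none. Qed.

Lemma widen_lift (i : 'I_n) : widen_ord (leqnSn n) i = fintype.lift ord_max i.
Proof. by apply: val_inj; rewrite /= [RHS]lift_max. Qed.

Lemma count_app s a : count_mem None (app s a) = (s == None) + count_mem None a.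
Proof.
rewrite -(sum_none (app s a)) -(sum_none a) big_mkcond big_ord_recr /= tnth_app_max addnC.
congr (_ + _).
rewrite [RHS]big_mkcond; apply: eq_bigr => i _.
by rewrite widen_lift tnth_app_lift.
Qed.

Lemma occ_lift s a (i : 'I_n) : occ (app s a) (fintype.lift ord_max i) = occ a i.
Proof.
have hb : bump n i = i by rewrite /bump leqNgt ltn_ord.
rewrite /occ -!sum1dep_card big_mkcond big_ord_recr /= hb leqNgt ltn_ord addn0.
rewrite [RHS]big_mkcond; apply: eq_bigr => j _.
by rewrite widen_lift tnth_app_lift.
Qed.

Lemma occ_max a : occ (app None a) ord_max = (count_mem None a).+1.
Proof.
have -> : (count_mem None a).+1 = count_mem None (app None a) by rewrite count_app.
rewrite /occ -card_none.
by apply: eq_card => i; rewrite !inE leq_ord.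
Qed.

Lemma subst_lift s a (i : 'I_n) t :
  subst (app s a) (fintype.lift ord_max i) t = app s (subst a i t).
Proof.
apply: eq_from_tnth => j; rewrite tnth_mktuple.
case: (unliftP ord_max j) => [k ->|->].
  by rewrite !tnth_app_lift tnth_mktuple (inj_eq lift_inj).
by rewrite !tnth_app_max (negPf (neq_lift _ _)).
Qed.

Lemma subst_max s a t : subst (app s a) ord_max t = app t a.
Proof.
apply: eq_from_tnth => j; rewrite tnth_mktuple.
case: (unliftP ord_max j) => [k ->|->]; last by rewrite eqxx !tnth_app_max.
by rewrite eq_sym (negPf (neq_lift _ _)) !tnth_app_lift.
Qed.

(** The minus faces for [e = true] and the plus faces for [e = false]; one
    definition for both halves the combinatorics. *)
Definition faces (e : bool) m (a : str m) : {set str m} :=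
  [set subst a p (Some (e (+) odd (occ a p))) | p : 'I_m & tnth a p == None].

(** The second alternative is the face in the new direction; its sign depends on
    the number of the final (.), which is one more than the number of earlier
    ones. *)
Lemma in_faces_app e s t a b :
  (app t b \in faces e (app s a)) =
  ((t == s) && (b \in faces e a)) ||
  [&& s == None, t == Some (e (+) ~~ odd (count_mem None a)) & b == a].
Proof.
have appE u v c d : (app u c == app v d) = (u == v) && (c == d).
  apply/eqP/andP => [h|[/eqP-> /eqP->]//].
  by have [-> ->] := app_inj h.
apply/imsetP/orP.
  case=> p; rewrite inE; case: (unliftP ord_max p) => [i ->|->].
    rewrite tnth_app_lift occ_lift subst_lift => ai /eqP; rewrite appE => /andP[-> /eqP->].
    by left; rewrite /=; apply/imsetP; exists i; rewrite ?inE.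
  rewrite tnth_app_max => /eqP es; subst s; rewrite occ_max subst_max => /eqP.
  by rewrite appE => h; right.
case=> [/andP[/eqP-> /imsetP[p]]|/and3P[/eqP-> /eqP-> /eqP->]].
  rewrite inE => ap ->; exists (fintype.lift ord_max p); first by rewrite inE tnth_app_lift.
  by rewrite occ_lift subst_lift.
exists ord_max; first by rewrite inE tnth_app_max.
by rewrite occ_max subst_max.
Qed.

Definition bd e m (xi : {set str m}) : {set str m} := \bigcup_(a in xi) faces e a.

Lemma in_bd e m (xi : {set str m}) w :
  reflect (exists2 a, a \in xi & w \in faces e a) (w \in bd e xi).
Proof. exact: bigcupP. Qed.

(** Whether the faces of sign [e] in the new direction of strings of dimension
    [m.+1] end in [s]. *)
Definition end_face e m (s : symbol) : bool := s == Some (e (+) ~~ odd m).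

Lemma bd_glue e m (P : symbol -> {set str n}) : P None \subset strs n m ->
  bd e (glue P) = glue (fun s => bd e (P s) :|: if end_face e m s then P None else set0).
Proof.
move=> /subsetP sP; apply: glueP => t b; apply/in_bd/idP.
  case=> w; have [s [a ->]] := app_surj w; rewrite in_glue in_faces_app => aP.
  case/orP=> [/andP[/eqP-> h]|/and3P[/eqP e1 /eqP-> /eqP->]].
    by rewrite inE; apply/orP; left; apply/in_bd; exists a.
  subst s; move: (aP); rewrite /end_face => /sP; rewrite inE => /eqP->.
  by rewrite eqxx inE aP orbT.
rewrite inE => /orP[/in_bd[a aP h]|].
  by exists (app t a); rewrite ?in_glue // in_faces_app eqxx h.
case: ifP => //; last by rewrite inE.
rewrite /end_face => /eqP -> bP; exists (app None b); rewrite ?in_glue //.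
by rewrite in_faces_app; apply/orP; right; move: (sP _ bP); rewrite inE => /eqP->; rewrite !eqxx.
Qed.

Lemma glue_strs m (P : symbol -> {set str n}) :
  (glue P \subset strs n.+1 m.+1) =
  (P None \subset strs n m) && [forall e, P (Some e) \subset strs n m.+1].
Proof.
apply/subsetP/andP => [h|[/subsetP h1 /forallP h2] w].
  split; first by apply/subsetP=> a aP; have := h (app None a); rewrite in_glue inE count_app eqSS inE => /(_ aP).
  apply/forallP=> e; apply/subsetP=> a aP; have := h (app (Some e) a).
  by rewrite in_glue inE count_app inE => /(_ aP).
have [s [a ->]] := app_surj w; rewrite in_glue inE count_app; case: s => [e|] /=.
  by move/subsetP: (h2 e) => h /h; rewrite inE.
by move=> /h1; rewrite inE.
Qed.

End Faces.

(** * Well formed sets and their boundaries *)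

Section Moves.

Variable T : finType.
Implicit Types M Q S mn pl : {set T}.

(** Condition (ii) in the definition of the cells of a cube: a set with minus
    faces [mn] and plus faces [pl] leads from [M] to [Q]. *)
Definition moves M mn pl Q := Q = (M :|: pl) :\: mn /\ M = (Q :|: mn) :\: pl.

Lemma moves_sym M mn pl Q : moves M mn pl Q <-> moves Q pl mn M.
Proof. by split=> -[]. Qed.

Lemma moves0 M : moves M set0 set0 M.
Proof. by split; rewrite setU0 setD0. Qed.

Lemma moves00 mn pl : moves set0 mn pl set0 -> mn = pl.
Proof.
case=> /setP e1 /setP e2; apply/setP=> x; move: (e1 x) (e2 x); rewrite !inE.
by case: (x \in mn) (x \in pl) => -[].
Qed.

(** Elements that must be present in the target can be counted as consumed instead.
    On the left is the condition on a bar in a slice of the cube, on the right the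
    condition on one component of a cell of the next cube. *)
Lemma moves_minus M mn pl Q S :
  moves M mn pl (S :|: Q) /\ S :&: Q = set0 <-> moves M (mn :|: S) pl Q /\ S :&: mn = set0.
Proof.
split=> -[[/setP e1 /setP e2] /setP e3].
  split; last apply/setP=> x; first split; try apply/setP=> x;
    move: (e1 x) (e2 x) (e3 x); rewrite !inE;
    by case: (x \in M) (x \in mn) (x \in pl) (x \in Q) (x \in S) => -[] [] [] [].
split; last apply/setP=> x; first split; try apply/setP=> x;
  move: (e1 x) (e2 x) (e3 x); rewrite !inE;
  by case: (x \in M) (x \in mn) (x \in pl) (x \in Q) (x \in S) => -[] [] [] [].
Qed.

Lemma moves_plus M mn pl Q S :
  moves (S :|: M) mn pl Q /\ S :&: M = set0 <-> moves M mn (pl :|: S) Q /\ S :&: pl = set0.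
Proof.
split=> -[/moves_sym h1 h2]; split.
- by apply/moves_sym; case/moves_minus: (conj h1 h2).
- by case/moves_minus: (conj h1 h2).
- by apply/moves_sym; case/moves_minus: (conj h1 h2).
- by case/moves_minus: (conj h1 h2).
Qed.

(** All the unions involved are disjoint, so the equation [M + pl = Q + mn + S]
    holds for cardinals. *)
Lemma moves_card M mn pl Q S : #|mn| = #|pl| -> S :&: mn = set0 ->
  moves M (mn :|: S) pl Q -> #|M| = #|Q| + #|S|.
Proof.
move=> e d [/setP e1 /setP e2].
have d1 : M :&: pl = set0.
  by apply/setP=> x; move: (e2 x); rewrite !inE => ->; case: (x \in pl); rewrite ?andbF.
have d2 : Q :&: (mn :|: S) = set0.
  by apply/setP=> x; move: (e1 x); rewrite !inE => ->; case: (x \in mn); case: (x \in S); rewrite ?andbF.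
have eU : M :|: pl = Q :|: (mn :|: S).
  apply/setP=> x; move: (e1 x) (e2 x); rewrite !inE.
  by case: (x \in M) (x \in mn) (x \in pl) (x \in Q) (x \in S) => -[] [] [] [].
apply/eqP; rewrite -(eqn_add2r #|pl|) -addnA.
have := congr1 (fun A : {set T} => #|A|) eU; rewrite /= !cardsU d1 d2 setIC d !cards0 !subn0 => ->.
by rewrite e [#|pl| + _]addnC.
Qed.

End Moves.

Section Wellformed.

(** Condition (i) in the definition of the cells of a cube, for both signs at
    once and pointwise. *)
Definition wf m (xi : {set str m}) := forall e a b w,
  a \in xi -> b \in xi -> w \in faces e a -> w \in faces e b -> a = b.

Lemma wfP m (xi : {set str m}) :
  (forall a b, a \in xi -> b \in xi -> a <> b ->
     plus_faces a :&: plus_faces b = set0 /\ minus_faces a :&: minus_faces b = set0)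
  <-> wf xi.
Proof.
split=> [h e a b w aX bX wa wb|h a b aX bX ne].
  apply/eqP; apply: contraT => /eqP ne; have [h1 h2] := h a b aX bX ne.
  have : w \in faces e a :&: faces e b by rewrite inE wa.
  by case: e {wa wb}; [have -> : faces true a :&: faces true b = set0 := h2
                      |have -> : faces false a :&: faces false b = set0 := h1]; rewrite inE.
by split; apply/setP=> w; rewrite !inE; apply/negP=> /andP[wa wb]; apply: ne;
  [apply: (h false) wa wb | apply: (h true) wa wb].
Qed.

Lemma wf0 m : wf (@set0 (str m)).
Proof. by move=> e a b w; rewrite inE. Qed.

Lemma bd0 e m : bd e (@set0 (str m)) = set0.
Proof. exact: big_set0. Qed.

Lemma faces_strs0 e m (a : str m) : a \in strs m 0 -> faces e a = set0.
Proof.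
rewrite inE -card_none cards_eq0 => /eqP h; apply/setP=> w; rewrite !inE.
apply/negP=> /imsetP[p]; rewrite inE => ap; have : p \in [set q : 'I_m | tnth a q == None].
  by rewrite inE.
by rewrite h inE.
Qed.

Lemma bd_strs0 e m (xi : {set str m}) : xi \subset strs m 0 -> bd e xi = set0.
Proof.
move=> /subsetP s; apply/setP=> w; rewrite inE; apply/negP=> /in_bd[a /s ha].
by rewrite faces_strs0 // inE.
Qed.

Lemma wf_strs0 m (xi : {set str m}) : xi \subset strs m 0 -> wf xi.
Proof. by move=> /subsetP s e a b w /s ha _; rewrite faces_strs0 // inE. Qed.

(** A string with a single (.) has one face of each sign. *)
Lemma faces_strs1 e m (a : str m) : a \in strs m 1 -> exists w, faces e a = [set w].
Proof.
rewrite inE -card_none => /cards1P[p ep].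
have ap q : (tnth a q == None) = (q == p).
  by have /setP/(_ q) := ep; rewrite !inE.
exists (Defs.subst a p (Some (e (+) odd (occ a p)))); apply/setP=> w; rewrite inE.
apply/imsetP/eqP => [[q]|->]; first by rewrite inE ap => /eqP->.
by exists p; rewrite ?inE ?ap.
Qed.

Lemma card_bd1 e m (xi : {set str m}) : xi \subset strs m 1 -> wf xi -> #|bd e xi| = #|xi|.
Proof.
move=> /subsetP sx wx; pose f (a : str m) := odflt a [pick w in faces e a].
have fE a : a \in xi -> faces e a = [set f a].
  move=> /sx /(faces_strs1 e)[w ew]; rewrite /f; case: pickP => [v|]; rewrite ew.
    by rewrite inE => /eqP->.
  by move=> /(_ w); rewrite inE eqxx.
have -> : bd e xi = f @: xi.
  apply/setP=> w; apply/in_bd/imsetP => [[a ax]|[a ax ->]].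
    by rewrite fE // inE => /eqP->; exists a.
  by exists a; rewrite // fE // inE.
rewrite card_in_imset // => a b ax bx ef; apply: (wx e a b (f a)) => //.
  by rewrite fE // inE.
by rewrite fE // inE ef.
Qed.

Section Glue.

Variables (n m : nat) (P : symbol -> {set str n}).
Hypothesis sP : P None \subset strs n m.

(** A string of [P None] shares a face with a string that has a fixed final
    symbol only through its face in the new direction, and two such faces differ
    when the strings do. *)
Lemma wf_glue : wf (glue P) <->
  (forall s, wf (P s)) /\ forall e, P None :&: bd e (P (Some (e (+) ~~ odd m))) = set0.
Proof.
have cP a : a \in P None -> count_mem None a = m.
  by move=> aP; have /subsetP/(_ _ aP) := sP; rewrite inE => /eqP.
split=> [h|[h1 h2] e a b w].
  split=> [s e a b w aP bP wa wb|e].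
    have /(_ _ _ _ _)/app_inj[] // := h e (app s a) (app s b) (app s w).
    - by rewrite in_glue.
    - by rewrite in_glue.
    - by rewrite in_faces_app eqxx wa.
    - by rewrite in_faces_app eqxx wb.
  apply/setP=> a; rewrite !inE; apply/negP=> /andP[aP /in_bd[b bP ab]].
  have /(_ _ _ _ _)/app_inj[] // := h e (app None a) (app (Some (e (+) ~~ odd m)) b)
    (app (Some (e (+) ~~ odd m)) a).
  - by rewrite in_glue.
  - by rewrite in_glue.
  - by rewrite in_faces_app cP // !eqxx orbT.
  - by rewrite in_faces_app eqxx ab.
have [s [{}a ->]] := app_surj a; have [t [{}b ->]] := app_surj b; have [r [{}w ->]] := app_surj w.
rewrite !in_glue !in_faces_app => aP bP.
(* Each of the two faces is in an old direction or in the new one. *)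
case/orP=> [/andP[/eqP ers wa]|/and3P[/eqP es /eqP er /eqP ew]];
case/orP=> [/andP[/eqP ert wb]|/and3P[/eqP et /eqP er' /eqP ew']]; subst.
- by rewrite (h1 t e a b w).
- have cb := cP _ bP; have /setP/(_ b) := h2 e; rewrite cb in aP wa *.
  by rewrite !inE bP; case/in_bd; exists a.
- have ca := cP _ aP; have /setP/(_ a) := h2 e; rewrite ca in bP wb *.
  by rewrite !inE aP; case/in_bd; exists b.
- by [].
Qed.

(** The component at [s] of the faces of sign [e] of [glue P], when the strings of
    [P None] have dimension [m]. *)
Definition glued_bd e s := bd e (P s) :|: if end_face e m s then P None else set0.

Lemma moves_glue (M Q : symbol -> {set str n}) :
  moves (glue M) (bd true (glue P)) (bd false (glue P)) (glue Q) <->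
  forall s, moves (M s) (glued_bd true s) (glued_bd false s) (Q s).
Proof.
rewrite !(bd_glue _ sP) /moves !glueU !glueD; split=> [[e1 e2] s|h].
  by split; [exact: (glue_inj e1) | exact: (glue_inj e2)].
by split; apply: eq_glue => s; case: (h s).
Qed.

End Glue.

(** There are no directed cycles in a cube.  The middle part of a set of longer
    strings again has equal minus and plus faces, so it is empty by induction, or
    by counting when it consists of vertices; then the same applies to the two
    outer parts. *)
Lemma no_cycle n j (xi : {set str n}) : xi \subset strs n j.+1 -> wf xi ->
  bd true xi = bd false xi -> xi = set0.
Proof.
elim: n j xi => [|n IH] j xi sx wx ebd.
  apply/setP=> a; rewrite inE; apply/negP=> ax; have /subsetP/(_ _ ax) := sx.
  by rewrite inE (tuple0 a).
have [P eP] := glue_surj xi; subst xi.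
move: sx; rewrite glue_strs => /andP[sN /forallP sS].
have [wS wx'] := (wf_glue sN).1 wx.
have h s : glued_bd j P true s = glued_bd j P false s.
  by move: ebd; rewrite !(bd_glue _ sN) => /glue_inj /(_ s).
have PN : P None = set0.
  case: j sN sS wx' h => [|j] sN sS wx' h; last first.
    by apply: (IH j) => //; have := h None; rewrite /glued_bd /= !setU0.
  (* For [j = 0] the vertices in the middle are minus faces at the left end. *)
  have := h (Some false); rewrite /glued_bd /end_face /= setU0 => e.
  apply/cards0_eq/esym; rewrite -[RHS]add0n -(cards0 (str n)).
  apply: (moves_card (mn := bd true (P (Some false))) (pl := bd false (P (Some false)))).
  - by rewrite !card_bd1.
  - exact: (wx' true).
  by rewrite e; split; rewrite set0U setDv.
rewrite -(glue0 n); apply: eq_glue => -[e|] //.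
by apply: (IH j) => //; have := h (Some e); rewrite /glued_bd PN !if_same !setU0.
Qed.

End Wellformed.

(** * The cubes *)

Section CubeStructure.

Variable n : nat.
Notation Q := (cube n).

Lemma cube_cellS k (x : amb Q k.+1) : is_cell Q x <->
  [/\ [/\ is_cell Q (src x), is_cell Q (tgt x) & tparallel (tsrc x) (ttgt x)],
      tlab x \subset strs n k.+1, wf (tlab x)
    & moves (tlab (tsrc x)) (bd true (tlab x)) (bd false (tlab x)) (tlab (ttgt x))].
Proof.
split=> [[h1 [h2 [/wfP h3 h4]]]|[h1 h2 /wfP h3 h4]]; first by split.
by split=> //; split=> //; split.
Qed.

Lemma cube_strs k (x : amb Q k) : is_cell Q x -> tlab x \subset strs n k.
Proof.
case: k x => [|k] x; last by case/cube_cellS.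
by case=> a; rewrite inE => ca /= ->; apply/subsetP=> b /set1P->; rewrite inE.
Qed.

Lemma cube_wf k (x : amb Q k) : is_cell Q x -> wf (tlab x).
Proof.
case: k x => [|k] x cx; last by case/cube_cellS: cx.
by apply: wf_strs0; apply: cube_strs cx.
Qed.

Lemma cube_globular : globular Q.
Proof.
by split=> k x /cube_cellS[[]] // _ _ [].
Qed.
Let gQ := cube_globular.

Lemma tparallel_refl D k (x : tower D k) : tparallel x x.
Proof. by case: k x. Qed.

Lemma cube_idc_cell k (x : amb Q k) : is_cell Q x -> is_cell Q (idc x).
Proof.
move=> cx; apply/cube_cellS; split; first by split=> //; apply: tparallel_refl.
- exact: sub0set.
- exact: wf0.
by rewrite /= !bd0; apply: moves0.
Qed.

Lemma cube_ext k (x y : amb Q k.+1) : src x = src y -> tgt x = tgt y -> tlab x = tlab y -> x = y.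
Proof.
case: x => [[? ?] ?]; case: y => [[? ?] ?]; rewrite /= /tsrc /ttgt /=.
by move=> -> -> ->.
Qed.

Lemma cube_comp_lab k i (y x : amb Q k) : i < k -> tlab (comp i y x) = tlab y :|: tlab x.
Proof. by case: k y x. Qed.

Lemma cube_lab_lift k i (x : amb Q k) : k < i -> tlab (lift i x) = set0.
Proof. by case: i => // i le_ki; rewrite /lift move_up. Qed.

Lemma cube_src_comp_top k (y x : amb Q k.+1) : src (comp k y x) = src x.
Proof. by rewrite /= /tsrc /= eqxx. Qed.

Lemma cube_tgt_comp_top k (y x : amb Q k.+1) : tgt (comp k y x) = tgt y.
Proof. by rewrite /= /ttgt /= eqxx. Qed.

Lemma cube_src_comp k i (y x : amb Q k.+1) : i < k -> src (comp i y x) = comp i (src y) (src x).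
Proof. by move=> lt_ik; rewrite /= {1}/tsrc /= ltn_eqF. Qed.

Lemma cube_tgt_comp k i (y x : amb Q k.+1) : i < k -> tgt (comp i y x) = comp i (tgt y) (tgt x).
Proof. by move=> lt_ik; rewrite /= {1}/ttgt /= ltn_eqF. Qed.

Lemma cube_compA k i (z y x : amb Q k) : i < k -> comp i z (comp i y x) = comp i (comp i z y) x.
Proof.
elim: k z y x => // k IH z y x; rewrite ltnS leq_eqVlt => /orP[/eqP->|lt_ik].
  apply: cube_ext; rewrite ?cube_src_comp_top ?cube_tgt_comp_top //.
  by rewrite !cube_comp_lab // setUA.
apply: cube_ext; rewrite ?cube_src_comp ?cube_tgt_comp //; [exact: IH | exact: IH |].
by rewrite !cube_comp_lab ?setUA // ltnW.
Qed.

Lemma cube_interchange k m i (y' y x' x : amb Q k) : i < m -> m < k ->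
  comp i (comp m y' y) (comp m x' x) = comp m (comp i y' x') (comp i y x).
Proof.
move=> lt_im; elim: k y' y x' x => // k IH y' y x' x; rewrite ltnS leq_eqVlt => /orP[/eqP e|lt_mk].
  subst m; apply: cube_ext; rewrite ?(cube_src_comp_top, cube_tgt_comp_top, cube_src_comp, cube_tgt_comp) //.
  by rewrite !cube_comp_lab 1?setUACA // ltnW.
have lt_ik := ltn_trans lt_im lt_mk.
apply: cube_ext; rewrite ?(cube_src_comp, cube_tgt_comp) //; [exact: IH | exact: IH |].
by rewrite !cube_comp_lab 1?setUACA // ltnW.
Qed.

Lemma cube_idc_comp k i (y x : amb Q k) : i < k -> idc (comp i y x) = comp i (idc y) (idc x).
Proof.
by move=> lt_ik; apply: cube_ext; rewrite ?cube_src_comp ?cube_tgt_comp // cube_comp_lab ?setU0 // ltnW.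
Qed.

Lemma src_lift_cube k i (x : amb Q k) : k <= i -> src (lift i.+1 x) = lift i x.
Proof. by move=> le_ki; rewrite /lift move_up. Qed.

Lemma tgt_lift_cube k i (x : amb Q k) : k <= i -> tgt (lift i.+1 x) = lift i x.
Proof. by move=> le_ki; rewrite /lift move_up. Qed.

Lemma cube_comp_idr k i (x : amb Q k) : i < k -> is_cell Q x -> comp i x (lift k (sbd i x)) = x.
Proof.
elim: k x => // k IH x lt_ik cx; move: (lt_ik); rewrite ltnS leq_eqVlt => /orP[/eqP e|lt_ik'].
  subst i; apply: cube_ext; rewrite ?cube_src_comp_top ?cube_tgt_comp_top //.
    by rewrite src_lift_cube // sbd_src // sbd_id /lift move_id.
  by rewrite cube_comp_lab // cube_lab_lift // setU0.
apply: cube_ext; rewrite ?(cube_src_comp, cube_tgt_comp) //.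
- by rewrite src_lift_cube // sbd_src // IH //; apply: (g_src gQ).
- by rewrite tgt_lift_cube // (sbd_tgt gQ) // IH //; apply: (g_tgt gQ).
by rewrite cube_comp_lab // cube_lab_lift // setU0.
Qed.

Lemma cube_comp_idl k i (x : amb Q k) : i < k -> is_cell Q x -> comp i (lift k (tbd i x)) x = x.
Proof.
elim: k x => // k IH x lt_ik cx; move: (lt_ik); rewrite ltnS leq_eqVlt => /orP[/eqP e|lt_ik'].
  subst i; apply: cube_ext; rewrite ?cube_src_comp_top ?cube_tgt_comp_top //.
    by rewrite tgt_lift_cube // tbd_tgt // tbd_id /lift move_id.
  by rewrite cube_comp_lab // cube_lab_lift // set0U.
apply: cube_ext; rewrite ?(cube_src_comp, cube_tgt_comp) //.
- by rewrite src_lift_cube // (tbd_src gQ) // IH //; apply: (g_src gQ).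
- by rewrite tgt_lift_cube // tbd_tgt // IH //; apply: (g_tgt gQ).
by rewrite cube_comp_lab // cube_lab_lift // set0U.
Qed.

(** The only omega-category axiom for a cube that is not a computation with
    unions. *)
Definition cube_comp_closed := forall k i (y x : amb Q k), i < k -> is_cell Q y ->
  is_cell Q x -> composable i y x -> is_cell Q (comp i y x).

Definition cube_comp_disjoint := forall k i (y x : amb Q k), i < k -> is_cell Q y ->
  is_cell Q x -> composable i y x -> tlab y :&: tlab x = set0.

Lemma cube_omega : cube_comp_closed -> is_omega_category Q.
Proof.
case: (gQ) => h1 h2 h3 h4 cl; split=> //.
- exact: cube_idc_cell.
- by move=> k y x *; apply: cube_src_comp_top.
- by move=> k y x *; apply: cube_tgt_comp_top.
- by move=> k i y x *; apply: cube_src_comp.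
- by move=> k i y x *; apply: cube_tgt_comp.
- by move=> k i z y x *; apply: cube_compA.
- exact: cube_comp_idr.
- exact: cube_comp_idl.
- by move=> k i y x *; apply: cube_idc_comp.
- by move=> k m i y' y x' x *; apply: cube_interchange.
Qed.

Lemma cube_labelled : cube_comp_disjoint -> @labelled Q (str n) (fun k => @tlab _ k).
Proof.
move=> dj; split=> //; first by move=> k i y x; apply: cube_comp_lab.
by move=> k x y _ _; apply: cube_ext.
Qed.

End CubeStructure.

Lemma cube0_cell_uniq k (x y : amb (cube 0) k) : is_cell (cube 0) x -> is_cell (cube 0) y -> x = y.
Proof.
elim: k x y => [|k IH] x y.
  by case=> a _ -> [b _ ->]; rewrite (tuple0 a) (tuple0 b).
move=> /cube_cellS[[xs xt _] xl _ _] /cube_cellS[[ys yt _] yl _ _].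
have e0 : strs 0 k.+1 = set0 by apply/setP=> a; rewrite !inE (tuple0 a).
move: xl yl; rewrite e0 !subset0 => /eqP xl /eqP yl.
by apply: cube_ext; [exact: IH | exact: IH | rewrite xl yl].
Qed.

Lemma cube0_closed : cube_comp_closed 0.
Proof.
move=> k i y x lt_ik cy cx yx.
suff -> : comp i y x = y by [].
have gQ := cube_globular 0.
have cl : is_cell (cube 0) (lift k (sbd i y)).
  have : is_cell (cube 0) (sbd i y) by apply: (sbd_cell_le gQ) => //; apply: ltnW.
  move: (sbd i y) (ltnW lt_ik) => z; elim: k {y x lt_ik cy cx yx} => [|k IH].
    by rewrite leqn0 => /eqP e; subst i; rewrite /lift move_id.
  rewrite leq_eqVlt => /orP[/eqP e|]; first by subst i; rewrite /lift move_id.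
  by rewrite ltnS => le_ik cz; rewrite /lift move_up //; apply: cube_idc_cell; apply: IH.
by rewrite (cube0_cell_uniq cx cl) cube_comp_idr.
Qed.

Lemma cube0_disjoint : cube_comp_disjoint 0.
Proof.
move=> [//|k] i y x _ /cube_strs /subsetP sy _ _; apply/setP=> a; rewrite !inE.
by apply/negP=> /andP[/sy]; rewrite inE (tuple0 a).
Qed.

(** * The comparison of the cylinder on a cube with the next cube *)

Section BarLabels.

Variables (X : omega_data) (T : finType) (lab : forall k, amb X k -> {set T}).
Arguments lab {k} _.
Hypotheses (wX : is_omega_category X) (lX : labelled (@lab)).
Variable a : amb X 0.

(** The labels of the ends of [bar c], leaving out the base: [lab_in] on the side
    of the source of [c], [lab_out] on that of its target.  In dimension 0 a bar
    goes from the object [a] to the base. *)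
Definition lab_in k : cos_amb X k -> {set T} :=
  match k return cos_amb X k -> {set T} with
  | 0 => fun _ => lab a | _.+1 => fun c => lab (bar (tsrc c))
  end.

Definition lab_out k : cos_amb X k -> {set T} :=
  match k return cos_amb X k -> {set T} with
  | 0 => fun _ => set0 | _.+1 => fun c => lab (bar (ttgt c))
  end.

(** The base and the other label at the same end are disjoint, since that end is
    the composite of cells that carry them. *)
Lemma cos_labels k (c : cos_amb X k) : cos_cell a c ->
  if odd k then
    [/\ lab (src (bar c)) = lab (base c) :|: lab_in c, lab (tgt (bar c)) = lab_out c
      & lab (base c) :&: lab_in c = set0]
  else
    [/\ lab (src (bar c)) = lab_in c, lab (tgt (bar c)) = lab (base c) :|: lab_out c
      & lab (base c) :&: lab_out c = set0].
Proof.
case: k c => [|m] c cc.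
  by case: (cc) => cb cr es et; rewrite es et /= setU0 setI0.
have fc := cell_frame cc; have cb := base_cell cc.
have fb := @cell_fits _ _ _ _ m.+1 (leqnn _) cc.
have cp := whisk_composable wX fc (leqnn _) (leqnn _) cb fb.
have cw := whisk_cell wX fc (leqnSn _) (leqnSn _) cb (fitsW (leqnSn _) fb).
have lw := @lab_whisk_lt _ _ _ lX _ c _ (base c) m (leqnn _).
have es : mbar c m = bar (tsrc c).
  by rewrite /mbar -/(@sbd (coslice a) _ _ c) sbd_src // sbd_id.
have et : pbar c m = bar (ttgt c).
  by rewrite /pbar -/(@tbd (coslice a) _ _ c) tbd_tgt // tbd_id.
have [[cs ct _] _] := cc; have crs := bar_cell cs; have crt := bar_cell ct.
case: ifPn => /= om.
  rewrite (lab_bar_src lX om cc) (bar_tgt_odd _ cc) //; split=> //.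
  by move: cp; rewrite (negPf om) es lift_id -lw => cp; apply: (lab_disj lX) cp.
move: om; rewrite negbK => om.
rewrite (lab_bar_tgt lX om cc) (bar_src_even _ cc) //= ?om //; split=> //.
by move: cp; rewrite om et lift_id -lw setIC => cp; apply: (lab_disj lX) cp.
Qed.

End BarLabels.

Section Step.

Variable n : nat.
Notation Q := (cube n).
Notation lab := (fun k => @tlab (fun _ => {set str n}) k).
Hypotheses (wQ : is_omega_category Q) (lQ : labelled (X := Q) lab).
Let wQ' := op_omega wQ.
Let lQ' := op_labelled lQ.
Let gC := cyl_globular wQ.

Definition tri (A S B : {set str n}) : symbol -> {set str n} :=
  fun s => match s with None => S | Some false => A | Some true => B end.

Definition parts k : amb (cyl Q) k -> symbol -> {set str n} :=
  match k return amb (cyl Q) k -> symbol -> {set str n} with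
  | 0 => fun x => match x with inl a => tri a set0 set0 | inr b => tri set0 set0 b end
  | m.+1 => fun x =>
    match x with
    | CylL h => tri (tlab h) set0 set0
    | CylR h => tri set0 set0 (tlab h)
    | CylM a b u => tri (tlab (bar u.1)) (tlab (base u.1)) (tlab (bar u.2))
    end
  end.

Fixpoint to_cube k : amb (cyl Q) k -> amb (cube n.+1) k :=
  match k return amb (cyl Q) k -> amb (cube n.+1) k with
  | 0 => fun x => glue (@parts 0 x)
  | m.+1 => fun x =>
    ((@to_cube m (@src (cyl Q) m x), @to_cube m (@tgt (cyl Q) m x)), glue (@parts m.+1 x))
  end.

Lemma tlab_to_cube k (x : amb (cyl Q) k) : tlab (to_cube x) = glue (parts x).
Proof. by case: k x. Qed.

(** Empty in dimension 0, as a 0-cell of a/X/b has objects of the two copies as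
    its ends, and these have an empty middle part. *)
Definition src_lab k : amb Q k -> {set str n} :=
  match k return amb Q k -> {set str n} with
  | 0 => fun _ => set0 | _.+1 => fun x => tlab (src x)
  end.

Definition tgt_lab k : amb Q k -> {set str n} :=
  match k return amb Q k -> {set str n} with
  | 0 => fun _ => set0 | _.+1 => fun x => tlab (tgt x)
  end.

Lemma parts_src k a b (u : bis_amb Q k) : is_cell (cyl Q) (CylM a b u : amb (cyl Q) k.+1) ->
  forall s, parts (src (CylM a b u : amb (cyl Q) k.+1)) s =
    tri (@lab_in Q _ lab a k u.1) (src_lab (base u.1))
        (@lab_out (op Q) _ lab k u.2) s.
Proof.
case: k u => [|k] u [_ _ [cu cv _]] s //.
exact: (congr1 (fun z => tri _ (tlab z) _ s) (esym (src_base cu))).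
Qed.

Lemma parts_tgt k a b (u : bis_amb Q k) : is_cell (cyl Q) (CylM a b u : amb (cyl Q) k.+1) ->
  forall s, parts (tgt (CylM a b u : amb (cyl Q) k.+1)) s =
    tri (@lab_out Q _ lab k u.1) (tgt_lab (base u.1))
        (@lab_in (op Q) _ lab b k u.2) s.
Proof.
case: k u => [|k] u [_ _ [cu cv _]] s //.
exact: (congr1 (fun z => tri _ (tlab z) _ s) (esym (tgt_base cu))).
Qed.

Lemma cyl_parts_wf k (x : amb (cyl Q) k.+1) : is_cell (cyl Q) x ->
  [/\ parts x None \subset strs n k, forall e, parts x (Some e) \subset strs n k.+1
    & forall s, wf (parts x s)].
Proof.
case: x => [h|h|a b [u v]] cx /=.
- split=> [|[]|[[]|]] /=; rewrite ?sub0set //; try exact: wf0; first exact: cube_strs cx.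
  exact: cube_wf cx.
- split=> [|[]|[[]|]] /=; rewrite ?sub0set //; try exact: wf0; first exact: cube_strs cx.
  exact: cube_wf cx.
case: cx => _ _ [/= cu cv _].
have cu1 := bar_cell cu; have cu2 := base_cell cu.
have cv1 : is_cell Q (bar v) := bar_cell cv.
split=> [|[]|[[]|]] /=.
- exact: (cube_strs cu2).
- exact: (cube_strs cv1).
- exact: (cube_strs cu1).
- exact: (cube_wf cv1).
- exact: (cube_wf cu1).
- exact: (cube_wf cu2).
Qed.

(** The conditions (i) and (ii) for [glue (parts x)], apart from what concerns
    each part alone.  For a cell of a/X/b, the bars in the slices satisfy (ii)
    with the base added at one end ([cos_labels]); [moves_minus] and [moves_plus]
    move it to the faces. *)
Lemma cyl_moves k (x : amb (cyl Q) k.+1) : is_cell (cyl Q) x ->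
  (forall e, parts x None :&: bd e (parts x (Some (e (+) ~~ odd k))) = set0) /\
  forall s, moves (parts (src x) s) (glued_bd k (parts x) true s) (glued_bd k (parts x) false s)
                  (parts (tgt x) s).
Proof.
have side : forall (j : nat) (h : amb Q j.+1), is_cell Q h ->
    moves (tlab (src h)) (bd true (tlab h)) (bd false (tlab h)) (tlab (tgt h)).
  by move=> j h /cube_cellS[].
have glued_bd_none e (P : symbol -> {set str n}) s : P None = set0 -> glued_bd k P e s = bd e (P s).
  by rewrite /glued_bd => ->; rewrite if_same setU0.
case: x => [h|h|a b u] cx.
- split=> [e|s]; first by rewrite set0I.
  rewrite !glued_bd_none //; case: k h cx {glued_bd_none} => [|k] h /(side _ h); case: s => [[]|] //= _;
    by rewrite ?bd0; apply: moves0.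
- split=> [e|s]; first by rewrite set0I.
  rewrite !glued_bd_none //; case: k h cx {glued_bd_none} => [|k] h /(side _ h); case: s => [[]|] //= _;
    by rewrite ?bd0; apply: moves0.
have es := parts_src cx; have et := parts_tgt cx.
case: cx => _ _ [cu cv eb].
have mb : moves (src_lab (base u.1)) (bd true (tlab (base u.1)))
    (bd false (tlab (base u.1))) (tgt_lab (base u.1)).
  have := base_cell cu; move: (base u.1) => h {glued_bd_none es et cu cv eb u}.
  case: k h => [|j] h cb; last exact: side.
  by rewrite !(bd_strs0 _ (cube_strs cb)); apply: moves0.
have := cos_labels wQ' lQ' cv; have := cos_labels wQ lQ cu.
have := side _ (bar u.2) (bar_cell cv); have := side _ (bar u.1) (bar_cell cu).
have -> : lab k (base u.2) = lab k (base u.1) by rewrite eb.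
rewrite /= -/(base u.1) -/(base u.2).
case: ifP => ok mA mB [e1 e2 d1] [e3 e4 d2]; move: mA mB.
  rewrite e1 e2 e3 e4 => mA mB.
  have [mA' dA] := (moves_plus _ _ _ _ _).1 (conj mA d1).
  have [mB' dB] := (moves_minus _ _ _ _ _).1 (conj mB d2).
  split=> [[]|s] //=; rewrite es et /glued_bd /end_face ok.
  by case: s => [[]|] /=; rewrite ?setU0.
rewrite e1 e2 e3 e4 => mA mB.
have [mA' dA] := (moves_minus _ _ _ _ _).1 (conj mA d1).
have [mB' dB] := (moves_plus _ _ _ _ _).1 (conj mB d2).
split=> [[]|s] //=; rewrite es et /glued_bd /end_face ok.
by case: s => [[]|] /=; rewrite ?setU0.
Qed.

Lemma to_cube_cell k (x : amb (cyl Q) k) : is_cell (cyl Q) x -> is_cell (cube n.+1) (to_cube x).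
Proof.
elim: k x => [|k IH] x cx.
  have one e (a : str n) : a \in strs n 0 ->
     exists2 w, w \in strs n.+1 0 & glue (fun s => if s == Some e then [set a] else set0) = [set w].
    rewrite inE => ca; exists (app (Some e) a); first by rewrite inE count_app.
    apply/esym/glueP => s b; case: (s =P Some e) => [->|ne]; rewrite !inE.
      by apply/eqP/eqP => [/app_inj[]|->].
    by apply/eqP => /app_inj[].
  case: x cx => _ [a ca ->] /=.
    have [w cw ew] := one false a ca; exists w => //; rewrite -ew.
    by apply: eq_glue => -[[]|].
  have [w cw ew] := one true a ca; exists w => //; rewrite -ew.
  by apply: eq_glue => -[[]|].
have cs := g_src gC cx; have ct := g_tgt gC cx.
have [sN sS wP] := cyl_parts_wf cx; have [dP mP] := cyl_moves cx.
apply/cube_cellS; rewrite tlab_to_cube.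
have -> : tsrc (to_cube x) = to_cube (src x) by [].
have -> : ttgt (to_cube x) = to_cube (tgt x) by [].
split.
- split; [exact: IH | exact: IH |].
  case: k x {sN sS wP dP mP IH cs ct} cx => // k x cx; split.
    by congr to_cube; apply: (g_ss gC).
  by congr to_cube; apply: (g_tt gC).
- by rewrite glue_strs sN; apply/forallP.
- by apply/(wf_glue sN); split.
by rewrite !tlab_to_cube; apply/(moves_glue sN).
Qed.

End Step.

Section CosExt.

Variables (X : omega_data) (T : finType) (lab : forall k, amb X k -> {set T}).
Arguments lab {k} _.
Hypothesis lX : labelled (@lab).
Variable a : amb X 0.

Lemma whisk_parallel k (c d : cos_amb X k.+1) K (u : amb X K) : tparallel c d ->
  whisk c u k.+1 = whisk d u k.+1.
Proof.
case=> es et; apply: (@whisk_ext X a) => l lt_l.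
by rewrite !(@sbd_src (coslice a) k) // !(@tbd_tgt (coslice a) k) //= es et.
Qed.

(** In a slice, too, parallel cells with the same labels are equal: the ends of
    the bars are determined by the rest. *)
Lemma cos_ext k (c d : cos_amb X k) : cos_cell a c -> cos_cell a d -> tparallel c d ->
  lab (base c) = lab (base d) -> lab (bar c) = lab (bar d) -> c = d.
Proof.
move=> cc cd; have cbc := base_cell cc; have cbd := base_cell cd.
have crc := bar_cell cc; have crd := bar_cell cd.
case: k c d cc cd cbc cbd crc crd => [|k] c d cc cd cbc cbd crc crd e lb lr.
  have eb : base c = base d by apply: (lab_ext0 lX).
  have er : bar c = bar d.
    case: cc cd => [_ _ e1 e2] [_ _ e3 e4]; apply: (lab_ext lX) => //; rewrite ?e1 ?e2 //.
    by rewrite e4.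
  by rewrite [c]surjective_pairing [d]surjective_pairing; exact: (f_equal2 pair eb er).
have [es et] := e.
have eb : base c = base d.
  by apply: (lab_ext lX); rewrite // ?(src_base cc) ?(src_base cd) ?(tgt_base cc) ?(tgt_base cd) ?es ?et.
have er : bar c = bar d.
  apply: (lab_ext lX) => //; case/boolP: (odd k.+1) => ok.
  - by rewrite (bar_src_odd ok cc) (bar_src_odd ok cd) (whisk_parallel _ e) eb.
  - by rewrite (bar_src_even ok cc) (bar_src_even ok cd) es.
  - by rewrite (bar_tgt_odd ok cc) (bar_tgt_odd ok cd) et.
  - by rewrite (bar_tgt_even ok cc) (bar_tgt_even ok cd) (whisk_parallel _ e) eb.
case: c d es et eb er {cc cd cbc cbd crc crd e lb lr} => [[c0 c1] [c2 c3]] [[d0 d1] [d2 d3]].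
by rewrite /tsrc /ttgt /base /bar /= => -> -> -> ->.
Qed.

End CosExt.

Section Step.

Variable n : nat.
Notation Q := (cube n).
Notation lab := (fun k => @tlab (fun _ => {set str n}) k).
Hypotheses (wQ : is_omega_category Q) (lQ : labelled (X := Q) lab).
Let wQ' := op_omega wQ.
Let lQ' := op_labelled lQ.
Let gC := cyl_globular wQ.

Lemma to_cube_idc k (x : amb (cyl Q) k) : to_cube (idc x) = idc (to_cube x).
Proof.
have e0 P : (forall s, P s = set0) -> glue P = @set0 (str n.+1).
  by move=> h; rewrite -(glue0 n); apply: eq_glue.
have h : glue (parts (idc x)) = set0.
  by apply: e0; case: k x => [[x|x]|k [h|h|a b [u v]]] [[]|].
have es : src (idc x) = x by case: k x {h} => [[x|x]|k [h|h|a b [u v]]].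
have et : tgt (idc x) = x by case: k x {h es} => [[x|x]|k [h|h|a b [u v]]].
exact: (f_equal2 pair (f_equal2 pair (congr1 (@to_cube n k) es) (congr1 (@to_cube n k) et)) h).
Qed.

Lemma parts_comp k i (y x : amb (cyl Q) k.+1) : i <= k -> is_cell (cyl Q) y ->
  is_cell (cyl Q) x -> composable i y x ->
  forall s, parts (comp i y x) s = parts y s :|: parts x s.
Proof.
move=> le_ik cy cx yx s; have bE j (d : cos_amb Q j) g : base (cos_act d g) = base d by case: j d g.
have rE j (d : cos_amb Q j) g : bar (cos_act d g) = comp 0 (bar d) g by case: j d g.
have bE' j (d : cos_amb (op Q) j) g : base (cos_act d g) = base d by case: j d g.
have rE' j (d : cos_amb (op Q) j) g : bar (cos_act d g) = @comp Q j.+1 0 g (bar d) by case: j d g.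
move: cy cx (le_ik).
case: (cyl_composableP le_ik yx) => {le_ik i y x yx}
  [i h g hg|i h g hg|a b u h th|a b h u sh|i a b [v v'] [u u'] e1 e2].
- by case: s => [[]|] ch cg le_ik; rewrite /= ?setU0.
- by case: s => [[]|] ch cg le_ik; rewrite /= ?setU0.
- by case: s => [[]|] cu ch _; rewrite /= ?rE ?bE ?setU0.
- by case: s => [[]|] ch cu _; rewrite /= ?rE' ?bE ?set0U.
move=> [_ _ [cv cv' _]] [_ _ [cu cu' _]] lt_ik.
have lt0k : 0 < k by apply: leq_ltn_trans lt_ik.
case: s => [[]|].
- rewrite [LHS]/= -/(@comp (coslice (X := op Q) b) k i u' v') bar_tcomp //.
  by have := lab_bar_comp lQ' u' v' lt_ik => /= ->; rewrite setUC.
- rewrite [LHS]/= -/(@comp (coslice a) k i v u) bar_tcomp //.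
  by have := lab_bar_comp lQ v u lt_ik => /= ->.
rewrite [LHS]/= -/(@comp (coslice a) k i v u) base_tcomp //.
exact: cube_comp_lab.
Qed.

Lemma to_cube_comp k i (y x : amb (cyl Q) k) : i < k -> is_cell (cyl Q) y ->
  is_cell (cyl Q) x -> composable i y x ->
  to_cube (comp i y x) = comp i (to_cube y) (to_cube x).
Proof.
elim: k y x => // k IH y x; rewrite ltnS => le_ik cy cx yx.
have es := cyl_src_compE wQ le_ik cy cx yx; have et := cyl_tgt_compE wQ le_ik cy cx yx.
have el : glue (parts (comp i y x)) = glue (parts y) :|: glue (parts x).
  by rewrite glueU; apply: eq_glue => s; apply: parts_comp.
have S0 (z : amb (cyl Q) k.+1) : src (to_cube z) = to_cube (src z) by [].
have T0 (z : amb (cyl Q) k.+1) : tgt (to_cube z) = to_cube (tgt z) by [].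
move: le_ik es et; rewrite leq_eqVlt => /orP[/eqP e|lt_ik]; rewrite ?e ?eqxx ?ltn_eqF // => es et.
  subst i; apply: cube_ext; rewrite ?cube_src_comp_top ?cube_tgt_comp_top ?S0 ?T0 ?es ?et //.
apply: cube_ext; rewrite ?cube_src_comp ?cube_tgt_comp ?S0 ?T0 ?es ?et //.
- rewrite IH //; try exact: (g_src gC).
  exact: (composable_src gC).
- rewrite IH //; try exact: (g_tgt gC).
  exact: (composable_tgt gC).
Qed.

Lemma cube0_neq0 (x : amb Q 0) : is_cell Q x -> x <> set0 :> {set str n}.
Proof. by case=> a _ -> /setP/(_ a); rewrite !inE eqxx. Qed.

(** The two copies and a/X/b are told apart by the boundary, down to the
    objects. *)
Lemma to_cube_inj k (x y : amb (cyl Q) k) : is_cell (cyl Q) x -> is_cell (cyl Q) y ->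
  to_cube x = to_cube y -> x = y.
Proof.
elim: k x y => [|k IH] x y cx cy exy.
  move: (glue_inj exy) cx cy => {exy} e.
  case: x y e => x [y|y] e cx cy.
  - by congr inl; exact: (e (Some false)).
  - by case: (cube0_neq0 cx); exact: (e (Some false)).
  - by case: (cube0_neq0 cx); exact: (e (Some true)).
  - by congr inr; exact: (e (Some true)).
have es : src x = src y.
  apply: IH; [exact: (g_src gC) | exact: (g_src gC) |].
  exact: (congr1 (fun z : amb (cube n.+1) k.+1 => src z) exy).
have et : tgt x = tgt y.
  apply: IH; [exact: (g_tgt gC) | exact: (g_tgt gC) |].
  exact: (congr1 (fun z : amb (cube n.+1) k.+1 => tgt z) exy).
have el s : parts x s = parts y s.
  by apply: glue_inj; rewrite -!tlab_to_cube exy.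
case: x y {exy} es et el cx cy => [h|h|a b u] [g|g|a' b' v] es et el cx cy;
  try (by case: (k) h g es {et el cx cy}); try (by case: (k) h v es et {el cx cy});
  try (by case: (k) u g es et {el cx cy}).
- congr CylL; apply: cube_ext; last exact: (el (Some false)).
    by case: (k) h g es {et el cx cy} => [|j] h g [].
  by case: (k) h g et {es el cx cy} => [|j] h g [].
- congr CylR; apply: cube_ext; last exact: (el (Some true)).
    by case: (k) h g es {et el cx cy} => [|j] h g [].
  by case: (k) h g et {es el cx cy} => [|j] h g [].
have [ea eb] : a = a' /\ b = b'.
  by case: (k) u v es et {el cx cy} => [|j] u v [] // -> [] // ->.
subst a' b'; congr CylM; case: cx cy => [_ _ [cu1 cu2 eu]] [_ _ [cv1 cv2 ev]].
have [s1 s2] : tparallel u.1 v.1 /\ tparallel u.2 v.2.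
  by case: (k) u v es et {el cu1 cu2 eu cv1 cv2 ev} => [|j] u v // [e1 e2] [e3 e4].
rewrite [u]surjective_pairing [v]surjective_pairing; congr pair.
  by apply: (cos_ext lQ cu1 cv1 s1); [exact: (el None) | exact: (el (Some false))].
apply: (cos_ext lQ' cu2 cv2 s2); last exact: (el (Some true)).
by rewrite -eu -ev; exact: (el None).
Qed.

End Step.

Lemma src_bars X (a : amb X 0) m (c0 c1 : cos_amb X m) : cos_cell a c0 -> cos_cell a c1 ->
  tparallel c0 c1 -> ~~ odd m -> src (bar c0) = src (bar c1).
Proof.
case: m c0 c1 => [|m] c0 c1 cc0 cc1; first by rewrite (bar_src0 cc0) (bar_src0 cc1).
by case=> es _ om; rewrite (bar_src_even om cc0) (bar_src_even om cc1) es.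
Qed.

Lemma tgt_bars X (a : amb X 0) m (c0 c1 : cos_amb X m) : cos_cell a c0 -> cos_cell a c1 ->
  tparallel c0 c1 -> odd m -> tgt (bar c0) = tgt (bar c1).
Proof.
case: m c0 c1 => // m c0 c1 cc0 cc1 [_ et] om.
by rewrite (bar_tgt_odd om cc0) (bar_tgt_odd om cc1) et.
Qed.

(** To fill the boundary given by [c0] and [c1] in a coslice over a cell [x], a
    bar between two parallel cells is needed; one of them is [shape_end]. *)
Section Fill.

Variables (X : omega_data) (T : finType) (lab : forall k, amb X k -> {set T}).
Arguments lab {k} _.
Hypotheses (wX : is_omega_category X) (lX : labelled (@lab)).
Variables (a : amb X 0) (m : nat) (c0 c1 : cos_amb X m) (x : amb X m.+1).
Hypotheses (cc0 : cos_cell a c0) (cc1 : cos_cell a c1) (par : tparallel c0 c1).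
Hypotheses (cx : is_cell X x) (sx : src x = base c0) (tx : tgt x = base c1).

(** The bar [idc x] is a placeholder on which whiskering does not depend. *)
Definition shape : cos_amb X m.+1 := ((c0, c1), (x, idc x)).
Definition shape_end : amb X m.+1 := whisk shape x m.+1.

Let fc : cos_frame a shape. Proof. by split. Qed.
Let fx : fits a shape x m.+1. Proof. exact: (base_fits fc sx tx). Qed.

Lemma shape_end_cell : is_cell X shape_end.
Proof. exact: (whisk_cell wX fc). Qed.

Lemma src_shape_end : src shape_end = src (bar c0).
Proof.
case: (boolP (odd m)) => om; first exact: (src_whisk_odd wX om fc cx fx).
exact: (src_whisk_even wX om fc cx fx).
Qed.

Lemma tgt_shape_end : tgt shape_end = tgt (bar c1).
Proof.
case: (boolP (odd m)) => om; first exact: (tgt_whisk_odd wX om fc cx fx).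
exact: (tgt_whisk_even wX om fc cx fx).
Qed.

Lemma lab_shape_end : lab shape_end = lab x :|: lab (bar (if odd m then c1 else c0)).
Proof. by rewrite (lab_whisk_top lX); case: ifP. Qed.

Lemma fill_cell (r : amb X m.+2) : is_cell X r ->
  (if odd m then src r = bar c0 /\ tgt r = shape_end
   else src r = shape_end /\ tgt r = bar c1) ->
  cos_cell a (((c0, c1), (x, r)) : cos_amb X m.+1).
Proof.
move=> cr h; split=> //; split=> //; split=> //.
have -> : whisk (((c0, c1), (x, r)) : cos_amb X m.+1)
    (base (((c0, c1), (x, r)) : cos_amb X m.+1)) m.+1 = shape_end.
  exact: whisk_parallel.
exact: h.
Qed.

End Fill.

Section Step.

Variable n : nat.
Notation Q := (cube n).
Notation lab := (fun k => @tlab (fun _ => {set str n}) k).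
Hypotheses (wQ : is_omega_category Q) (lQ : labelled (X := Q) lab).
Let wQ' := op_omega wQ.
Let lQ' := op_labelled lQ.
Let gC := cyl_globular wQ.

Lemma cube_cellI k (p q : amb Q k) (A : {set str n}) : is_cell Q p -> is_cell Q q ->
  tparallel p q -> A \subset strs n k.+1 -> wf A ->
  moves (tlab p) (bd true A) (bd false A) (tlab q) -> is_cell Q ((p, q, A) : amb Q k.+1).
Proof. by move=> cp cq pq sA wA mA; apply/cube_cellS. Qed.

Section Extend.

Variables (k : nat) (P : symbol -> {set str n}).
Hypotheses (sN : P None \subset strs n k) (sS : forall e, P (Some e) \subset strs n k.+1).
Hypotheses (wP : forall s, wf (P s))
  (dP : forall e, P None :&: bd e (P (Some (e (+) ~~ odd k))) = set0).
Notation g := (glued_bd k P).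

Lemma glued_bd_None e : g e None = bd e (P None).
Proof. by rewrite /glued_bd /= setU0. Qed.

Lemma glued_bd_empty e s : P None = set0 -> g e s = bd e (P s).
Proof. by rewrite /glued_bd => ->; rewrite if_same setU0. Qed.

(** In dimension 0 the strings of [P None] are vertices: each is a passage from
    the left to the right copy, entering the part [P (Some true)] and leaving the
    part [P (Some false)]. *)
Lemma dim0_card t M R : k = 0 -> moves M (g true (Some t)) (g false (Some t)) R ->
  if t then #|R| = #|M| + #|P None| else #|M| = #|R| + #|P None|.
Proof.
move=> k0; move: dP; rewrite /glued_bd /end_face k0 /= => d.
have e : #|bd true (P (Some t))| = #|bd false (P (Some t))|.
  by rewrite !card_bd1 //; move: (sS t); rewrite k0.
case: t e => e; rewrite /= ?setU0; last by apply: moves_card => //; exact: (d true).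
by move/moves_sym; apply: moves_card => //; exact: (d false).
Qed.

(** If both ends of [glue P] avoid the middle and one copy, so does [glue P]: the
    middle part is a cycle, or consists of vertices and is counted by [dim0_card],
    and once it is empty the part in that copy is a cycle as well. *)
Lemma empty_side t :
  moves set0 (g true None) (g false None) set0 ->
  moves set0 (g true (Some t)) (g false (Some t)) set0 ->
  P None = set0 /\ P (Some t) = set0.
Proof.
move=> /moves00 mN mS.
have PN : P None = set0.
  case: (posnP k) => [k0|kp].
    have := dim0_card k0 mS; rewrite cards0 add0n => h.
    by apply: cards0_eq; case: (t) h.
  rewrite !glued_bd_None in mN; apply: (@no_cycle _ k.-1) => //.
  by rewrite prednK.
split=> //; have := moves00 mS; rewrite !glued_bd_empty //.
exact: no_cycle.
Qed.

(** What is needed for [glue P] to be the top label of a cell in the image of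
    [to_cube]. *)
Definition extension (x0 x1 : amb (cyl Q) k) := exists x : amb (cyl Q) k.+1,
  [/\ is_cell (cyl Q) x, src x = x0, tgt x = x1 & forall s, parts x s = P s].

Definition left j : amb Q j -> amb (cyl Q) j :=
  match j return amb Q j -> amb (cyl Q) j with 0 => inl | _.+1 => @CylL Q _ end.
Definition right j : amb Q j -> amb (cyl Q) j :=
  match j return amb Q j -> amb (cyl Q) j with 0 => inr | _.+1 => @CylR Q _ end.

Lemma src_CylL j (h : amb Q j.+1) : src (CylL h : amb (cyl Q) j.+1) = left (src h).
Proof. by case: j h. Qed.

Lemma tgt_CylL j (h : amb Q j.+1) : tgt (CylL h : amb (cyl Q) j.+1) = left (tgt h).
Proof. by case: j h. Qed.

Lemma src_CylR j (h : amb Q j.+1) : src (CylR h : amb (cyl Q) j.+1) = right (src h).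
Proof. by case: j h. Qed.

Lemma tgt_CylR j (h : amb Q j.+1) : tgt (CylR h : amb (cyl Q) j.+1) = right (tgt h).
Proof. by case: j h. Qed.

Lemma extend_left (p q : amb Q k) : is_cell Q p -> is_cell Q q -> tparallel p q ->
  (forall s, moves (parts (left p) s) (g true s) (g false s) (parts (left q) s)) ->
  extension (left p) (left q).
Proof.
have pE (z : amb Q k) s : parts (left z) s = tri (tlab z) set0 set0 s by case: (k) z.
move=> cp cq pq mv.
(* Both ends lie in the left copy, so nothing is left of the other two parts. *)
have [PN PS] : P None = set0 /\ P (Some true) = set0.
  by apply: empty_side; [have := mv None | have := mv (Some true)]; rewrite !pE.
exists (CylL ((p, q, P (Some false)) : amb Q k.+1)); split.
- by apply: cube_cellI => //; have := mv (Some false); rewrite !pE !glued_bd_empty.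
- exact: src_CylL.
- exact: tgt_CylL.
by case=> [[]|].
Qed.

Lemma extend_right (p q : amb Q k) : is_cell Q p -> is_cell Q q -> tparallel p q ->
  (forall s, moves (parts (right p) s) (g true s) (g false s) (parts (right q) s)) ->
  extension (right p) (right q).
Proof.
have pE (z : amb Q k) s : parts (right z) s = tri set0 set0 (tlab z) s by case: (k) z.
move=> cp cq pq mv.
have [PN PS] : P None = set0 /\ P (Some false) = set0.
  by apply: empty_side; [have := mv None | have := mv (Some false)]; rewrite !pE.
exists (CylR ((p, q, P (Some true)) : amb Q k.+1)); split.
- by apply: cube_cellI => //; have := mv (Some true); rewrite !pE !glued_bd_empty.
- exact: src_CylR.
- exact: tgt_CylR.
by case=> [[]|].
Qed.

(** The middle part is a single vertex because the object [a] is. *)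
Lemma extend_mid0 (a b : amb Q 0) : k = 0 -> is_cell Q a -> is_cell Q b ->
  (forall s, moves (tri a set0 set0 s) (g true s) (g false s) (tri set0 set0 b s)) ->
  exists u : bis_amb Q 0, is_cell (bislice a b) u /\
    forall s, parts (CylM a b u : amb (cyl Q) 1) s = P s.
Proof.
move=> k0 ca cb mv; have card_cell (z : amb Q 0) : is_cell Q z -> #|(z : {set str n})| = 1.
  by case=> w _ ->; rewrite cards1.
have sc : is_cell Q (P None : amb Q 0).
  have := dim0_card k0 (mv (Some false)); rewrite /= cards0 add0n (card_cell a) //.
  move/esym/eqP/cards1P=> [w ew]; exists w => //.
  by move: sN; rewrite k0 ew sub1set.
move: sS dP mv; rewrite k0 => sS' d mv.
pose ba : amb Q 1 := (a, P None, P (Some false)).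
pose bb : amb Q 1 := (P None, b, P (Some true)).
have cba : is_cell Q ba.
  apply: cube_cellI => //=.
  have := mv (Some false); rewrite /glued_bd /end_face /= setU0 => m0.
  by have [] := (moves_minus _ _ _ _ _).2 (conj m0 (d true)); rewrite setU0.
have cbb : is_cell Q bb.
  apply: cube_cellI => //=.
  have := mv (Some true); rewrite /glued_bd /end_face /= setU0 => m0.
  by have [] := (moves_plus _ _ _ _ _).2 (conj m0 (d false)); rewrite setU0.
exists (((P None, ba) : cos_amb Q 0), ((P None, bb) : cos_amb (op Q) 0)); split.
  by split=> //; split.
by case=> [[]|].
Qed.

End Extend.

Lemma base_parallel (a : amb Q 0) m (c0 c1 : cos_amb Q m) :
  cos_cell a c0 -> cos_cell a c1 -> tparallel c0 c1 ->
  @tparallel (fun=> {set str n}) m (base c0) (base c1).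
Proof.
case: m c0 c1 => // m c0 c1 cc0 cc1 [es et]; split.
  exact: etrans (src_base cc0) (etrans (congr1 (@base Q m) es) (esym (src_base cc1))).
exact: etrans (tgt_base cc0) (etrans (congr1 (@base Q m) et) (esym (tgt_base cc1))).
Qed.

(** The bars have the labels [P (Some false)] and [P (Some true)] and lie between the
    ends that the slices prescribe; these ends contain [P None] by
    [lab_shape_end], which is the form of (ii) that [moves_minus] and [moves_plus]
    provide. *)
Lemma extend_midS m (P : symbol -> {set str n}) (a b : amb Q 0) (u0 u1 : bis_amb Q m) :
  P None \subset strs n m.+1 -> (forall e, P (Some e) \subset strs n m.+2) ->
  (forall s, wf (P s)) ->
  (forall e, P None :&: bd e (P (Some (e (+) ~~ odd m.+1))) = set0) ->
  is_cell Q a -> is_cell Q b ->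
  is_cell (bislice a b) u0 -> is_cell (bislice a b) u1 ->
  tparallel u0.1 u1.1 -> tparallel u1.2 u0.2 ->
  (forall s, moves (parts (CylM a b u0 : amb (cyl Q) m.+1) s) (glued_bd m.+1 P true s)
    (glued_bd m.+1 P false s) (parts (CylM a b u1 : amb (cyl Q) m.+1) s)) ->
  extension P (CylM a b u0 : amb (cyl Q) m.+1) (CylM a b u1 : amb (cyl Q) m.+1).
Proof.
case: u0 => c0 d0; case: u1 => c1 d1 /= sN sS wP dP ca cb [/= cc0 cd0 e0] [/= cc1 cd1 e1] pc pd mv.
pose x : amb Q m.+1 := (base c0, base c1, P None).
have cx : is_cell Q x.
  apply: cube_cellI => //.
  - exact: base_cell cc0.
  - exact: base_cell cc1.
  - exact: base_parallel cc0 cc1 pc.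
  by have := mv None; rewrite !glued_bd_None.
have R1 := shape_end_cell wQ cc0 cc1 pc cx erefl erefl.
have R2 := src_shape_end wQ cc0 cc1 pc cx erefl erefl.
have R3 := tgt_shape_end wQ cc0 cc1 pc cx erefl erefl.
have R4 := lab_shape_end lQ c0 c1 x.
(* The slice over [b] is a dual, so that its boundary goes from [d1] to [d0]. *)
have S2 : @src (op Q) m x = base d1 by rewrite -e1.
have S3 : @tgt (op Q) m x = base d0 by rewrite -e0.
have T1 := shape_end_cell wQ' cd1 cd0 pd cx S2 S3.
have T2 := src_shape_end wQ' cd1 cd0 pd cx S2 S3.
have T3 := tgt_shape_end wQ' cd1 cd0 pd cx S2 S3.
have T4 := lab_shape_end lQ' d1 d0 x.
have cr0 := bar_cell cc0; have cr1 := bar_cell cc1.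
have cs0 : is_cell Q (bar d0) := bar_cell cd0.
have cs1 : is_cell Q (bar d1) := bar_cell cd1.
pose A := P (Some false); pose B := P (Some true).
pose ra : amb Q m.+2 := if odd m then (bar c0, shape_end c0 c1 x, A) else (shape_end c0 c1 x, bar c1, A).
pose rb : amb Q m.+2 := if odd m then (@shape_end (op Q) m d1 d0 x, bar d1, B)
                        else (bar d0, @shape_end (op Q) m d1 d0 x, B).
have mF := mv (Some false); have mT := mv (Some true).
have mF' : if odd m
  then moves (tlab (bar c0)) (bd true A) (bd false A) (P None :|: tlab (bar c1))
  else moves (P None :|: tlab (bar c0)) (bd true A) (bd false A) (tlab (bar c1)).
  move: mF (dP true) (dP false); rewrite /glued_bd /end_face /=.
  case: (odd m) => /=; rewrite ?setU0 => mF dt df.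
    by have [] := (moves_minus _ _ _ _ _).2 (conj mF dt).
  by have [] := (moves_plus _ _ _ _ _).2 (conj mF df).
have mT' : if odd m
  then moves (P None :|: tlab (bar d0)) (bd true B) (bd false B) (tlab (bar d1))
  else moves (tlab (bar d0)) (bd true B) (bd false B) (P None :|: tlab (bar d1)).
  move: mT (dP true) (dP false); rewrite /glued_bd /end_face /=.
  case: (odd m) => /=; rewrite ?setU0 => mT dt df.
    by have [] := (moves_plus _ _ _ _ _).2 (conj mT df).
  by have [] := (moves_minus _ _ _ _ _).2 (conj mT dt).
have sA : A \subset strs n m.+2 := sS false; have sB : B \subset strs n m.+2 := sS true.
have wA : wf A := wP (Some false); have wB : wf B := wP (Some true).
have cra : is_cell Q ra.
  rewrite /ra; case: ifPn mF' R4 => om mF' R4; apply: cube_cellI => //; rewrite ?R4 //.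
    by split; [exact: esym R2 | exact: etrans (tgt_bars cc0 cc1 pc om) (esym R3)].
  by split; [exact: etrans R2 (src_bars cc0 cc1 pc om) | exact: R3].
have crb : is_cell Q rb.
  rewrite /rb; case: ifPn mT' T4 => om mT' T4; apply: cube_cellI => //; rewrite ?T4 //.
    by split; [exact: etrans T3 (esym (tgt_bars cd1 cd0 pd om)) | exact: T2].
  by split; [exact: esym T3 | exact: etrans (esym (src_bars cd1 cd0 pd om)) (esym T2)].
exists (CylM a b ((((c0, c1), (x, ra)) : cos_amb Q m.+1), (((d1, d0), (x, rb)) : cos_amb (op Q) m.+1))).
split=> //.
  split=> //; split=> //.
    by apply: fill_cell => //; rewrite /ra; case: (odd m).
  by apply: fill_cell => //; rewrite /rb; case: (odd m).
by case=> [[]|] //=; rewrite /bar /= /ra /rb; case: (odd m).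
Qed.

(** By induction the ends of a cell have preimages, which are parallel by
    injectivity; so either they lie in the same copy or they belong to the same
    a/X/b.  Among objects there is one more case, from the right copy to the left
    one, which counting excludes. *)
Lemma to_cube_surj k (y : amb (cube n.+1) k) : is_cell (cube n.+1) y ->
  exists2 x : amb (cyl Q) k, is_cell (cyl Q) x & to_cube x = y.
Proof.
elim: k y => [|k IH] y cy.
  case: cy => w cw ->; have [s [a ew]] := app_surj w; subst w.
  move: cw; rewrite inE count_app addn_eq0 => /andP[sn ca].
  have ca' : a \in strs n 0 by rewrite inE.
  have one e : [set app (Some e) a] = glue (fun s => if s == Some e then [set a] else set0).
    apply/glueP => t b; case: (t =P Some e) => [->|ne]; rewrite !inE.
      by apply/eqP/eqP => [/app_inj[]|->].
    by apply/eqP => /app_inj[].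
  case: s sn => // e _; rewrite one; case: e {one}.
    exists (inr ([set a] : amb Q 0)); first by exists a.
    by apply: eq_glue => -[[]|].
  exists (inl ([set a] : amb Q 0)); first by exists a.
  by apply: eq_glue => -[[]|].
have [[cs ct pst] sy wy my] := (cube_cellS _).1 cy.
have [x0 cx0 e0] := IH _ cs; have [x1 cx1 e1] := IH _ ct.
have [P eP] := glue_surj (tlab y).
move: sy wy my; rewrite eP glue_strs => /andP[sN /forallP sS] /(wf_glue sN)[wP dP].
have -> : tsrc y = to_cube x0 by rewrite e0.
have -> : ttgt y = to_cube x1 by rewrite e1.
rewrite !tlab_to_cube => /(moves_glue sN) mv.
suff [x [cx sx tx px]] : extension P x0 x1.
  exists x => //; apply: cube_ext.
  - by rewrite -e0 -sx.
  - by rewrite -e1 -tx.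
  by rewrite tlab_to_cube eP; apply: eq_glue.
have par : match k return amb (cyl Q) k -> amb (cyl Q) k -> Prop with
    0 => fun _ _ => True | j.+1 => fun x y => src x = src y /\ tgt x = tgt y end x0 x1.
  case: k y x0 x1 cx0 cx1 e0 e1 pst {IH cy cs ct eP sN sS wP dP mv P} => // k y x0 x1 cx0 cx1 e0 e1 pst.
  have [es et] : src (to_cube x0) = src (to_cube x1) /\ tgt (to_cube x0) = tgt (to_cube x1).
    by rewrite e0 e1; exact: pst.
  split; apply: (to_cube_inj wQ lQ) => //; try exact: (g_src gC); exact: (g_tgt gC).
case: k x0 x1 {IH y cy cs ct e0 e1 eP pst} sN sS dP mv cx0 cx1 par => [|k] x0 x1 sN sS dP mv cx0 cx1 par.
  case: x0 x1 mv cx0 cx1 {par} => a [b|b] mv ca cb.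
  - exact: (extend_left sN sS wP dP ca cb I mv).
  - have [u [cu pu]] := extend_mid0 sN sS wP dP erefl ca cb mv.
    by exists (CylM a b u); split.
  - have := dim0_card sS wP dP erefl (mv (Some true)).
    by case: ca => w _ ew; rewrite /= ew cards0 cards1.
  - exact: (extend_right sN sS wP dP ca cb I mv).
case: par => es et; case: x0 x1 es et mv cx0 cx1 => [h|h|a b u] [h'|h'|a' b' u'] es et mv cx0 cx1;
  try (by case: (k) h h' es {et mv cx0 cx1}); try (by case: (k) h u' es et {mv cx0 cx1});
  try (by case: (k) u h' es et {mv cx0 cx1}).
- apply: (extend_left sN sS wP dP cx0 cx1 _ mv).
  by case: (k) h h' es et {mv cx0 cx1} => [|j] h h' [e1] [e2]; split.
- apply: (extend_right sN sS wP dP cx0 cx1 _ mv).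
  by case: (k) h h' es et {mv cx0 cx1} => [|j] h h' [e1] [e2]; split.
have [ea eb] : a = a' /\ b = b'.
  by case: (k) u u' es et {mv cx0 cx1} => [|j] u v [] // -> [] // ->.
subst a' b'; case: cx0 cx1 => [ca cb cu] [_ _ cu'].
apply: (extend_midS sN sS wP dP ca cb cu cu' _ _ mv).
  by case: (k) u u' es et {mv cu cu'} => [|j] [u v] [u' v'] // [e1 e2] [e3 e4].
by case: (k) u u' es et {mv cu cu'} => [|j] [u v] [u' v'] // [e1 e2] [e3 e4].
Qed.

End Step.

(** The bars of the factors of a composite are composable after whiskering, which
    does not change labels. *)
Lemma bar_disjoint X (T : finType) (lab : forall k, amb X k -> {set T}) (a : amb X 0)
    k n (y x : cos_amb X k) : is_omega_category X -> labelled lab -> n < k ->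
  cos_cell a y -> cos_cell a x -> @composable (coslice a) k n y x ->
  lab _ (bar y) :&: lab _ (bar x) = set0.
Proof.
move=> wX lX lt_nk cy cx yx; have lt_nk1 : n < k.+1 by apply: ltnW.
have cby := bar_cell cy; have cbx := bar_cell cx; have cm := mid_cell wX lt_nk cy cx yx.
have := mid_inner wX lt_nk cy cx yx; have := mid_outer wX lt_nk cy cx yx.
case: ifP => on co ci.
  have := lab_disj lX _ (comp_cell wX lt_nk1 cby cm ci) cbx co.
  by rewrite (lab_comp lX) // (lab_mid lX) // setU0; apply.
have := lab_disj lX _ cby (comp_cell wX lt_nk1 cm cbx ci) co.
by rewrite (lab_comp lX) // (lab_mid lX) // set0U; apply.
Qed.

Section Step.

Variable n : nat.
Notation Q := (cube n).
Notation lab := (fun k => @tlab (fun _ => {set str n}) k).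
Hypotheses (wQ : is_omega_category Q) (lQ : labelled (X := Q) lab).
Let wQ' := op_omega wQ.
Let lQ' := op_labelled lQ.
Let gC := cyl_globular wQ.

Lemma parts_disjoint k i (y x : amb (cyl Q) k.+1) : i <= k -> is_cell (cyl Q) y ->
  is_cell (cyl Q) x -> composable i y x -> forall s, parts y s :&: parts x s = set0.
Proof.
move=> le_ik cy cx yx s; move: cy cx (le_ik).
case: (cyl_composableP le_ik yx) => {le_ik i y x yx}
  [i h g hg|i h g hg|a b u h th|a b h u sh|i a b [v v'] [u u'] e1 e2].
- by case: s => [[]|] ch cg le_ik; rewrite /= ?set0I //; apply: (lab_disj lQ _ ch cg hg).
- by case: s => [[]|] ch cg le_ik; rewrite /= ?set0I //; apply: (lab_disj lQ _ ch cg hg).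
- case: s => [[]|] [_ _ [cu _ _]] ch _; rewrite /= ?setI0 //.
  by apply: (lab_disj lQ (n := 0) _ (bar_cell cu) ch) => //; rewrite /composable th (sbd0_bar wQ cu).
- case: s => [[]|] ch [_ _ [_ cu _]] _; rewrite /= ?set0I //.
  apply: (lab_disj lQ (n := 0) _ ch (bar_cell cu)) => //.
  by rewrite /composable sh; apply: (sbd0_bar wQ' cu).
move=> [_ _ [cv cv' _]] [_ _ [cu cu' _]] lt_ik; case: s => [[]|] /=.
- by rewrite setIC; apply: (bar_disjoint wQ' lQ' lt_ik cu' cv' (esym e2)).
- exact: (bar_disjoint wQ lQ lt_ik cv cu e1).
exact: (lab_disj lQ lt_ik (base_cell cv) (base_cell cu) (base_composable lt_ik cv cu e1)).
Qed.

Lemma to_cube_functor : is_omega_functor (@to_cube n).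
Proof.
split=> //.
- exact: to_cube_cell.
- by move=> k x _; apply: to_cube_idc.
- exact: to_cube_comp.
Qed.

Let F_inj := to_cube_inj wQ lQ.
Let F_surj := to_cube_surj wQ lQ.

Lemma to_cube_isomorphic : isomorphic (cyl Q) (cube n.+1).
Proof.
apply: (bijective_isomorphic gC to_cube_functor F_inj F_surj).
- exact: (cyl_idc_cell wQ lQ).
- exact: (cyl_comp_cell wQ lQ).
by case=> [|k]; constructor; [exact: inl set0 | exact: CylL (lift k.+1 (set0 : amb Q 0))].
Qed.

(** Composites exist in the cylinder and [to_cube] preserves them. *)
Lemma cubeS_omega : is_omega_category (cube n.+1).
Proof.
apply: cube_omega => k i y x lt_ik cy cx.
have [v cv <-] := F_surj cy; have [u cu <-] := F_surj cx.
move/(functor_composable_inv gC to_cube_functor F_inj (ltnW lt_ik) cv cu) => vu.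
by rewrite -to_cube_comp //; apply: to_cube_cell => //; apply: (cyl_comp_cell wQ lQ).
Qed.

Lemma cubeS_labelled : @labelled (cube n.+1) (str n.+1) (fun k => @tlab _ k).
Proof.
apply: cube_labelled => k i y x lt_ik cy cx.
have [v cv <-] := F_surj cy; have [u cu <-] := F_surj cx.
move/(functor_composable_inv gC to_cube_functor F_inj (ltnW lt_ik) cv cu) => vu.
case: k v u lt_ik {y x cy cx} cv cu vu => // k v u lt_ik cv cu vu.
rewrite !tlab_to_cube glueI -(glue0 n); apply: eq_glue.
exact: parts_disjoint vu.
Qed.

End Step.

Lemma terminal_omega : is_omega_category terminal.
Proof.
have u (x y : unit) : x = y by case: x; case: y.
by split=> //= *; apply: u.
Qed.

Lemma terminal_cube0 : isomorphic terminal (cube 0).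
Proof.
have w0 := cube_omega cube0_closed.
pose pt : amb (cube 0) 0 := [set [tuple]].
have cpt : is_cell (cube 0) pt by exists [tuple] => //; rewrite inE.
have c0 k : is_cell (cube 0) (lift k pt) by apply: lift_cell.
exists (fun k _ => lift k pt), (fun _ _ => tt); split=> //.
- split=> // k i y x lt_ik cy cx yx /=; apply: cube0_cell_uniq => //.
  by apply: cube0_closed => //; rewrite /composable tbd_lift_ge // ?sbd_lift_ge // ltnW.
- by move=> k x _; case: x.
by move=> k y cy; apply: cube0_cell_uniq (c0 k) cy.
Qed.

Theorem theorem10 (n : nat) :
  [/\ is_omega_category (iter n cyl terminal),
      is_omega_category (cube n)
    & isomorphic (iter n cyl terminal) (cube n)].
Proof.
suff [? ? ? _] : [/\ is_omega_category (iter n cyl terminal), is_omega_category (cube n),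
    isomorphic (iter n cyl terminal) (cube n)
  & @labelled (cube n) (str n) (fun k => @tlab _ k)] by [].
elim: n => [|n [wC wQ iso lQ]].
  split; [exact: terminal_omega | exact: cube_omega cube0_closed | exact: terminal_cube0 |].
  exact: cube_labelled cube0_disjoint.
have wQ' := cubeS_omega wQ lQ.
have iso' : isomorphic (iter n.+1 cyl terminal) (cube n.+1).
  apply: isomorphic_trans (cyl_isomorphic wC wQ iso) (to_cube_isomorphic wQ lQ).
    exact: cyl_globular.
  exact: omega_globular.
split=> //; last exact: cubeS_labelled.
by have [f [g [ff fg gK _]]] := iso'; apply: transport_omega ff fg gK.
Qed.
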